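(* Let $\mathcal Z\subseteq\mathbb R^d$ be a nonempty closed convex set, let $F_1,\dots,F_n:\mathcal Z\to\mathbb R^d$, let $F=\frac1n\sum_{i=1}^nF_i$, and let $L,\mu,\delta>0$. Assume: (1) each $F_i$ is $L$-Lipschitz on $\mathcal Z$: $\|F_i(u)-F_i(v)\|\le L\|u-v\|$ for all $u,v\in\mathcal Z$; (2) $F$ is $\mu$-strongly monotone on $\mathcal Z$: $\langle F(u)-F(v),u-v\rangle\ge\mu\|u-v\|^2$ for all $u,v\in\mathcal Z$, and each $F_i$ is monotone on $\mathcal Z$: $\langle F_i(u)-F_i(v),u-v\rangle\ge 0$; (3) for every $j\in\{1,\dots,n\}$ and all $u,v\in\mathcal Z$, $\frac1n\sum_{i=1}^n\|F_i(u)-F_j(u)-F_i(v)+F_j(v)\|^2\le\delta^2\|u-v\|^2$. Let $z^*\in\mathcal Z$ be the solution of the variational inequality $\langle F(z^* ),z-z^*\rangle\ge0$ for all $z\in\mathcal Z$. Let $\{z^k\}_{k\ge0}$ be the iterates of the Three Pillars Algorithm with Partial Participation (defined in the context) with parameters $$\tau=p\le\tfrac14,\qquad \gamma=\min\left\{\frac{p}{3\mu},\ \frac{\sqrt p}{4\delta},\ \frac1L\left(\frac{H}{4\log\frac{40L}{\mu p}}-1\right)\right\},\qquad \eta=\frac{1}{4\left(L+\frac1\gamma\right)},\qquad H\ge 8\log\frac{40L}{\mu p}.$$ Then for every $K\ge 0$, $$\mathbb E\left[\|z^K-z^*\|^2\right]\le\left(1-\frac{\gamma\mu}{2}\right)^K\cdot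 2\|z^0-z^*\|^2 .$$
   Context: $\|\cdot\|$ is the Euclidean norm, $\mathrm{proj}_{\mathcal Z}$ the Euclidean projection onto $\mathcal Z$, $\log$ the natural logarithm. Three Pillars Algorithm with Partial Participation. Parameters: $\gamma,\eta>0$, $\tau$, $p\in(0,1]$, integer $H\ge1$. Start from any $z^0=m^0\in\mathcal Z$. For $k=0,1,2,\dots$: (a) set $u_0^k=z^k$; for $t=0,\dots,H-1$ compute $u^k_{t+1/2}=\mathrm{proj}_{\mathcal Z}\big[u^k_t-\eta\big(F_1(u^k_t)-F_1(m^k)+F(m^k)+\frac1\gamma(u^k_t-z^k-\tau(m^k-z^k))\big)\big]$, $u^k_{t+1}=\mathrm{proj}_{\mathcal Z}\big[u^k_t-\eta\big(F_1(u^k_{t+1/2})-F_1(m^k)+F(m^k)+\frac1\gamma(u^k_{t+1/2}-z^k-\tau(m^k-z^k))\big)\big]$; (b) draw $i_k$ uniformly from $\{1,\dots,n\}$, independently of the past, and set $z^{k+1}=\mathrm{proj}_{\mathcal Z}\big[u^k_H+\gamma\big(F_{i_k}(m^k)-F_1(m^k)-F_{i_k}(u^k_H)+F_1(u^k_H)\big)\big]$; (c) independently of the past, set $m^{k+1}=z^k$ with probability $p$ and $m^{k+1}=m^k$ with probability $1-p$. *)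

(* Defs.v *)
From HB Require Import structures.
From mathcomp Require Import all_boot all_order all_algebra.
From mathcomp Require Import all_classical all_reals all_analysis.
Set Implicit Arguments.
Unset Strict Implicit.
Unset Printing Implicit Defensive.
Import Order.TTheory GRing.Theory Num.Theory.
Import numFieldNormedType.Exports.
Local Open Scope classical_set_scope.
Local Open Scope ring_scope.

Definition dotv (R : realType) (d : nat) (u v : 'rV[R]_d) : R :=
  \sum_j u ord0 j * v ord0 j.

(* The library norm on ['rV[R]_d] is the sup norm, hence this definition. *)
Definition enorm (R : realType) (d : nat) (u : 'rV[R]_d) : R :=
  Num.sqrt (dotv u u).

(* A nearest point of [Z]: it exists and is unique for [Z] nonempty, closed
   and convex; the default value 0 is used only when no nearest point exists. *)
Definition proj (R : realType) (d : nat) (Z : set 'rV[R]_d) (x : 'rV[R]_d)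
    : 'rV[R]_d :=
  xget 0 [set y | Z y /\ forall y', Z y' -> enorm (x - y) <= enorm (x - y')].

(* The operators F_1, ..., F_n are indexed by ['I_n.+1] (so that there is at
   least one), and [ord0] is the index of F_1.  They are total functions, only
   their values on Z being relevant. *)
Definition avg_op (R : realType) (d n : nat)
    (F : 'I_n.+1 -> 'rV[R]_d -> 'rV[R]_d) (x : 'rV[R]_d) : 'rV[R]_d :=
  n.+1%:R^-1 *: \sum_i F i x.

Definition inner_op (R : realType) (d n : nat)
    (F : 'I_n.+1 -> 'rV[R]_d -> 'rV[R]_d) (gamma tau : R)
    (z m u : 'rV[R]_d) : 'rV[R]_d :=
  F ord0 u - F ord0 m + avg_op F m + gamma^-1 *: (u - z - tau *: (m - z)).

Definition inner_step (R : realType) (d n : nat) (Z : set 'rV[R]_d)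
    (F : 'I_n.+1 -> 'rV[R]_d -> 'rV[R]_d) (gamma eta tau : R)
    (z m u : 'rV[R]_d) : 'rV[R]_d :=
  let u_half := proj Z (u - eta *: inner_op F gamma tau z m u) in
  proj Z (u - eta *: inner_op F gamma tau z m u_half).

Definition inner_loop (R : realType) (d n : nat) (Z : set 'rV[R]_d)
    (F : 'I_n.+1 -> 'rV[R]_d -> 'rV[R]_d) (gamma eta tau : R) (H : nat)
    (z m : 'rV[R]_d) : 'rV[R]_d :=
  iter H (inner_step Z F gamma eta tau z m) z.

Definition outer_step (R : realType) (d n : nat) (Z : set 'rV[R]_d)
    (F : 'I_n.+1 -> 'rV[R]_d -> 'rV[R]_d) (gamma eta tau : R) (H : nat)
    (i : 'I_n.+1) (z m : 'rV[R]_d) : 'rV[R]_d :=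
  let u := inner_loop Z F gamma eta tau H z m in
  proj Z (u + gamma *: (F i m - F ord0 m - F i u + F ord0 u)).

(* The pair (z^k, m^k) as a function of the realized draws: [idx k] is i_k and
   [coin k] tells whether m^(k+1) is z^k (true) or m^k (false). *)
Fixpoint three_pillars (R : realType) (d n : nat) (Z : set 'rV[R]_d)
    (F : 'I_n.+1 -> 'rV[R]_d -> 'rV[R]_d) (gamma eta tau : R) (H : nat)
    (z0 : 'rV[R]_d) (idx : nat -> 'I_n.+1) (coin : nat -> bool) (k : nat)
    : 'rV[R]_d * 'rV[R]_d :=
  if k is k'.+1 then
    let: (z, m) := three_pillars Z F gamma eta tau H z0 idx coin k' in
    (outer_step Z F gamma eta tau H (idx k') z m, if coin k' then z else m)
  else (z0, z0).

(* The sigma-algebra generated by i_0, ..., i_(a-1) and the first b coins. *)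
Definition past (Om : Type) (n : nat) (idx : nat -> Om -> 'I_n.+1)
    (coin : nat -> Om -> bool) (a b : nat) : set (set Om) :=
  <<s [set A | (exists2 j, (j < a)%N & exists B, A = idx j @^-1` B) \/
               (exists2 j, (j < b)%N & exists B, A = coin j @^-1` B)] >>.

(* [X] takes values in a discrete space, all of whose subsets are events. *)
Definition independent_of (R : realType) (dd : measure_display)
    (Om : measurableType dd) (P : probability Om R) (I : Type) (X : Om -> I)
    (G : set (set Om)) : Prop :=
  forall A B, G A -> P (A `&` X @^-1` B) = (P A * P (X @^-1` B))%E.

(* Within round k the index i_k is drawn before the coin, so that the past of
   the coin contains i_k. *)
Definition algorithm_draws (R : realType) (dd : measure_display)
    (Om : measurableType dd) (P : probability Om R) (n : nat) (p : R)
    (idx : nat -> Om -> 'I_n.+1) (coin : nat -> Om -> bool) : Prop :=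
  [/\ forall k B, measurable (idx k @^-1` B),
      forall k B, measurable (coin k @^-1` B),
      forall k i, P [set w | idx k w = i] = (n.+1%:R^-1)%:E,
      forall k, P [set w | coin k w = true] = p%:E &
      forall k, independent_of P (idx k) (past idx coin k k) /\
                independent_of P (coin k) (past idx coin k.+1 k)].

(* Main.v *)
(* Let u be the exact solution of the inner problem at (z, m), x = 40 L / (mu p) and
   t = gamma mu.  The three-point identities at u, together with similarity of the F_i,
   show that one round contracts |z - z*|^2 + |m - z*|^2 by 1 - t/2 in expectation as soon
   as the inner loop returns a point at squared distance at most th |z - u|^2 of u, where
   10 th <= t.  If mu > L, then Z has one point.  If L gamma >= p/4, then H is at least
   4 (1 + L gamma) ln x, which gives th = 1/x and 10/x <= t.  If L gamma <= 1/16, then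
   H >= 8 ln x gives th = x^-3.

   There remains the case t < 10 x^-3, where the inner loop is too inaccurate for a
   comparison round by round.  There eps = gamma L is tiny, so that the inner problem is
   almost the projection of a point on Z, and the error of the loop is not arbitrary: for
   each y in Z, the output is close to u - lam (u - y), lam = (13/16)^H, up to an error
   measured by |z - y|^2 and by the pairing of the normal vector at u with u - y.  Taking
   for y the point of the same form in the previous round makes these terms summable.
   They are dominated by a potential which compares z and m with the shadow sequences y
   and mb of such points, contains the squared length of the last displacement, and
   carries weights w that increase with the number of rounds.  The potential contracts
   by 1 - t/2 and starts below (5/2) |z0 - z*|^2; since m lags behind z, the term
   |z - z*|^2 alone is at most 3/4 of it in the long run, hence the factor 2. *)

Require Import Defs.
From HB Require Import structures.
From mathcomp Require Import all_boot all_order all_algebra.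
From mathcomp Require Import all_classical all_reals all_analysis.
From mathcomp Require Import measurable_realfun.
From mathcomp Require Import ring lra.
Set Implicit Arguments.
Unset Strict Implicit.
Unset Printing Implicit Defensive.
Import Order.TTheory GRing.Theory Num.Theory.
Import numFieldNormedType.Exports.
Local Open Scope classical_set_scope.
Local Open Scope ring_scope.
Local Notation proj := Defs.proj.

(** * Euclidean inner product *)

(** A comparison round by round has to pay for the pairing of the inner error [e] with [q], the
    difference between the exact point [u] and [zstar]. Only [t * |q|^2] is available, at the price
    [|e|^2 / t]; hence the requirement [10 * th <= t], which fails when [t] is much smaller than the
    accuracy that [H] guarantees. The way out is that a component [lam * (z - u)] of [e] is
    harmless: it mixes the exact point with the old one, and the sum of the squared distances
    remains a potential once the anchor term is multiplied by [1 - lam]. Only the rest of [e] is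
    charged to [tau * |q|^2], and as long as the weights grow, [tau] is financed by a slow decrease
    of the factor in front of the distances, which stays between [1] and [112 / 100]. This budget
    does not depend on the number of rounds, so the errors must be summable against growing weights.
    The squared displacement provides this: its potential decreases by the very pairing with the
    normal vector that bounds the alignment error. *)

Section euclidean.
Variables (R : realType) (d : nat).
Implicit Types u v w x y : 'rV[R]_d.

Lemma dotvC u v : dotv u v = dotv v u.
Proof. by apply: eq_bigr => j _; rewrite mulrC. Qed.

Lemma dotvDl u v w : dotv (u + v) w = dotv u w + dotv v w.
Proof. by rewrite /dotv -big_split; apply: eq_bigr => j _; rewrite mxE mulrDl. Qed.

Lemma dotvZl a u w : dotv (a *: u) w = a * dotv u w.
Proof. by rewrite /dotv mulr_sumr; apply: eq_bigr => j _; rewrite mxE mulrA. Qed.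

Lemma dotvNl u w : dotv (- u) w = - dotv u w.
Proof. by rewrite -scaleN1r dotvZl mulN1r. Qed.

Lemma dotvDr u v w : dotv w (u + v) = dotv w u + dotv w v.
Proof. by rewrite dotvC dotvDl !(dotvC w). Qed.

Lemma dotvZr a u w : dotv w (a *: u) = a * dotv w u.
Proof. by rewrite dotvC dotvZl (dotvC w). Qed.

Lemma dotvNr u w : dotv w (- u) = - dotv w u.
Proof. by rewrite dotvC dotvNl (dotvC w). Qed.

Definition dotvE := (dotvDl, dotvDr, dotvNl, dotvNr, dotvZl, dotvZr).

Lemma dotv_sqrB u v : dotv (u - v) (u - v) = dotv u u - 2 * dotv u v + dotv v v.
Proof. by rewrite !dotvE (dotvC v u); ring. Qed.

Lemma dotv_sqrD u v : dotv (u + v) (u + v) = dotv u u + 2 * dotv u v + dotv v v.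
Proof. by rewrite !dotvE (dotvC v u); ring. Qed.

Lemma dotv0l w : dotv 0 w = 0.
Proof. by rewrite -(scale0r 0) dotvZl mul0r. Qed.

Lemma dotv_suml (I : finType) (f : I -> 'rV[R]_d) w :
  dotv (\sum_i f i) w = \sum_i dotv (f i) w.
Proof.
by elim/big_ind2: _ => [|? ? ? ? <- <-|//]; rewrite ?dotv0l ?dotvDl.
Qed.

Lemma dotv_ge0 u : 0 <= dotv u u.
Proof. by apply: sumr_ge0 => j _; rewrite -expr2 sqr_ge0. Qed.

Lemma dotv_eq0 u : dotv u u <= 0 -> u = 0.
Proof.
move=> u0; have /eqP : dotv u u = 0 by apply/eqP; rewrite eq_le u0 dotv_ge0.
rewrite psumr_eq0 => [/allP h|j _]; last by rewrite -expr2 sqr_ge0.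
apply/rowP => j; rewrite mxE.
by have := h j (mem_index_enum j); rewrite mulf_eq0 orbb => /eqP.
Qed.

Lemma enorm_ge0 u : 0 <= enorm u. Proof. exact: sqrtr_ge0. Qed.

Lemma sqr_enorm u : enorm u ^+ 2 = dotv u u.
Proof. by rewrite sqr_sqrtr// dotv_ge0. Qed.

Lemma enormN u : enorm (- u) = enorm u.
Proof. by rewrite /enorm dotvNl dotvNr opprK. Qed.

Lemma dotv_young (c : R) u v : 0 < c ->
  2 * dotv u v <= c * dotv u u + c^-1 * dotv v v.
Proof.
move=> c0; have := dotv_ge0 (c *: u - v); rewrite !dotvE (dotvC v u) => h.
rewrite -(ler_pM2l c0) mulrDr !mulrA divff ?gt_eqF// mul1r.
lra.
Qed.

Lemma dotv_le_enorm u v : dotv u v <= enorm u * enorm v.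
Proof.
have := dotv_ge0 (enorm v *: u - enorm u *: v).
rewrite !dotvE (dotvC v u) -!sqr_enorm.
have := enorm_ge0 u; have := enorm_ge0 v; rewrite le_eqVlt => /orP[/eqP v0 _ _|v0].
  have -> : v = 0 by apply: dotv_eq0; rewrite -sqr_enorm -v0 expr0n.
  by rewrite dotvC dotv0l mulr_ge0// enorm_ge0.
rewrite le_eqVlt => /orP[/eqP u0 _|u0 h].
  have -> : u = 0 by apply: dotv_eq0; rewrite -sqr_enorm -u0 expr0n.
  by rewrite dotv0l mulr_ge0// enorm_ge0.
have uv0 : 0 < enorm u * enorm v by rewrite mulr_gt0.
by rewrite -(ler_pM2l uv0); lra.
Qed.

Lemma ler_enormD u v : enorm (u + v) <= enorm u + enorm v.
Proof.
rewrite -(@ler_pXn2r _ 2)// ?nnegrE ?addr_ge0 ?enorm_ge0//.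
rewrite sqr_enorm !dotvE (dotvC v u) -!sqr_enorm.
by have := dotv_le_enorm u v; lra.
Qed.

Lemma ler_enorm_dist u v : `|enorm u - enorm v| <= enorm (u - v).
Proof.
have h1 := ler_enormD (u - v) v; have h2 := ler_enormD (v - u) u.
rewrite !subrK in h1 h2; rewrite -opprB enormN in h2.
by rewrite ler_norml; apply/andP; split; lra.
Qed.

Lemma enorm_le_norm u : enorm u <= Num.sqrt d%:R * `|u|.
Proof.
rewrite -(@ler_pXn2r _ 2)// ?nnegrE ?mulr_ge0 ?enorm_ge0 ?sqrtr_ge0//.
rewrite sqr_enorm exprMn sqr_sqrtr ?ler0n//.
apply: (@le_trans _ _ (\sum_(j < d) `|u| ^+ 2)).
  apply: ler_sum => j _; rewrite -expr2 -[leLHS]real_normK ?num_real//.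
  rewrite ler_pXn2r ?nnegrE//.
  rewrite [leRHS]/Num.norm /= mx_normrE; apply/bigmax_geP; right => /=.
  by exists (ord0, j).
by rewrite sumr_const card_ord mulr_natl.
Qed.

Lemma norm_le_enorm u : `|u| <= enorm u.
Proof.
rewrite [leLHS]/Num.norm /= mx_normrE; apply/bigmax_leP; split; first exact: enorm_ge0.
case=> i j _ /=; rewrite (ord1 i) -(@ler_pXn2r _ 2)// ?nnegrE ?enorm_ge0//.
rewrite sqr_enorm real_normK ?num_real// /dotv (bigD1 j)//= -expr2 lerDl.
by apply: sumr_ge0 => k _; rewrite -expr2 sqr_ge0.
Qed.

(** The topology is that of the sup norm; the comparison of the two norms transfers Lipschitz bounds
    from the Euclidean one. *)
Lemma enorm_lipschitz_continuous (f : 'rV[R]_d -> R) (K : R) :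
  (forall u v, `|f u - f v| <= K * enorm (u - v)) -> continuous f.
Proof.
move=> fK u; apply/(@cvgrPdist_le _ _ _ _ (nbhs_filter u)) => e e0.
pose C := (`|K| + 1) * (Num.sqrt d%:R + 1).
have C0 : 0 < C by rewrite mulr_gt0// ltr_wpDl// sqrtr_ge0.
apply/nbhs_ballP; exists (e / C) => [|v]; first by rewrite /= divr_gt0.
rewrite -ball_normE /= => /ltW uv.
apply: le_trans (fK _ _) _; apply: (@le_trans _ _ (C * `|u - v|)).
  apply: (@le_trans _ _ ((`|K| + 1) * (Num.sqrt d%:R * `|u - v|))).
    apply: (@le_trans _ _ ((`|K| + 1) * enorm (u - v))).
      by rewrite ler_wpM2r ?enorm_ge0//; have := ler_norm K; lra.
    by rewrite ler_wpM2l ?enorm_le_norm// addr_ge0.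
  by rewrite /C -mulrA ler_wpM2l ?addr_ge0// ler_wpM2r// lerDl.
by rewrite mulrC -ler_pdivlMr.
Qed.

Lemma enorm_ball_compact (x : 'rV[R]_d) (M : R) (A : set 'rV[R]_d) : closed A ->
  compact (A `&` [set y | enorm (x - y) <= M]).
Proof.
move=> cA; apply: bounded_closed_compact.
  exists (M + enorm x); split; first exact: num_real.
  move=> r Mr y [_ /= yM]; apply: le_trans (norm_le_enorm _) _.
  have := ler_enorm_dist y x.
  rewrite -[enorm (y - x)]enormN opprB ler_norml => /andP[_].
  by move=> h; lra.
apply: closedI => //.
have -> : [set y | enorm (x - y) <= M] = (fun y => enorm (x - y)) @^-1` [set r | r <= M] by [].
apply: closed_comp; last exact: closed_le.
move=> y _; apply: (@enorm_lipschitz_continuous _ 1) => u v.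
rewrite mul1r; apply: le_trans (ler_enorm_dist _ _) _.
by rewrite opprB addrC addrA subrK -[leLHS]enormN opprB.
Qed.

(** The displacement [h] attains its minimum at some [c], and [T] would reduce a positive minimum by
    the factor [r]. Compactness replaces the limit of the iterates. *)
Lemma contraction_fixpoint (T : 'rV[R]_d -> 'rV[R]_d) (r : R) :
  0 <= r -> r < 1 -> (forall u v, enorm (T u - T v) <= r * enorm (u - v)) ->
  exists x, T x = x.
Proof.
move=> r0 r1 Tr; pose h v := enorm (v - T v).
have hc : continuous h.
  apply: (@enorm_lipschitz_continuous _ 2) => u v.
  apply: le_trans (ler_enorm_dist _ _) _.
  have -> : u - T u - (v - T v) = (u - v) - (T u - T v).
    by apply/rowP => j; rewrite !mxE; ring.
  apply: le_trans (ler_enormD _ _) _; rewrite enormN.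
  have := Tr u v; have := enorm_ge0 (u - v).
  move=> n0 h0; apply: (@le_trans _ _ (enorm (u - v) + r * enorm (u - v))); first by lra.
  by nra.
(* Outside this ball the displacement is at least [(1 - r) * |v| - |T 0|], which exceeds
   [|T 0| = h 0]; the minimum over the ball is therefore global. *)
pose M := 2 * h 0 / (1 - r).
have M0 : 0 <= M by rewrite divr_ge0 ?mulr_ge0 ?enorm_ge0// subr_ge0 ltW.
have [|c cA cmin] := @EVT_min_rV R d h (setT `&` [set y | enorm (0 - y) <= M]) _
   (@enorm_ball_compact 0 M _ closedT) (continuous_subspaceT hc).
  by exists 0; split => //=; rewrite subr0 /enorm dotv0l sqrtr0.
have cglob v : h c <= h v.
  have [vM|vM] := leP (enorm v) M; first by apply: cmin; rewrite inE; split => //=; rewrite sub0r enormN.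
  apply: (@le_trans _ _ (h 0)).
    by apply: cmin; rewrite inE; split => //=; rewrite subr0 /enorm dotv0l sqrtr0.
  have := ler_enormD (v - T v) (T v - T 0); have := ler_enormD (v - T 0) (T 0).
  rewrite subrK addrA subrK => h1 h2; have := Tr v 0; rewrite subr0.
  have -> : h 0 = enorm (T 0) by rewrite /h sub0r enormN.
  have hv : 2 * enorm (T 0) < enorm v * (1 - r).
    by move: vM; rewrite /M ltr_pdivrMr ?subr_gt0// /h sub0r enormN.
  by rewrite -/(h v) in h2 => h3; lra.
exists c; apply/esym/eqP; rewrite -subr_eq0; apply/eqP/dotv_eq0.
have := cglob (T c); have := Tr c (T c); rewrite -/(h c) -/(h (T c)) => h1 h2.
have h0 : 0 <= h c := enorm_ge0 _.
have hc0 : h c = 0 by nra.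
by rewrite -sqr_enorm -/(h c) hc0 expr0n.
Qed.

End euclidean.

(** * Projections and extragradient steps *)

Section projection.
Variables (R : realType) (d : nat) (Z : set 'rV[R]_d).
Hypotheses (Z_nonempty : Z !=set0) (Z_closed : closed Z)
  (Z_convex : @convex_set R 'rV[R]_d Z).

Lemma segment_in (x y : 'rV[R]_d) (t : R) : 0 <= t -> t <= 1 -> Z x -> Z y ->
  Z (x + t *: (y - x)).
Proof.
move=> t0 t1 Zx Zy; have := @Z_convex y x (Itv01 t0 t1).
rewrite !inE => /(_ Zy Zx); congr (Z _).
by apply/rowP => j; rewrite !mxE /= /unstable.onem; ring.
Qed.

Lemma proj_spec (x : 'rV[R]_d) : Z (proj Z x) /\
  forall y, Z y -> dotv (x - proj Z x) (y - proj Z x) <= 0.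
Proof.
have [y0 Zy0] := Z_nonempty.
have [||c] := @EVT_min_rV R d (fun y => enorm (x - y))
    (Z `&` [set y | enorm (x - y) <= enorm (x - y0)]) _ (@enorm_ball_compact _ _ _ _ _ Z_closed).
- by exists y0; split => /=.
- apply: continuous_subspaceT; apply: (@enorm_lipschitz_continuous _ _ _ 1) => u v.
  rewrite mul1r; apply: le_trans (ler_enorm_dist _ _) _.
  by rewrite opprB addrC addrA subrK -[leLHS]enormN opprB.
rewrite inE => -[Zc cy0] cmin.
have : [set y | Z y /\ forall y', Z y' -> enorm (x - y) <= enorm (x - y')] c.
  split=> // y Zy; have [yy|yy] := leP (enorm (x - y)) (enorm (x - y0)).
    by apply: cmin; rewrite inE.
  exact: le_trans cy0 (ltW yy).
move=> /(xgetI 0); rewrite -/(proj Z x); set q := proj Z x => -[Zq qmin].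
split=> // y Zy; rewrite leNgt; apply/negP => g0.
set g := dotv _ _ in g0; pose N := dotv (y - q) (y - q).
have N0 : 0 <= N := dotv_ge0 _.
(* Moving from [q] towards [y] by the fraction [t] would come closer to [x]: minimality of [q] gives
   [2 * g <= t * N], whereas [t * N < g] for this [t]. *)
pose t := g / (g + N).
have gN : 0 < g + N by lra.
have t0 : 0 < t by rewrite divr_gt0.
have t1 : t <= 1 by rewrite ler_pdivrMr// mul1r lerDl.
have := qmin _ (segment_in (ltW t0) t1 Zq Zy).
rewrite -(@ler_pXn2r _ 2)// ?nnegrE ?enorm_ge0// !sqr_enorm opprD addrA.
rewrite [X in _ <= X -> _]dotvDl [in X in _ <= X -> _]dotvDr [in X in _ <= _ + X -> _]dotvDr.
rewrite !(dotvNr (t *: _)) !(dotvNl (t *: _)) !(dotvZl t) !(dotvZr t) -/N (dotvC (y - q)) -/g => h.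
have h2 : 2 * g <= t * N.
  by rewrite -(ler_pM2l t0); lra.
have tE : t * (g + N) = g by rewrite /t divfK// gt_eqF.
nra.
Qed.

Lemma proj_in (x : 'rV[R]_d) : Z (proj Z x). Proof. by case: (proj_spec x). Qed.

Lemma proj_vi (x y : 'rV[R]_d) : Z y -> dotv (x - proj Z x) (y - proj Z x) <= 0.
Proof. by case: (proj_spec x) => _; apply. Qed.

Lemma proj_nonexpansive (x y : 'rV[R]_d) : enorm (proj Z x - proj Z y) <= enorm (x - y).
Proof.
have h1 := proj_vi x (proj_in y); have h2 := proj_vi y (proj_in x).
set a := proj Z x in h1 h2 *; set b := proj Z y in h1 h2 *.
have h3 : dotv (a - b) (a - b) <= dotv (x - y) (a - b).
  by move: h1 h2; rewrite !dotvE (dotvC b a); lra.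
have := dotv_le_enorm (x - y) (a - b); rewrite -sqr_enorm in h3.
have := enorm_ge0 (a - b); rewrite le_eqVlt => /orP[/eqP <- _|a0 h4]; first exact: enorm_ge0.
by rewrite -(ler_pM2r a0) -expr2; exact: le_trans h3 h4.
Qed.

Lemma proj_fixed (x : 'rV[R]_d) : Z x -> proj Z x = x.
Proof.
move=> Zx; apply/esym/eqP; rewrite -subr_eq0; apply/eqP/dotv_eq0.
exact: proj_vi.
Qed.

End projection.

(** * Variational inequalities: existence of solutions, extragradient contraction *)

Section variational_inequality.
Variables (R : realType) (d : nat) (Z : set 'rV[R]_d).
Hypotheses (Z_nonempty : Z !=set0) (Z_closed : closed Z)
  (Z_convex : @convex_set R 'rV[R]_d Z).
Variables (G : 'rV[R]_d -> 'rV[R]_d) (lam Lam : R).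
Hypotheses (lam0 : 0 < lam) (Lam0 : 0 < Lam)
  (G_mono : forall u v, Z u -> Z v ->
     lam * dotv (u - v) (u - v) <= dotv (G u - G v) (u - v))
  (G_lip : forall u v, Z u -> Z v ->
     dotv (G u - G v) (G u - G v) <= Lam ^+ 2 * dotv (u - v) (u - v)).

Let Zproj x := proj_in Z_nonempty Z_closed Z_convex x.
Let vi x y := @proj_vi _ _ _ Z_nonempty Z_closed Z_convex x y.

(** Solutions are fixed points of the projected step of length [s]. As [G] is controlled on [Z]
    only, [T] projects its argument first. *)
Lemma vi_solution_exists : exists2 u, Z u &
  forall y, Z y -> 0 <= dotv (G u) (y - u).
Proof.
(* The step multiplies squared distances by [1 - 2 * s * lam + s^2 * K^2], which is
   [1 - (lam / K)^2] for this [s]. Adding [lam] to [Lam] ensures [lam < K], so the factor is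
   nonnegative. *)
pose K := Lam + lam; pose s := lam / K ^+ 2.
have K0 : 0 < K by rewrite addr_gt0.
have K20 : 0 < K ^+ 2 by rewrite exprn_gt0.
have s0 : 0 < s by rewrite divr_gt0.
pose r2 := 1 - (lam / K) ^+ 2.
have lK : lam / K < 1 by rewrite ltr_pdivrMr// mul1r ltrDr.
have lK0 : 0 < lam / K by rewrite divr_gt0.
have r2_0 : 0 <= r2 by rewrite /r2; nra.
have r2_1 : r2 < 1 by rewrite /r2 ltrBlDr ltrDl exprn_gt0.
pose P := proj Z.
pose T v := P (P v - s *: G (P v)).
have TL u v : enorm (T u - T v) <= Num.sqrt r2 * enorm (u - v).
  apply: le_trans (proj_nonexpansive Z_nonempty Z_closed Z_convex _ _) _.
  apply: (@le_trans _ _ (Num.sqrt r2 * enorm (P u - P v))); last first.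
    by rewrite ler_wpM2l ?sqrtr_ge0// proj_nonexpansive.
  rewrite -(@ler_pXn2r _ 2)// ?nnegrE ?mulr_ge0 ?enorm_ge0 ?sqrtr_ge0//.
  rewrite exprMn !sqr_enorm sqr_sqrtr//.
  have -> : P u - s *: G (P u) - (P v - s *: G (P v)) =
      (P u - P v) - s *: (G (P u) - G (P v)) by apply/rowP => j; rewrite !mxE; ring.
  have h1 := G_mono (Zproj u) (Zproj v); have h2 := G_lip (Zproj u) (Zproj v).
  rewrite -/(P u) -/(P v) in h1 h2.
  set w := P u - P v in h1 h2 *; set g := G _ - G _ in h1 h2 *.
  rewrite dotv_sqrB !(dotvZl, dotvZr) (dotvC w g).
  have w0 := dotv_ge0 w.
  have h3 : dotv g g <= K ^+ 2 * dotv w w.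
    apply: le_trans h2 _; rewrite ler_wpM2r//.
    by rewrite ler_pXn2r ?nnegrE ?lerDl ?ltW.
  have h4 : s * (lam * dotv w w) <= s * dotv g w by rewrite ler_pM2l.
  have h5 : s * (s * dotv g g) <= s * (s * (K ^+ 2 * dotv w w)) by rewrite !ler_pM2l.
  have sK : s * K ^+ 2 = lam by rewrite /s divfK// gt_eqF.
  have r2E : r2 = 1 - s * lam by rewrite /r2 /s; field; rewrite gt_eqF.
  have h6 : s * (s * (K ^+ 2 * dotv w w)) = s * lam * dotv w w.
    by rewrite (mulrA s (K ^+ 2)) sK mulrA.
  by rewrite r2E; lra.
have [|||u Tu] := @contraction_fixpoint _ _ T (Num.sqrt r2).
- exact: sqrtr_ge0.
- by rewrite -(@ltr_pXn2r _ 2)// ?nnegrE ?sqrtr_ge0// sqr_sqrtr// expr1n.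
- exact: TL.
have Zu : Z u by rewrite -Tu; exact: Zproj.
have Pu : P u = u by apply: proj_fixed.
exists u => // y Zy; have := @vi (u - s *: G u) y Zy.
have -> : proj Z (u - s *: G u) = u by rewrite -[RHS]Tu /T Pu.
have -> : u - s *: G u - u = - s *: G u by apply/rowP => j; rewrite !mxE; ring.
by rewrite dotvZl mulNr oppr_le0 pmulr_rge0.
Qed.

Definition eg_step (eta : R) u :=
  proj Z (u - eta *: G (proj Z (u - eta *: G u))).

Lemma eg_step_in eta u : Z (eg_step eta u). Proof. exact: Zproj. Qed.

(** The classical extragradient estimate with the half point [v] kept: [15 / 16] is
    [1 - (eta * Lam)^2], and strong monotonicity acts at [v]. The two gains are combined differently
    in the two contraction lemmas below. *)
Lemma eg_step_descent eta u us : 0 < eta -> eta * Lam = 4^-1 ->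
  Z u -> Z us -> (forall y, Z y -> 0 <= dotv (G us) (y - us)) ->
  let v := proj Z (u - eta *: G u) in
  dotv (eg_step eta u - us) (eg_step eta u - us) <=
  dotv (u - us) (u - us) - 15 / 16 * dotv (v - u) (v - u)
  - 2 * (eta * lam) * dotv (v - us) (v - us).
Proof.
move=> eta0 etaLam Zu Zus us_sol; cbv zeta; rewrite /eg_step; set v := proj Z (u - eta *: G u).
set w := proj Z (u - eta *: G v).
have Zv : Z v by exact: Zproj.
have Zw : Z w by exact: Zproj.
have h1 := @vi (u - eta *: G u) w Zw; rewrite -/v in h1.
have h2 := @vi (u - eta *: G v) us Zus; rewrite -/w in h2.
clearbody v w.
have h3 := G_mono Zv Zus; have h4 := us_sol v Zv; have h5 := G_lip Zv Zu.
have h6 := dotv_young (eta *: (G v - G u)) (v - w) ltr01.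
have e2 : eta ^+ 2 * dotv (G v - G u) (G v - G u) <= 16^-1 * dotv (v - u) (v - u).
  have := ler_wpM2l (sqr_ge0 eta) h5; rewrite mulrA -exprMn etaLam.
  by have -> : (4^-1 : R) ^+ 2 = 16^-1 by field.
have h7 : 2 * eta * (lam * dotv (v - us) (v - us)) <= 2 * eta * dotv (G v) (v - us).
  rewrite ler_pM2l ?mulr_gt0//; apply: le_trans h3 _.
  by rewrite dotvDl dotvNl gerBl.
suff : dotv (w - us) (w - us) <= dotv (u - us) (u - us) - dotv (v - u) (v - u)
   + eta ^+ 2 * dotv (G v - G u) (G v - G u) - 2 * eta * dotv (G v) (v - us).
  by move=> h12; lra.
move: h1 h2 h6.
rewrite expr2 invr1 !mul1r !dotvE.
rewrite ?(dotvC v u) ?(dotvC w u) ?(dotvC w v) ?(dotvC us u) ?(dotvC us v) ?(dotvC us w).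
lra.
Qed.

Lemma eg_step_contraction eta u us : 0 < eta -> lam <= Lam -> eta * Lam = 4^-1 ->
  Z u -> Z us -> (forall y, Z y -> 0 <= dotv (G us) (y - us)) ->
  dotv (eg_step eta u - us) (eg_step eta u - us) <=
  (1 - eta * lam) * dotv (u - us) (u - us).
Proof.
move=> eta0 lamLam etaLam Zu Zus us_sol.
have D := eg_step_descent eta0 etaLam Zu Zus us_sol; cbv zeta in D; apply: le_trans D _.
set v := proj _ _; clearbody v.
have el0 : 0 <= eta * lam by rewrite mulr_ge0// ltW.
have el : eta * lam <= 4^-1 by rewrite -etaLam ler_pM2l.
(* Strong monotonicity is moved from [v] to [u] by bounding [|u - us|^2] by
   [2 * |v - us|^2 + 2 * |v - u|^2]; the price is at most [|v - u|^2 / 2], less than the gain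
   [15 / 16]. *)
have h9 : eta * lam * dotv (u - us) (u - us) <=
    2 * (eta * lam) * (dotv (v - us) (v - us) + dotv (v - u) (v - u)).
  have -> : u - us = (v - us) - (v - u) by apply/rowP => j; rewrite !mxE; ring.
  rewrite -(mulrA 2) mulrCA; apply: ler_wpM2l => //.
  by have := dotv_ge0 ((v - us) + (v - u)); rewrite (dotv_sqrD (v - us)) (dotv_sqrB (v - us) (v - u)); lra.
have h10 : 2 * (eta * lam) * dotv (v - u) (v - u) <= 2^-1 * dotv (v - u) (v - u).
  by apply: ler_wpM2r; [exact: dotv_ge0 | lra].
have h11 := dotv_ge0 (v - u).
by rewrite mulrBl mul1r; rewrite mulrDr in h9; lra.
Qed.

(* 6867/10000 is below exp(-3/8), hence H >= 8 ln x steps gain the factor x^-3. *)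
Lemma eg_step_contraction_fast eta u us : 0 < eta -> eta * Lam = 4^-1 ->
  4 / 17 <= eta * lam ->
  Z u -> Z us -> (forall y, Z y -> 0 <= dotv (G us) (y - us)) ->
  dotv (eg_step eta u - us) (eg_step eta u - us) <=
  6867 / 10000 * dotv (u - us) (u - us).
Proof.
move=> eta0 etaLam el Zu Zus us_sol.
have D := eg_step_descent eta0 etaLam Zu Zus us_sol; cbv zeta in D; apply: le_trans D _.
set v := proj _ _; clearbody v.
have -> : u - us = (v - us) - (v - u) by apply/rowP => j; rewrite !mxE; ring.
(* The gains [8 / 17] at [v - us] and [15 / 16] at [v - u] together dominate
   [120 / 383 * |u - us|^2]; [251 / 500] rounds the optimal Young parameter [128 / 255]. *)
have h := @dotv_young R d (251 / 500) (v - us) (- (v - u)) ltac:(lra).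
have h2 : 8 / 17 * dotv (v - us) (v - us) <= 2 * (eta * lam) * dotv (v - us) (v - us).
  by apply: ler_wpM2r; [exact: dotv_ge0 | lra].
have := dotv_ge0 (v - u); have := dotv_ge0 (v - us).
move: h h2; rewrite (dotv_sqrB (v - us)) (dotvNr (v - u)) (dotvNr (v - u)) (dotvNl (v - u)) opprK.
move: (dotv (v - us) (v - us)) (dotv (v - u) (v - u)) (dotv (v - us) (v - u)).
by intros; lra.
Qed.

Lemma eg_iter_contraction eta q u us H : 0 <= q -> Z u ->
  (forall v, Z v -> dotv (eg_step eta v - us) (eg_step eta v - us) <=
     q * dotv (v - us) (v - us)) ->
  Z (iter H (eg_step eta) u) /\
  dotv (iter H (eg_step eta) u - us) (iter H (eg_step eta) u - us) <=
  q ^+ H * dotv (u - us) (u - us).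
Proof.
move=> q0 Zu step; elim: H => [|H [Zi IH]]; first by rewrite expr0 mul1r.
rewrite iterS; split; first exact: eg_step_in.
by apply: le_trans (step _ Zi) _; rewrite exprS -mulrA ler_wpM2l.
Qed.

End variational_inequality.

(** * Algebra of one accurate round *)

Section descent.
Variables (R : realType) (d : nat).

(** [q] is the exact inner point minus [zstar]; [e], [a], [b] are the computed point, the old point
    and the anchor, each minus the exact point. Twice the last hypothesis cancels [2 * dotv Y2 q],
    so that only [e] and [Y1], both of the size of the inner error, remain paired with [q]. *)
Lemma descent_core (t p th kap2 : R) (q e a b Y1 Y2 : 'rV[R]_d) :
  0 < t -> 0 < p -> p <= 4^-1 -> t <= p / 3 -> 10 * th <= t -> th <= 160^-1 ->
  kap2 <= p / 16 ->
  dotv e e <= th * dotv a a ->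
  dotv Y1 Y1 <= kap2 * dotv e e ->
  dotv Y2 Y2 <= kap2 * dotv (b - e) (b - e) ->
  t * dotv q q + dotv Y2 q - dotv Y1 q <= (1 - p) * dotv a q + p * dotv b q ->
  dotv (e + q) (e + q) + 2 * dotv Y2 (e + q) + kap2 * dotv (b - e) (b - e) +
    (p * dotv (a + q) (a + q) + (1 - p) * dotv (b + q) (b + q)) <=
  (1 - t / 2) * (dotv (a + q) (a + q) + dotv (b + q) (b + q)).
Proof.
move=> t0 p0 p4 tp tht th160 kp he hY1 hY2 hvi.
have aa := dotv_ge0 a; have bb := dotv_ge0 b; have ee := dotv_ge0 e.
have qq := dotv_ge0 q; have be := dotv_ge0 (b - e).
have y1 : 2 * dotv (e + Y1) q <= t / 2 * dotv q q + 2 / t * dotv (e + Y1) (e + Y1).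
  have := @dotv_young R d (t / 2) q (e + Y1); rewrite divr_gt0// invf_div => /(_ isT).
  by rewrite (dotvC q).
have y2 := @dotv_young R d 1 Y2 e ltr01.
have y3 : 2 * dotv e Y1 <= 8^-1 * dotv e e + 8 * dotv Y1 Y1.
  by have := @dotv_young R d 8^-1 e Y1; rewrite invrK; apply; rewrite invr_gt0.
have y4 : dotv Y1 Y1 <= 64^-1 * dotv e e.
  by apply: le_trans hY1 _; rewrite ler_wpM2r//; lra.
have y5 : dotv (e + Y1) (e + Y1) <= 81 / 64 * dotv e e by rewrite dotv_sqrD; lra.
(* The Young factor [2 / t] is compensated by [10 * th <= t]. *)
have y6 : 2 / t * dotv (e + Y1) (e + Y1) <= 81 / 320 * dotv a a.
  apply: (@le_trans _ _ (2 / t * (81 / 64 * (t / 10 * dotv a a)))).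
    rewrite ler_pM2l ?divr_gt0//; apply: le_trans y5 _; rewrite ler_pM2l//.
    by apply: le_trans he _; rewrite ler_wpM2r//; lra.
  by rewrite le_eqVlt; apply/orP; left; apply/eqP; field; rewrite gt_eqF.
have y7 : dotv e e <= 160^-1 * dotv a a.
  by apply: le_trans he _; rewrite ler_wpM2r.
have y8 : kap2 * dotv (b - e) (b - e) <= p / 16 * dotv (b - e) (b - e) by rewrite ler_wpM2r.
have y9 : dotv (b - e) (b - e) <= 2 * dotv b b + 2 * dotv e e.
  by have := dotv_ge0 (b + e); rewrite (dotv_sqrD b e) (dotv_sqrB b e); lra.
have y10 : p / 16 * dotv (b - e) (b - e) <= p / 16 * (2 * dotv b b + 2 * dotv e e).
  by rewrite ler_pM2l// divr_gt0.
have young v : dotv (v + q) (v + q) <= 3 / 2 * dotv q q + 3 * dotv v v.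
  have := @dotv_young R d 2 v q; rewrite ltr0n => /(_ isT).
  by rewrite dotv_sqrD; lra.
have y11 : t / 2 * (dotv (a + q) (a + q) + dotv (b + q) (b + q)) <=
    t / 2 * (3 * dotv q q + 3 * dotv a a + 3 * dotv b b).
  rewrite ler_pM2l ?divr_gt0//; have := young a; have := young b; lra.
have y12 : t * dotv a a <= p / 3 * dotv a a by rewrite ler_wpM2r.
have y13 : t * dotv b b <= p / 3 * dotv b b by rewrite ler_wpM2r.
have y14 : p * dotv a a <= 4^-1 * dotv a a by rewrite ler_wpM2r.
have y15 : p * dotv e e <= 4^-1 * dotv e e by rewrite ler_wpM2r.
have y16 : 0 <= p * dotv b b by rewrite mulr_ge0// ltW.
rewrite mulrBl mul1r.
move: y1 y2 y11 hvi; rewrite !(dotv_sqrD _ q) (dotvDr e q) (dotvDl e Y1) invr1 !mul1r (dotvC Y2 e).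
lra.
Qed.

End descent.

(** * Expectations along the trajectory *)

Section averaged.
Variables (R : realType) (J : finType) (T : Type) (wt : J -> R) (step : J -> T -> T).
Hypothesis wt_ge0 : forall j, 0 <= wt j.

(** The transition operator of the Markov chain that makes the move [step j] with probability
    [wt j]; its iterates turn expectations into finite algebra. *)
Definition averaged (f : T -> R) (s : T) := \sum_j wt j * f (step j s).

Lemma averaged_ge0 f : (forall s, 0 <= f s) -> forall s, 0 <= averaged f s.
Proof. by move=> f0 s; apply: sumr_ge0 => j _; exact: mulr_ge0. Qed.

Variable inv : T -> Prop.
Hypothesis step_inv : forall j s, inv s -> inv (step j s).

Lemma averaged_le f g : (forall s, inv s -> f s <= g s) ->
  forall s, inv s -> averaged f s <= averaged g s.
Proof.
by move=> fg s hs; apply: ler_sum => j _; apply: ler_wpM2l => //; apply: fg; exact: step_inv.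
Qed.

Lemma iter_averaged_le f g k : (forall s, inv s -> f s <= g s) ->
  forall s, inv s -> iter k averaged f s <= iter k averaged g s.
Proof. by move=> fg; elim: k => // k IH s hs; exact: averaged_le. Qed.

Lemma averaged_contraction f rho : 0 <= rho ->
  (forall s, inv s -> averaged f s <= rho * f s) ->
  forall k s, inv s -> iter k averaged f s <= rho ^+ k * f s.
Proof.
move=> rho0 hf; elim=> [|k IH] s hs /=; first by rewrite expr0 mul1r.
apply: le_trans (averaged_le IH hs) _.
rewrite /averaged; under eq_bigr do rewrite mulrCA.
by rewrite -mulr_sumr exprSr -mulrA; apply: ler_wpM2l; [exact: exprn_ge0 | exact: hf].
Qed.

(* A quantity driven by a family of potentials which contract more slowly than it. *)
Lemma averaged_perturbed_contraction a (W : nat -> T -> R) (r q c e : R) :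
  0 <= r -> r <= q -> 0 <= c -> e <= c * (q - r) ->
  (forall k s, inv s -> 0 <= W k s) ->
  (forall k s, inv s -> averaged (W k.+1) s <= q * W k s) ->
  (forall k s, inv s -> averaged a s <= r * a s + e * W k s) ->
  forall k l s, inv s ->
    iter k averaged a s <= r ^+ k * a s + c * (q ^+ k - r ^+ k) * W l s.
Proof.
move=> r0 rq c0 ec W0 Wq ar; elim=> [|k IH] l s hs /=.
  by rewrite !expr0 subrr mulr0 mul0r addr0 mul1r.
(* The induction is over all [l]: after one round, the remaining [k] rounds start from the potential
   [W l.+1]. *)
apply: le_trans (averaged_le (g := fun s => r ^+ k * a s + c * (q ^+ k - r ^+ k) * W l.+1 s) _ hs) _.
  by move=> s'; exact: IH.
have E : averaged (fun s => r ^+ k * a s + c * (q ^+ k - r ^+ k) * W l.+1 s) s =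
    r ^+ k * averaged a s + c * (q ^+ k - r ^+ k) * averaged (W l.+1) s.
  rewrite /averaged !mulr_sumr -big_split /=; apply: eq_bigr => j _; ring.
have qr0 : 0 <= c * (q ^+ k - r ^+ k).
  by rewrite mulr_ge0// subr_ge0; apply: lerXn2r; rewrite ?nnegrE ?(le_trans r0 rq).
have rk := exprn_ge0 k r0.
have h1 := ler_wpM2l rk (ar l s hs).
have h2 := ler_wpM2l qr0 (Wq l s hs).
have h3 := ler_wpM2r (W0 l s hs) (ler_wpM2l rk ec).
rewrite E !exprS; move: h1 h2 h3; move: (averaged _ _) (averaged _ _) (W l s) (a s) => A1 A2 v a1.
clear; lra.
Qed.

End averaged.

(** * Expectations of variables with finitely many values *)

Section finite_expectation.
Variables (R : realType) (dd : measure_display) (Om : measurableType dd)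
  (P : probability Om R).

Lemma finite_range_sum (T : eqType) (X : Om -> T) (r : seq T) (f : T -> R) :
  uniq r -> (forall w, X w \in r) ->
  (fun w => (f (X w))%:E) =
  (fun w => \sum_(x <- r) (f x)%:E * (\1_(X @^-1` [set x]) w)%:E)%E.
Proof.
move=> r_uniq Xr; apply/funext => w.
rewrite (bigD1_seq (X w))//= big1 => [|x xX].
  by rewrite indicE mem_set// mule1 adde0.
by rewrite indicE memNset ?mule0//= => /esym/eqP; apply/negP.
Qed.

Lemma integral_finite_range (T : eqType) (X : Om -> T) (r : seq T) (f : T -> R) :
  uniq r -> (forall w, X w \in r) -> (forall x, measurable (X @^-1` [set x])) ->
  (forall x, 0 <= f x) ->
  (\int[P]_w (f (X w))%:E = \sum_(x <- r) (f x)%:E * P (X @^-1` [set x]))%E.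
Proof.
move=> r_uniq Xr mX f0; rewrite (finite_range_sum f r_uniq Xr).
rewrite ge0_integral_sum//=; last 2 first.
- move=> x; apply: measurable_funeM; apply/measurable_EFinP.
  exact: measurable_indic.
- by move=> x w _; rewrite mule_ge0 ?lee_fin.
apply: eq_bigr => x _; rewrite ge0_integralZl_EFin//=.
- by rewrite integral_indic// setIT.
- by apply/measurable_EFinP; exact: measurable_indic.
Qed.

(** Both sides are finite sums over the joint atoms of state and draw, on which the probability
    factors. *)
Lemma expectation_step (T : eqType) (S : Om -> T) (J : finType) (Y : Om -> J)
    (r : seq T) (wt : J -> R) (step : J -> T -> T) (f : T -> R) :
  uniq r -> (forall w, S w \in r) ->
  (forall s, measurable (S @^-1` [set s])) ->
  (forall j, measurable (Y @^-1` [set j])) ->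
  (forall s j, P (S @^-1` [set s] `&` Y @^-1` [set j]) =
               P (S @^-1` [set s]) * (wt j)%:E)%E ->
  (forall j, 0 <= wt j) -> (forall s, 0 <= f s) ->
  (\int[P]_w (f (step (Y w) (S w)))%:E = \int[P]_w (averaged wt step f (S w))%:E)%E.
Proof.
move=> r_uniq Sr mS mY indep wt0 f0.
pose X w := (S w, Y w); pose rX := [seq (s, j) | s <- r, j <- enum J].
have XE s j : X @^-1` [set (s, j)] = S @^-1` [set s] `&` Y @^-1` [set j].
  by apply/seteqP; split => [w [<- <-]//|w [/= <- <-]].
rewrite (@integral_finite_range _ X rX (fun x => f (step x.2 x.1))) //; last 3 first.
- by rewrite allpairs_uniq// ?enum_uniq// => -[? ?] [? ?].
- by move=> w; apply/allpairsP; exists (X w); rewrite /= Sr mem_enum.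
- by case=> s j; rewrite XE; exact: measurableI.
rewrite (integral_finite_range r_uniq Sr) ?big_allpairs_dep//=; last first.
  by move=> s; exact: averaged_ge0.
apply: eq_bigr => s _; rewrite big_enum/=.
under eq_bigr do rewrite XE indep.
have [q Pq q0] : exists2 q : R, P (S @^-1` [set s]) = q%:E & 0 <= q.
  exists (fine (P (S @^-1` [set s]))); first by rewrite fineK// fin_num_measure.
  by rewrite fine_ge0.
rewrite Pq; under eq_bigr do rewrite -!EFinM.
rewrite sumEFin -!EFinM; congr (_%:E).
by rewrite /averaged mulr_suml; apply: eq_bigr => j _; ring.
Qed.

End finite_expectation.

(** * Independence of the draws from the past *)

Section draws.
Variables (R : realType) (dd : measure_display) (Om : measurableType dd)
  (P : probability Om R) (n : nat) (p : R)
  (idx : nat -> Om -> 'I_n.+1) (coin : nat -> Om -> bool).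
Hypothesis draws : algorithm_draws P p idx coin.

Lemma pastS a b a' b' : (a <= a')%N -> (b <= b')%N ->
  past idx coin a b `<=` past idx coin a' b'.
Proof.
move=> aa bb; apply: sub_sigma_algebra2 => A [] [j jl [B ->]].
  by left; exists j; [exact: leq_trans jl aa | exists B].
by right; exists j; [exact: leq_trans jl bb | exists B].
Qed.

Lemma past_idx a b j B : (j < a)%N -> past idx coin a b (idx j @^-1` B).
Proof. by move=> ja; apply: sub_sigma_algebra; left; exists j => //; exists B. Qed.

Lemma past_coin a b j B : (j < b)%N -> past idx coin a b (coin j @^-1` B).
Proof. by move=> jb; apply: sub_sigma_algebra; right; exists j => //; exists B. Qed.

Lemma past_measurable a b : past idx coin a b `<=` measurable.
Proof.
case: draws => mi mc _ _ _; apply: smallest_sub.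
  exact: sigma_algebra_measurable.
by move=> A [] [j _ [B ->]]; [exact: mi | exact: mc].
Qed.

Lemma pastU a b A B : past idx coin a b A -> past idx coin a b B ->
  past idx coin a b (A `|` B).
Proof.
move=> pA pB; rewrite -bigcup2E; apply: sigma_algebra_bigcup => -[|[|i]]//=.
exact: sigma_algebra0.
Qed.

Lemma pastI a b A B : past idx coin a b A -> past idx coin a b B ->
  past idx coin a b (A `&` B).
Proof.
move=> pA pB; rewrite -[A]setCK -[B]setCK -setCU; apply: sigma_algebraC.
by apply: pastU; exact: sigma_algebraC.
Qed.

Lemma past_finite_union a b (J : finType) (A : J -> set Om) :
  (forall j, past idx coin a b (A j)) -> past idx coin a b [set w | exists j, A j w].
Proof.
move=> pA.
have -> : [set w | exists j, A j w] = \big[setU/set0]_(j <- enum J) A j.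
  rewrite -bigcup_seq; apply/seteqP; split => [w [j Aj]|w [j _ Aj]]; last by exists j.
  by exists j => //=; rewrite mem_enum.
by elim/big_ind : _ => [|? ?|j _]; [exact: sigma_algebra0 | exact: pastU | exact: pA].
Qed.

Definition draw_weight (j : 'I_n.+1 * bool) : R :=
  n.+1%:R^-1 * (if j.2 then p else 1 - p).

(** The coin is split off first, because its past contains the index of the same round; the index is
    then independent of what is left. *)
Lemma draw_indep k A j : past idx coin k k A ->
  (P (A `&` (fun w => (idx k w, coin k w)) @^-1` [set j]) =
   P A * (draw_weight j)%:E)%E.
Proof.
case: j => i c pA; have [_ mc Pi Pc /(_ k) [ii ic]] := draws.
have -> : A `&` (fun w => (idx k w, coin k w)) @^-1` [set (i, c)] =
    (A `&` idx k @^-1` [set i]) `&` coin k @^-1` [set c].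
  by apply/seteqP; split => [w [? [? ?]]|w [[? /= ?] ?]]; repeat split => //=; congr pair.
rewrite ic; last first.
  apply: pastI; first exact: (@pastS k k).
  exact: past_idx.
rewrite ii// -muleA; congr (_ * _)%E.
have -> : P (idx k @^-1` [set i]) = (n.+1%:R^-1)%:E by rewrite -(Pi k i).
have Ptrue : P (coin k @^-1` [set true]) = p%:E by rewrite -(Pc k).
case: c; rewrite /draw_weight /= EFinM; first by rewrite Ptrue.
congr (_ * _)%E.
have -> : coin k @^-1` [set false] = ~` (coin k @^-1` [set true]).
  by apply/seteqP; split => w /=; case: (coin k w).
by rewrite probability_setC// Ptrue.
Qed.

End draws.

Lemma draw_weight_ge0 (R : realType) (n : nat) (p : R) (j : 'I_n.+1 * bool) :
  0 <= p -> p <= 1 -> 0 <= draw_weight p j.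
Proof.
by move=> p0 p1; rewrite mulr_ge0 ?invr_ge0 ?ler0n//; case: j => i [] //=; rewrite subr_ge0.
Qed.

Lemma sum_draw_weight (R : realType) (n : nat) (p : R) (f : 'I_n.+1 * bool -> R) :
  \sum_j draw_weight p j * f j =
  n.+1%:R^-1 * \sum_i (p * f (i, true) + (1 - p) * f (i, false)).
Proof.
transitivity (\sum_(j : 'I_n.+1 * bool) draw_weight p (j.1, j.2) * f (j.1, j.2)).
  by apply: eq_bigr => -[].
rewrite -(pair_bigA _ (fun i c => draw_weight p (i, c) * f (i, c)))/= mulr_sumr.
by apply: eq_bigr => i _; rewrite big_bool /draw_weight /=; ring.
Qed.

(** * The iterates as a Markov chain *)

Section trajectory.
Variables (R : realType) (d n : nat) (Z : set 'rV[R]_d)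
  (F : 'I_n.+1 -> 'rV[R]_d -> 'rV[R]_d) (gamma eta tau p : R) (H : nat).
Variable z0 : 'rV[R]_d.
Variables (dd : measure_display) (Om : measurableType dd) (P : probability Om R)
  (idx : nat -> Om -> 'I_n.+1) (coin : nat -> Om -> bool).
Hypothesis draws : algorithm_draws P p idx coin.

Let state := ('rV[R]_d * 'rV[R]_d)%type.

Definition round (j : 'I_n.+1 * bool) (s : state) : state :=
  (outer_step Z F gamma eta tau H j.1 s.1 s.2, if j.2 then s.1 else s.2).

Definition trajectory k w : state :=
  three_pillars Z F gamma eta tau H z0 (fun k => idx k w) (fun k => coin k w) k.

Lemma trajectoryS k w :
  trajectory k.+1 w = round (idx k w, coin k w) (trajectory k w).
Proof. by rewrite /trajectory /=; case: three_pillars. Qed.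

(** A finite list of all possible states, which makes the expectation at each time a finite sum. It
    may contain repetitions, hence the [undup] below. *)
Fixpoint reachable k : seq state :=
  if k is k'.+1 then [seq round j s | s <- reachable k', j <- enum {: 'I_n.+1 * bool}]
  else [:: (z0, z0)].

Lemma trajectory_reachable k w : trajectory k w \in reachable k.
Proof.
elim: k => [|k IH]; first by rewrite mem_head.
rewrite trajectoryS /=; apply/allpairsP; exists (trajectory k w, (idx k w, coin k w)).
by rewrite IH mem_enum.
Qed.

(** The event is a finite union, over the possible draws of the last round, of the event of this
    draw and an event of the preceding state. *)
Lemma trajectory_past k B : past idx coin k k (trajectory k @^-1` B).
Proof.
elim: k B => [|k IH] B.
  have [Bz|nBz] := pselect (B (z0, z0)).
    have -> : trajectory 0 @^-1` B = ~` set0 by apply/seteqP; split => [w _ []|].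
    by apply: sigma_algebraC; exact: sigma_algebra0.
  have -> : trajectory 0 @^-1` B = set0 by apply/seteqP; split => // w /nBz.
  exact: sigma_algebra0.
have -> : trajectory k.+1 @^-1` B = [set w | exists j : 'I_n.+1 * bool,
    (idx k @^-1` [set j.1] `&` coin k @^-1` [set j.2] `&`
     trajectory k @^-1` (round j @^-1` B)) w].
  apply/seteqP; split => w /=; rewrite trajectoryS.
    by exists (idx k w, coin k w).
  by move=> [[i c]] /= [[-> ->]].
apply: past_finite_union => j; apply: pastI; last exact: (pastS (leqnSn k) (leqnSn k)).
by apply: pastI; [exact: past_idx | exact: past_coin].
Qed.

Lemma expectation_trajectory (f : state -> R) : 0 <= p -> p <= 1 -> (forall s, 0 <= f s) ->
  forall k, (\int[P]_w (f (trajectory k w))%:E =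
    (iter k (averaged (@draw_weight R n p) round) f (z0, z0))%:E)%E.
Proof.
move=> p0 p1 f0 k; elim: k f f0 => [|k IH] f f0.
  rewrite /trajectory /=.
  by rewrite integral_cst// [X in (_ * X)%E](@probability_setT _ _ _ P) mule1.
under eq_integral do rewrite trajectoryS.
have w0 j : 0 <= @draw_weight R n p j by exact: draw_weight_ge0.
(* The last round is averaged out, which replaces [f] by its average as a function of the preceding
   state. *)
rewrite iterSr -IH; last exact: averaged_ge0.
apply: (@expectation_step _ _ _ P _ (trajectory k) _ (fun w => (idx k w, coin k w))
  (undup (reachable k)) (@draw_weight R n p) round f) => //.
- exact: undup_uniq.
- by move=> w; rewrite mem_undup trajectory_reachable.
- by move=> s; apply: (past_measurable draws); exact: trajectory_past.
- case=> i c; have [mi mc _ _ _] := draws.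
  have -> : (fun w => (idx k w, coin k w)) @^-1` [set (i, c)] =
      idx k @^-1` [set i] `&` coin k @^-1` [set c].
    by apply/seteqP; split => [w [<- <-]|w [/= <- <-]].
  exact: measurableI.
- by move=> s j; apply: (draw_indep draws); exact: trajectory_past.
Qed.

End trajectory.

(** * Rounds with an accurate inner loop *)

Section algorithm.
Variables (R : realType) (d n : nat) (Z : set 'rV[R]_d)
  (F : 'I_n.+1 -> 'rV[R]_d -> 'rV[R]_d) (L mu delta : R).
Hypotheses (Z_nonempty : Z !=set0) (Z_closed : closed Z)
  (Z_convex : @convex_set R 'rV[R]_d Z)
  (L_gt0 : 0 < L) (mu_gt0 : 0 < mu) (delta_gt0 : 0 < delta)
  (F_lipschitz : forall i u v, Z u -> Z v ->
    enorm (F i u - F i v) <= L * enorm (u - v))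
  (F_strongly_monotone : forall u v, Z u -> Z v ->
    mu * enorm (u - v) ^+ 2 <= dotv (avg_op F u - avg_op F v) (u - v))
  (F_monotone : forall i u v, Z u -> Z v -> 0 <= dotv (F i u - F i v) (u - v))
  (F_similar : forall j u v, Z u -> Z v ->
    n.+1%:R^-1 * \sum_i enorm (F i u - F j u - F i v + F j v) ^+ 2
      <= delta ^+ 2 * enorm (u - v) ^+ 2).
Variable zstar : 'rV[R]_d.
Hypotheses (zstar_in : Z zstar)
  (zstar_sol : forall z, Z z -> 0 <= dotv (avg_op F zstar) (z - zstar)).

Let N : R := n.+1%:R^-1.

Let N_ge0 : 0 <= N. Proof. by rewrite invr_ge0. Qed.

Lemma avg_cst (c : R) : N * \sum_(i < n.+1) c = c.
Proof. by rewrite sumr_const card_ord -[c *+ _]mulr_natl mulrA mulVf ?mul1r// pnatr_eq0. Qed.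

(** Jensen's inequality, obtained from a nonnegative variance. *)
Lemma dotv_avg_le (D : 'I_n.+1 -> 'rV[R]_d) :
  dotv (N *: \sum_i D i) (N *: \sum_i D i) <= N * \sum_i dotv (D i) (D i).
Proof.
set m := N *: _.
have h : 0 <= N * \sum_i dotv (D i - m) (D i - m).
  by rewrite mulr_ge0// sumr_ge0// => i _; exact: dotv_ge0.
have E : N * \sum_i dotv (D i - m) (D i - m) =
    N * \sum_i dotv (D i) (D i) - dotv m m.
  under eq_bigr do rewrite dotv_sqrB.
  rewrite big_split /= mulrDr avg_cst big_split /= mulrDr sumrN -mulr_sumr.
  have -> : dotv m m = N * \sum_i dotv (D i) m by rewrite {1}/m dotvZl dotv_suml.
  ring.
by rewrite E subr_ge0 in h.
Qed.

Lemma avg_op_diff j u v : avg_op F u - F j u - (avg_op F v - F j v) =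
  N *: \sum_i (F i u - F j u - F i v + F j v).
Proof.
apply/rowP => k; rewrite /avg_op -/N !mxE !summxE.
under [in RHS]eq_bigr do rewrite !mxE.
rewrite !big_split /= !sumrN !mulrDr !mulrN !avg_cst; ring.
Qed.

Lemma avg_op_dist u v : avg_op F u - avg_op F v = N *: \sum_i (F i u - F i v).
Proof. by rewrite big_split /= sumrN scalerBr. Qed.

Lemma avg_op_similar j u v : Z u -> Z v ->
  dotv (avg_op F u - F j u - (avg_op F v - F j v))
       (avg_op F u - F j u - (avg_op F v - F j v)) <= delta ^+ 2 * dotv (u - v) (u - v).
Proof.
move=> Zu Zv; rewrite avg_op_diff; apply: le_trans (dotv_avg_le _) _.
have := F_similar j Zu Zv; rewrite sqr_enorm.
by under eq_bigr do rewrite sqr_enorm.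
Qed.

Lemma avg_op_lipschitz u v : Z u -> Z v ->
  dotv (avg_op F u - avg_op F v) (avg_op F u - avg_op F v)
    <= L ^+ 2 * dotv (u - v) (u - v).
Proof.
move=> Zu Zv; rewrite avg_op_dist; apply: le_trans (dotv_avg_le _) _.
rewrite -[leRHS]avg_cst ler_wpM2l//; apply: ler_sum => i _.
rewrite -!sqr_enorm -exprMn ler_pXn2r ?nnegrE ?mulr_ge0 ?enorm_ge0 ?(ltW L_gt0)//.
by rewrite F_lipschitz.
Qed.

(** Contraposed, [L < mu] leaves no two distinct points in [Z], and the rate is then trivial. *)
Lemma mu_le_L u v : Z u -> Z v -> u != v -> mu <= L.
Proof.
move=> Zu Zv uv; have h1 := F_strongly_monotone Zu Zv.
have h2 := dotv_le_enorm (avg_op F u - avg_op F v) (u - v).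
have h3 := avg_op_lipschitz Zu Zv.
rewrite -!sqr_enorm -exprMn ler_pXn2r ?nnegrE ?mulr_ge0 ?enorm_ge0 ?(ltW L_gt0)// in h3.
have e0 : 0 < enorm (u - v).
  rewrite lt_neqAle enorm_ge0 andbT; apply: contra uv => /eqP e0.
  by rewrite -subr_eq0; apply/eqP/dotv_eq0; rewrite -sqr_enorm -e0 expr0n.
rewrite -(@ler_pM2r _ (enorm (u - v) ^+ 2)) ?exprn_gt0//.
apply: le_trans h1 _; apply: le_trans h2 _.
by rewrite expr2 mulrA ler_pM2r.
Qed.

Variables (gamma p : R).
Hypotheses (gamma_gt0 : 0 < gamma) (p_gt0 : 0 < p) (p_le : p <= 4^-1).

Let gi0 : 0 < gamma^-1. Proof. by rewrite invr_gt0. Qed.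

Let Lam0 : 0 < L + gamma^-1. Proof. by rewrite addr_gt0. Qed.

Lemma inner_op_diff z m u v : inner_op F gamma p z m u - inner_op F gamma p z m v =
  (F ord0 u - F ord0 v) + gamma^-1 *: (u - v).
Proof. by rewrite /inner_op; apply/rowP => j; rewrite !mxE; ring. Qed.

Lemma inner_op_mono z m u v : Z u -> Z v ->
  gamma^-1 * dotv (u - v) (u - v) <=
  dotv (inner_op F gamma p z m u - inner_op F gamma p z m v) (u - v).
Proof.
move=> Zu Zv.
by rewrite inner_op_diff (dotvDl (F ord0 u - F ord0 v)) (dotvZl gamma^-1) lerDr F_monotone.
Qed.

Lemma inner_op_lipschitz z m u v : Z u -> Z v ->
  dotv (inner_op F gamma p z m u - inner_op F gamma p z m v)
       (inner_op F gamma p z m u - inner_op F gamma p z m v)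
  <= (L + gamma^-1) ^+ 2 * dotv (u - v) (u - v).
Proof.
move=> Zu Zv; rewrite -!sqr_enorm -exprMn.
rewrite ler_pXn2r ?nnegrE ?mulr_ge0 ?enorm_ge0// ?(ltW Lam0)//.
rewrite inner_op_diff; apply: le_trans (ler_enormD _ _) _; rewrite mulrDl lerD ?F_lipschitz//.
rewrite -(@ler_pXn2r _ 2)// ?nnegrE ?mulr_ge0 ?enorm_ge0 ?(ltW gi0)//.
by rewrite exprMn !sqr_enorm dotvZl dotvZr mulrA expr2.
Qed.

Definition inner_solution z m u :=
  Z u /\ forall y, Z y -> 0 <= dotv (inner_op F gamma p z m u) (y - u).

Lemma inner_solution_exists z m : exists u, inner_solution z m u.
Proof.
have [u Zu sol] := vi_solution_exists Z_nonempty Z_closed Z_convex gi0 Lam0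
  (@inner_op_mono z m) (@inner_op_lipschitz z m).
by exists u.
Qed.

Variables (eta : R) (H : nat).
Hypotheses (eta_gt0 : 0 < eta) (eta_L : eta * (L + gamma^-1) = 4^-1).

Lemma inner_loop_contraction z m u : Z z -> inner_solution z m u ->
  Z (inner_loop Z F gamma eta p H z m) /\
  dotv (inner_loop Z F gamma eta p H z m - u) (inner_loop Z F gamma eta p H z m - u)
  <= (1 - eta / gamma) ^+ H * dotv (z - u) (z - u).
Proof.
move=> Zz [Zu sol].
have lamLam : gamma^-1 <= L + gamma^-1 by rewrite lerDr ltW.
apply: (@eg_iter_contraction _ _ _ Z_nonempty Z_closed Z_convex
  (inner_op F gamma p z m) eta (1 - eta / gamma)) => // [|v Zv].
  by rewrite subr_ge0 (@le_trans _ _ 4^-1)// ?invf_le1 ?ler1n// -eta_L ler_pM2l.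
exact: (eg_step_contraction Z_nonempty Z_closed Z_convex gi0
  (@inner_op_mono z m) (@inner_op_lipschitz z m) eta_gt0 lamLam eta_L Zv Zu sol).
Qed.

Lemma inner_loop_contraction_fast z m u : L * gamma <= 16^-1 -> Z z ->
  inner_solution z m u ->
  Z (inner_loop Z F gamma eta p H z m) /\
  dotv (inner_loop Z F gamma eta p H z m - u) (inner_loop Z F gamma eta p H z m - u)
  <= (6867 / 10000) ^+ H * dotv (z - u) (z - u).
Proof.
move=> gL Zz [Zu sol].
have el : 4 / 17 <= eta * gamma^-1.
  have -> : eta * gamma^-1 = 4^-1 / (L * gamma + 1).
    by rewrite -eta_L; field; rewrite !gt_eqF// ltr_wpDl// mulr_ge0 ?ltW.
  have g0 := mulr_gt0 L_gt0 gamma_gt0.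
  by rewrite ler_pdivlMr; lra.
have step v (Zv : Z v) := eg_step_contraction_fast Z_nonempty Z_closed Z_convex
  (@inner_op_mono z m) (@inner_op_lipschitz z m) eta_gt0 eta_L el Zv Zu sol.
have q0 : 0 <= 6867 / 10000 :> R by lra.
exact: (eg_iter_contraction Z_nonempty Z_closed Z_convex H q0 Zz step).
Qed.

Variable th : R.
Hypotheses (gamma_mu : gamma * mu <= p / 3)
  (gamma_delta : (gamma * delta) ^+ 2 <= p / 16)
  (th_gamma : mu <= L -> 10 * th <= gamma * mu) (th_le : mu <= L -> th <= 160^-1)
  (inner_error : mu <= L -> forall z m u, Z z -> inner_solution z m u ->
    Z (inner_loop Z F gamma eta p H z m) /\
    dotv (inner_loop Z F gamma eta p H z m - u) (inner_loop Z F gamma eta p H z m - u)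
    <= th * dotv (z - u) (z - u)).

Lemma outer_step_in i z m : Z (outer_step Z F gamma eta p H i z m).
Proof. exact: proj_in. Qed.

(** The projection is nonexpansive and fixes [zstar], so the new distance is that of the computed
    point plus noise; the mean of the noise is [Dl m - Dl u], and similarity bounds its second
    moment. The conditions on [th] are asked for only when [mu <= L], since both sides vanish
    otherwise. *)
Lemma outer_step_descent z m : Z z -> Z m ->
  N * (\sum_i dotv (outer_step Z F gamma eta p H i z m - zstar)
                  (outer_step Z F gamma eta p H i z m - zstar)) +
    (p * dotv (z - zstar) (z - zstar) + (1 - p) * dotv (m - zstar) (m - zstar)) <=
  (1 - gamma * mu / 2) *
    (dotv (z - zstar) (z - zstar) + dotv (m - zstar) (m - zstar)).
Proof.
move=> Zz Zm.
have dotv00 : dotv (zstar - zstar) (zstar - zstar) = 0 by rewrite subrr dotv0l.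
have [muL|Lmu] := leP mu L; last first.
  have single u : Z u -> u = zstar.
    move=> Zu; apply/eqP; apply/negPn/negP => /(mu_le_L Zu zstar_in).
    by rewrite leNgt Lmu.
  rewrite (single _ Zz) (single _ Zm) dotv00 big1; first by rewrite !(mulr0, addr0).
  by move=> i _; rewrite (single _ (outer_step_in i zstar zstar)).
pose G := inner_op F gamma p z m.
have [uh [Zuh uh_sol]] := inner_solution_exists z m.
have [Zu hu] := inner_error muL Zz (conj Zuh uh_sol).
pose u := inner_loop Z F gamma eta p H z m.
rewrite -/u in Zu hu.
pose q := uh - zstar; pose e := u - uh; pose a := z - uh; pose b := m - uh.
pose Dl v := avg_op F v - F ord0 v.
(* [Y2] is the mean of the noise actually added, taken at the computed point [u]; [Y1] corrects for
   the fact that the inner inequality holds at [uh]. *)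
pose Y1 := gamma *: (Dl uh - Dl u); pose Y2 := gamma *: (Dl m - Dl u).
have zE : z - zstar = a + q by rewrite /a /q addrA subrK.
have mE : m - zstar = b + q by rewrite /b /q addrA subrK.
have uE : u - zstar = e + q by rewrite /e /q addrA subrK.
have muE : m - u = b - e by apply/rowP => j; rewrite !mxE; ring.
have gd0 : 0 <= (gamma * delta) ^+ 2 by rewrite exprn_ge0// mulr_ge0// ltW.
pose D i := F i m - F ord0 m - F i u + F ord0 u.
have step i : dotv (outer_step Z F gamma eta p H i z m - zstar)
                  (outer_step Z F gamma eta p H i z m - zstar) <=
    dotv (e + q) (e + q) + 2 * gamma * dotv (D i) (e + q) + gamma ^+ 2 * dotv (D i) (D i).
  have := proj_nonexpansive Z_nonempty Z_closed Z_convex (u + gamma *: D i) zstar.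
  rewrite (proj_fixed Z_nonempty Z_closed Z_convex zstar_in).
  rewrite -(@ler_pXn2r _ 2)// ?nnegrE ?enorm_ge0// !sqr_enorm => h.
  apply: le_trans h _.
  have -> : u + gamma *: D i - zstar = (e + q) + gamma *: D i.
    by rewrite -uE; apply/rowP => j; rewrite !mxE; ring.
  by rewrite (dotv_sqrD (e + q)) !(dotvZl gamma) !(dotvZr gamma) (dotvC (e + q) (D i)); lra.
have avgD : N *: \sum_i D i = Dl m - Dl u by rewrite -avg_op_diff.
have avgstep : N * (\sum_i dotv (outer_step Z F gamma eta p H i z m - zstar)
                  (outer_step Z F gamma eta p H i z m - zstar)) <=
    dotv (e + q) (e + q) + 2 * dotv Y2 (e + q) + (gamma * delta) ^+ 2 * dotv (b - e) (b - e).
  apply: le_trans (ler_wpM2l N_ge0 (ler_sum _ (fun i _ => step i))) _.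
  rewrite !big_split /= !mulrDr avg_cst -!mulr_sumr -dotv_suml.
  have -> : N * (2 * gamma * dotv (\sum_i D i) (e + q)) = 2 * dotv Y2 (e + q).
    by rewrite /Y2 dotvZl -avgD dotvZl; ring.
  rewrite lerD2l exprMn (mulrCA N) -[leRHS]mulrA ler_pM2l ?exprn_gt0// -muE.
  have := F_similar ord0 Zm Zu; rewrite sqr_enorm.
  by under eq_bigr do rewrite sqr_enorm.
apply: le_trans (lerD avgstep (lexx _)) _; rewrite zE mE.
have hY1 : dotv Y1 Y1 <= (gamma * delta) ^+ 2 * dotv e e.
  rewrite /Y1 dotvZl dotvZr mulrA exprMn -expr2 -[leRHS]mulrA ler_pM2l ?exprn_gt0//.
  apply: le_trans (avg_op_similar ord0 Zuh Zu) _.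
  by rewrite /e !dotv_sqrB (dotvC uh u); lra.
have hY2 : dotv Y2 Y2 <= (gamma * delta) ^+ 2 * dotv (b - e) (b - e).
  rewrite /Y2 dotvZl dotvZr mulrA exprMn -expr2 -[leRHS]mulrA ler_pM2l ?exprn_gt0//.
  by rewrite -muE; apply: (avg_op_similar ord0 Zm Zu).
have hvi : gamma * mu * dotv q q + dotv Y2 q - dotv Y1 q <= (1 - p) * dotv a q + p * dotv b q.
  have h1 := uh_sol _ zstar_in; have h2 := F_strongly_monotone Zuh zstar_in.
  have h3 := zstar_sol Zuh.
  have Gq : gamma * dotv (G uh) q = gamma * dotv (F ord0 uh + Dl m) q
      - ((1 - p) * dotv a q + p * dotv b q).
    have -> : G uh = (F ord0 uh + Dl m) - gamma^-1 *: ((1 - p) *: a + p *: b).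
      by apply/rowP => j; rewrite !mxE; ring.
    rewrite dotvDl dotvNl dotvZl (dotvDl ((1 - p) *: a)) !dotvZl.
    by rewrite mulrBr mulrA divff ?gt_eqF// mul1r.
  have h4 : gamma * dotv (G uh) q <= 0.
    by rewrite pmulr_rle0// -oppr_ge0 -dotvNr /q opprB.
  have h5 : mu * dotv q q <= dotv (avg_op F uh) q.
    by move: h2 h3; rewrite sqr_enorm -/q dotvDl dotvNl; lra.
  have h6 : gamma * (mu * dotv q q) <= gamma * dotv (avg_op F uh) q by rewrite ler_pM2l.
  have h7 : gamma * dotv (avg_op F uh) q + dotv Y2 q - dotv Y1 q =
      gamma * dotv (F ord0 uh + Dl m) q.
    have -> : F ord0 uh + Dl m = avg_op F uh + (Dl m - Dl u) - (Dl uh - Dl u).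
      by apply/rowP => j; rewrite !mxE; ring.
    rewrite /Y1 /Y2 !(dotvZl gamma) (dotvDl (avg_op F uh + (Dl m - Dl u))).
    by rewrite (dotvDl (avg_op F uh) (Dl m - Dl u)) (dotvNl (Dl uh - Dl u)); ring.
  by lra.
apply: (@descent_core _ _ (gamma * mu) p th ((gamma * delta) ^+ 2)
  q e a b Y1 Y2) => //.
- by rewrite mulr_gt0.
- exact: th_gamma.
- exact: th_le.
Qed.

Lemma descent_rate z0 K : Z z0 ->
  iter K (averaged (@draw_weight R n p) (round Z F gamma eta p H))
    (fun s => dotv (s.1 - zstar) (s.1 - zstar)) (z0, z0)
  <= (1 - gamma * mu / 2) ^+ K * (2 * dotv (z0 - zstar) (z0 - zstar)).
Proof.
move=> Zz0.
(* The anchor starts at [z0] as well, so [V] starts at twice the squared distance: this is the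
   factor 2 of the rate. *)
pose V (s : 'rV[R]_d * 'rV[R]_d) :=
  dotv (s.1 - zstar) (s.1 - zstar) + dotv (s.2 - zstar) (s.2 - zstar).
pose inv (s : 'rV[R]_d * 'rV[R]_d) := Z s.1 /\ Z s.2.
have round_inv j s : inv s -> inv (round Z F gamma eta p H j s).
  by case: j => i [] [Z1 Z2]; split => //=; exact: outer_step_in.
have w0 j : 0 <= @draw_weight R n p j.
  by apply: draw_weight_ge0; rewrite ?(ltW p_gt0)// (le_trans p_le)// invf_le1 ?ler1n.
have rho0 : 0 <= 1 - gamma * mu / 2 by move: gamma_mu p_le; lra.
have Vstep s : inv s ->
    averaged (@draw_weight R n p) (round Z F gamma eta p H) V s <= (1 - gamma * mu / 2) * V s.
  move=> [Z1 Z2]; rewrite /averaged sum_draw_weight.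
  apply: le_trans (outer_step_descent Z1 Z2).
  rewrite -[X in _ <= _ + X]avg_cst -mulrDr -big_split /=.
  rewrite le_eqVlt; apply/orP; left; apply/eqP; congr (_ * _).
  by apply: eq_bigr => i _; rewrite /V /=; ring.
have h := averaged_contraction w0 round_inv rho0 Vstep K (conj Zz0 Zz0 : inv (z0, z0)).
have h2 := iter_averaged_le w0 round_inv (f := fun s => dotv (s.1 - zstar) (s.1 - zstar)) (g := V) K
  _ (conj Zz0 Zz0 : inv (z0, z0)).
apply: le_trans (h2 _) _; first by move=> s _; rewrite lerDl dotv_ge0.
apply: le_trans h _; rewrite /V /= le_eqVlt; apply/orP; left; apply/eqP; ring.
Qed.

End algorithm.

(** * Extragradient steps for operators close to the identity *)

Section two_step.
Variables (R : realType) (d : nat).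

(* The squares [s1], ..., [s4] are a rounded LDL decomposition, the remaining ones
   absorb the rounding errors. *)
Lemma two_step_scalar_form (a b1 w1 b2 w2 : R) :
  23 / 12 * ((a - 4^-1 * b1) * w1 - w1 * w1) +
  13 / 20 * (3 / 4 * (w1 * b2) - b2 * b2) +
  2 * ((w1 - 4^-1 * b2) * w2 - w2 * w2) +
  39 / 12 * (((3 / 4) * a - b1) * (b1 - (23 / 39) * w1 - (16 / 39) * w2)) +
  22 / 10000 * (b1 * b1 + w1 * w1 + b2 * b2 + w2 * w2) <=
  671 / 1000 * (a * a) - w2 * w2.
Proof.
have s1 := sqr_ge0 (a - (1137/625) * b1 - (447/1250) * w1 + (933/1250) * w2).
have s2 := sqr_ge0 (b1 - (1401/1250) * w1 + (59/250) * w2).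
have s3 := sqr_ge0 (w1 - (57/125) * b2 - (2567/2500) * w2).
have s4 := sqr_ge0 (w2 - (17/250) * b2).
have s5 := sqr_ge0 b2; have s6 := sqr_ge0 a; have s7 := sqr_ge0 b1.
have s8 := sqr_ge0 w1; have s9 := sqr_ge0 w2.
have t1 := sqr_ge0 (b1 + a); have t2 := sqr_ge0 (w1 + a).
have t3 := sqr_ge0 (w1 - b1); have t4 := sqr_ge0 (b2 - w1).
have t5 := sqr_ge0 (w2 - a); have t6 := sqr_ge0 (w2 - b1).
have t7 := sqr_ge0 (w2 + w1); have t8 := sqr_ge0 (w2 - b2).
lra.
Qed.

(** The coefficients of the form are scalars, so it is the sum over the coordinates of the scalar
    form. *)
Lemma two_step_form_ge0 (a b1 w1 b2 w2 : 'rV[R]_d) :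
  23 / 12 * (dotv (a - 4^-1 *: b1) w1 - dotv w1 w1) +
  13 / 20 * (3 / 4 * dotv w1 b2 - dotv b2 b2) +
  2 * (dotv (w1 - 4^-1 *: b2) w2 - dotv w2 w2) +
  39 / 12 * dotv ((3 / 4) *: a - b1) (b1 - (23 / 39) *: w1 - (16 / 39) *: w2) +
  22 / 10000 * (dotv b1 b1 + dotv w1 w1 + dotv b2 b2 + dotv w2 w2) <=
  671 / 1000 * dotv a a - dotv w2 w2.
Proof.
rewrite /dotv !mulr_sumr -!sumrB -!big_split /= !mulr_sumr -!big_split /=.
apply: ler_sum => j _; rewrite !mxE.
exact: two_step_scalar_form.
Qed.

(* The multipliers 23/12, 13/20, 2 and 39/12 make the normal-cone terms [h] cancel. *)
Lemma two_step_contraction (a b1 w1 b2 w2 f1 f2 g1 g2 : 'rV[R]_d)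
    (hv h1 hv' h2 q0 ph : R) :
  0 <= hv -> 0 <= hv' -> 0 <= h2 ->
  dotv f1 f1 <= ph -> dotv f2 f2 <= ph -> dotv g1 g1 <= ph -> dotv g2 g2 <= ph ->
  dotv w1 w1 + h1 <= dotv (a - 4^-1 *: b1 + f2) w1 + 13 / 16 * q0 ->
  dotv b2 b2 + hv' <= dotv ((3 / 4) *: w1 + g1) b2 + 3 / 4 * (13 / 16 * q0) ->
  dotv w2 w2 + h2 <= dotv (w1 - 4^-1 *: b2 + g2) w2 + 13 / 16 * (13 / 16 * q0) ->
  0 <= dotv ((3 / 4) *: a + f1 - b1) (b1 - (23 / 39) *: w1 - (16 / 39) *: w2) +
       23 / 39 * h1 + 16 / 39 * h2 - hv ->
  0 <= q0 ->
  dotv w2 w2 <= 671 / 1000 * dotv a a + 33 / 10 * q0 + 4200 * ph.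
Proof.
(* The Young parameters are tuned so that each of [b1], [w1], [b2], [w2] is charged at most
   [22 / 10000] of its square, the slack left in the form; the multiples of [ph] then add up to less
   than [4200]. *)
have y1 := @dotv_young R d 872 f2 w1 ltac:(lra).
have y2 := @dotv_young R d 872 f1 (- w1) ltac:(lra).
have y3 := @dotv_young R d 148 g1 b2 ltac:(lra).
have y4 := @dotv_young R d 770 g2 w2 ltac:(lra).
have y5 := @dotv_young R d 740 f1 (- w2) ltac:(lra).
have y6 := @dotv_young R d 739 f1 b1 ltac:(lra).
move=> hv0 hv'0 h20 F1 F2 G1 G2 B A B' K q00.
have := two_step_form_ge0 a b1 w1 b2 w2.
have bb := dotv_ge0 b1; have ww := dotv_ge0 w1; have w22 := dotv_ge0 w2.
have b22 := dotv_ge0 b2; have ph0 := le_trans (dotv_ge0 f1) F1.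
have fE : dotv ((3 / 4) *: a + f1 - b1) (b1 - (23 / 39) *: w1 - (16 / 39) *: w2) =
  dotv ((3 / 4) *: a - b1) (b1 - (23 / 39) *: w1 - (16 / 39) *: w2)
  + dotv f1 b1 - 23 / 39 * dotv f1 w1 - 16 / 39 * dotv f1 w2.
  by rewrite addrAC (dotvDl _ f1) !(dotvDr _ _ f1) !(dotvNr _ f1) !(dotvZr _ _ f1); lra.
have fB : dotv (a - 4^-1 *: b1 + f2) w1 = dotv (a - 4^-1 *: b1) w1 + dotv f2 w1.
  exact: dotvDl.
have fB' : dotv (w1 - 4^-1 *: b2 + g2) w2 = dotv (w1 - 4^-1 *: b2) w2 + dotv g2 w2.
  exact: dotvDl.
have fA : dotv ((3 / 4) *: w1 + g1) b2 = 3 / 4 * dotv w1 b2 + dotv g1 b2.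
  by rewrite dotvDl dotvZl.
move: B A B' K y1 y2 y3 y4 y5 y6 F1 F2 G1 G2 bb ww b22 w22.
rewrite fE fB fB' fA !dotvNr !dotvNl !opprK.
move: (dotv (a - _) w1) (dotv (w1 - _) w2) (dotv ((3 / 4) *: a - b1) _).
move: (dotv f1 f1) (dotv f2 f2) (dotv g1 g1) (dotv g2 g2) (dotv f2 w1) (dotv f1 w1)
  (dotv g1 b2) (dotv g2 w2) (dotv f1 w2) (dotv f1 b1) (dotv a a) (dotv b1 b1)
  (dotv w1 w1) (dotv b2 b2) (dotv w2 w2) (dotv w1 b2).
clear -ph0 hv0 hv'0 h20 q00; intros; lra.
Qed.

End two_step.

(** * Alignment of the extragradient iterates along a segment *)

Section alignment.
Variables (R : realType) (d : nat) (Z : set 'rV[R]_d).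
Hypotheses (Z_nonempty : Z !=set0) (Z_closed : closed Z)
  (Z_convex : @convex_set R 'rV[R]_d Z).
Variables (A : 'rV[R]_d -> 'rV[R]_d) (c x : 'rV[R]_d) (eps rho : R).
Hypotheses (eps_ge0 : 0 <= eps) (eps_le : eps <= 4^-1) (rho_gt0 : 0 < rho)
  (rho_eps : rho * (1 + eps) = 4^-1)
  (A_mono : forall u v, Z u -> Z v -> 0 <= dotv (A u - A v) (u - v))
  (A_lip : forall u v, Z u -> Z v ->
     dotv (A u - A v) (A u - A v) <= eps ^+ 2 * dotv (u - v) (u - v)).

Let G u := A u + u - c.

Hypotheses (Zx : Z x) (x_sol : forall y, Z y -> 0 <= dotv (G x) (y - x)).

Let Zproj v := proj_in Z_nonempty Z_closed Z_convex v.
Let N := rho *: (c - A x - x).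

Let N_normal y : Z y -> 0 <= dotv N (x - y).
Proof.
move=> Zy; rewrite /N dotvZl pmulr_rge0//.
have -> : dotv (c - A x - x) (x - y) = dotv (G x) (y - x).
  have -> : c - A x - x = - G x by apply/rowP => j; rewrite !mxE; ring.
  by rewrite dotvNl -dotvNr opprB.
exact: x_sol.
Qed.

Let half u := proj Z (u - rho *: G u).

(* The operator is the identity up to the [eps]-Lipschitz term [A], and [rho] is
   close to 1/4. *)
Lemma eg_argument u v : Z u -> Z v -> exists2 f : 'rV[R]_d,
  u - rho *: G v = x + (u - x) - 4^-1 *: (v - x) + f + N &
  dotv f f <= eps ^+ 2 / 4 * dotv (v - x) (v - x).
Proof.
move=> Zu Zv; exists (rho *: (eps *: (v - x) - (A v - A x))).
  apply/rowP => j; rewrite !mxE.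
  have -> : 4^-1 = rho * (1 + eps) by [].
  ring.
rewrite dotvZl dotvZr mulrA; apply: (@le_trans _ _ (rho * rho * (2 * (eps ^+ 2 * dotv (v - x) (v - x)) + 2 * (eps ^+ 2 * dotv (v - x) (v - x))))).
  apply: ler_wpM2l; first by rewrite mulr_ge0// ltW.
  have := A_lip Zv Zx; set a := A v - A x; set b := v - x.
  have := dotv_ge0 (eps *: b + a); rewrite dotv_sqrD (dotv_sqrB (eps *: b)).
  rewrite !dotvZl !dotvZr; lra.
have -> : rho * rho * (2 * (eps ^+ 2 * dotv (v - x) (v - x)) + 2 * (eps ^+ 2 * dotv (v - x) (v - x)))
  = (4 * (rho * rho)) * (eps ^+ 2 * dotv (v - x) (v - x)) by ring.
have -> : eps ^+ 2 / 4 * dotv (v - x) (v - x) = 4^-1 * (eps ^+ 2 * dotv (v - x) (v - x)).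
  by ring.
apply: ler_wpM2r; first by rewrite mulr_ge0 ?dotv_ge0 ?sqr_ge0.
have r4 : rho <= 4^-1 by rewrite -rho_eps mulrDr mulr1 lerDl mulr_ge0// ltW.
by move: rho_gt0; nra.
Qed.

Lemma eg_half_argument u : Z u -> exists2 f : 'rV[R]_d,
  u - rho *: G u = x + (3 / 4) *: (u - x) + f + N &
  dotv f f <= eps ^+ 2 / 4 * dotv (u - x) (u - x).
Proof.
move=> Zu; have [f fE f_le] := eg_argument Zu Zu; exists f => //.
by rewrite fE; apply/rowP => j; rewrite !mxE; field.
Qed.

Lemma eg_half_dist u : Z u -> dotv (half u - x) (half u - x) <= dotv (u - x) (u - x).
Proof.
move=> Zu; have [f fE f_le] := eg_half_argument Zu.
have := proj_vi Z_nonempty Z_closed Z_convex (u - rho *: G u) Zx.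
have := N_normal (Zproj (u - rho *: G u)).
rewrite -/(half u) fE; set v := half u; clearbody v.
have h := dotv_young ((3 / 4) *: (u - x) + f) (v - x) ltr01.
have h2 := @dotv_young R d 3^-1 ((3 / 4) *: (u - x)) f ltac:(lra).
have e2 : eps ^+ 2 / 4 * dotv (u - x) (u - x) <= 64^-1 * dotv (u - x) (u - x).
  by apply: ler_wpM2r; [exact: dotv_ge0 | by move: eps_ge0 eps_le; nra].
have -> : x + (3 / 4) *: (u - x) + f + N - v = ((3 / 4) *: (u - x) + f) - (v - x) + N.
  by apply/rowP => j; rewrite !mxE; ring.
have -> : x - v = - (v - x) by rewrite opprB.
rewrite !(dotvNr (v - x)) (dotvDl _ N) (dotvDl _ (- (v - x))) (dotvNl (v - x)).
move: h h2; rewrite (dotv_sqrD _ f) !(dotvZl (3 / 4)) !(dotvZr (3 / 4)) invr1 !mul1r.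
move: f_le e2; set a := dotv (u - x) (u - x).
have a0 : 0 <= a := dotv_ge0 _.
move: (dotv (_ + f) _) (dotv (u - x) f) (dotv f f) (dotv (v - x) (v - x)) (dotv N (v - x)).
move: a a0; move=> a a0 b1 b2 b3 b4 b5; lra.
Qed.

Lemma eg_step_dist u : Z u ->
  dotv (eg_step Z G rho u - x) (eg_step Z G rho u - x) <= dotv (u - x) (u - x).
Proof.
move=> Zu.
have G_mono v w : Z v -> Z w -> 1 * dotv (v - w) (v - w) <= dotv (G v - G w) (v - w).
  move=> Zv Zw; have -> : G v - G w = (A v - A w) + (v - w).
    by apply/rowP => j; rewrite !mxE; ring.
  by rewrite (dotvDl _ (v - w)) mul1r lerDr A_mono.
have G_lip v w : Z v -> Z w ->
    dotv (G v - G w) (G v - G w) <= (1 + eps) ^+ 2 * dotv (v - w) (v - w).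
  move=> Zv Zw; have -> : G v - G w = (A v - A w) + (v - w).
    by apply/rowP => j; rewrite !mxE; ring.
  rewrite -!sqr_enorm -exprMn ler_pXn2r ?nnegrE ?mulr_ge0 ?enorm_ge0 ?addr_ge0//.
  apply: le_trans (ler_enormD _ _) _; rewrite [leRHS]mulrDl mul1r addrC lerD2l.
  by rewrite -(@ler_pXn2r _ 2)// ?nnegrE ?mulr_ge0 ?enorm_ge0// exprMn !sqr_enorm A_lip.
have D := eg_step_descent Z_nonempty Z_closed Z_convex G_mono G_lip rho_gt0 rho_eps Zu Zx x_sol.
cbv zeta in D; apply: le_trans D _.
set v := proj _ _; have := dotv_ge0 (v - u); have := dotv_ge0 (v - x).
by move: (dotv (v - x) _) (dotv (v - u) _) (dotv (u - x) _) rho_gt0 => a b e r0 *; nra.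
Qed.

(** The projection inequality with the normal part split off. The pairing with [N] is kept exactly,
    because it is not small and has no fixed sign for a general test point. *)
Lemma eg_half_vi u : Z u -> exists2 f : 'rV[R]_d,
  dotv f f <= eps ^+ 2 / 4 * dotv (u - x) (u - x) &
  forall y, Z y -> 0 <= dotv (x + (3 / 4) *: (u - x) + f - half u) (half u - y) +
    dotv N (half u - y).
Proof.
move=> Zu; have [f fE f_le] := eg_half_argument Zu; exists f => // y Zy.
have := proj_vi Z_nonempty Z_closed Z_convex (u - rho *: G u) Zy.
rewrite -/(half u) fE -oppr_ge0 -dotvNr opprB.
by rewrite addrAC (dotvDl _ N).
Qed.

Lemma eg_step_vi u : Z u -> exists2 f : 'rV[R]_d,
  dotv f f <= eps ^+ 2 / 4 * dotv (half u - x) (half u - x) &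
  forall y, Z y ->
    0 <= dotv (u - 4^-1 *: (half u - x) + f - eg_step Z G rho u) (eg_step Z G rho u - y) +
    dotv N (eg_step Z G rho u - y).
Proof.
move=> Zu; have [f fE f_le] := eg_argument Zu (Zproj (u - rho *: G u)); exists f => // y Zy.
have := proj_vi Z_nonempty Z_closed Z_convex (u - rho *: G (half u)) Zy.
rewrite fE -/(half u) -[proj Z _]/(proj Z _) /eg_step -fE -/(half u).
rewrite -oppr_ge0 -dotvNr opprB fE addrAC (dotvDl _ N).
by have -> : x + (u - x) = u by rewrite addrC subrK.
Qed.

Variable y : 'rV[R]_d.
Hypothesis Zy : Z y.

Let pt l := x - l *: (x - y).
Let Q := dotv N (x - y).

Let pt_in l : 0 <= l -> l <= 1 -> Z (pt l).
Proof.
move=> l0 l1; have := segment_in Z_convex l0 l1 Zx Zy; congr (Z _).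
by rewrite /pt -scalerN opprB.
Qed.

Let N_pt v l : dotv N (v - pt l) = l * Q - dotv N (x - v).
Proof.
have -> : v - pt l = l *: (x - y) - (x - v) by apply/rowP => j; rewrite !mxE; ring.
by rewrite (dotvDr (l *: (x - y)) (- (x - v)) N) (dotvNr (x - v) N) (dotvZr l (x - y) N).
Qed.

Let normal_ineq (a w : 'rV[R]_d) (t h : R) : 0 <= dotv (a - w) w + (t - h) ->
  dotv w w + h <= dotv a w + t.
Proof. by rewrite dotvDl dotvNl; move: (dotv a w) (dotv w w) => ? ?; lra. Qed.

(** The factors [3 / 4], [13 / 16] and their products follow [pt l] through the linear dynamics
    around [x] that results from [A = 0] and no constraint; the projection inequalities are tested
    at these points. Only the first half step is tested at a convex combination of both results.
    This couples the two steps: the pairing of [N] with [x - w1] cancels, whereas a single step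
    gives only the factor [11 / 10] below. *)
Lemma eg_two_steps u l : Z u -> 0 <= l -> l <= 1 ->
  let w := eg_step Z G rho (eg_step Z G rho u) in
  dotv (w - pt (169 / 256 * l)) (w - pt (169 / 256 * l)) <=
  671 / 1000 * dotv (u - pt l) (u - pt l) + 33 / 10 * (l * Q)
  + 1050 * eps ^+ 2 * dotv (u - x) (u - x).
Proof.
move=> Zu l0 l1; cbv zeta.
have [l1' l1''] : 0 <= 13 / 16 * l /\ 13 / 16 * l <= 1 by split; lra.
have [l2' l2''] : 0 <= 3 / 4 * (13 / 16 * l) /\ 3 / 4 * (13 / 16 * l) <= 1 by split; lra.
have [l3' l3''] : 0 <= 169 / 256 * l /\ 169 / 256 * l <= 1 by split; lra.
have [b0' b0''] : 0 <= 16 / 39 :> R /\ 16 / 39 <= 1 :> R by split; lra.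
set w1 := eg_step Z G rho u; set w2 := eg_step Z G rho w1.
have Zw1 : Z w1 by exact: Zproj.
have Zw2 : Z w2 by exact: Zproj.
have Q0 : 0 <= Q := N_normal Zy.
have [f1 f1_le F1] := eg_half_vi Zu; have [f2 f2_le F2] := eg_step_vi Zu.
have [g1 g1_le G1] := eg_half_vi Zw1; have [g2 g2_le G2] := eg_step_vi Zw1.
have du := eg_half_dist Zu; have dw := eg_half_dist Zw1; have dw1 := eg_step_dist Zu.
rewrite -/w1 in F2 dw1; rewrite -/w2 in G2.
have Zb1 : Z (half u) := Zproj _; have Zb2 : Z (half w1) := Zproj _.
have Hv := N_normal Zb1; have Hv' := N_normal Zb2; have H2 := N_normal Zw2.
have bound (f v : 'rV[R]_d) : dotv f f <= eps ^+ 2 / 4 * dotv (v - x) (v - x) ->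
    dotv (v - x) (v - x) <= dotv (u - x) (u - x) ->
    dotv f f <= eps ^+ 2 / 4 * dotv (u - x) (u - x).
  by move=> h1 h2; apply: le_trans h1 _; apply: ler_wpM2l; rewrite ?divr_ge0 ?sqr_ge0.
have {}f2_le := bound _ _ f2_le du.
have {}g1_le := bound _ _ g1_le dw1.
have {}g2_le := bound _ _ g2_le (le_trans dw dw1).
set b1 := half u in F1 F2 Zb1 Hv; set b2 := half w1 in G1 G2 Zb2 Hv'.
have K := F1 (w1 + (16 / 39) *: (w2 - w1)).
have B := F2 (pt (13 / 16 * l)); have A' := G1 (pt (3 / 4 * (13 / 16 * l))).
have B' := G2 (pt (169 / 256 * l)).
have := @two_step_contraction R d (u - pt l) (b1 - pt (3 / 4 * l)) (w1 - pt (13 / 16 * l))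
  (b2 - pt (3 / 4 * (13 / 16 * l))) (w2 - pt (169 / 256 * l)) f1 f2 g1 g2
  (dotv N (x - b1)) (dotv N (x - w1)) (dotv N (x - b2)) (dotv N (x - w2)) (l * Q)
  (eps ^+ 2 / 4 * dotv (u - x) (u - x)).
have -> : 4200 * (eps ^+ 2 / 4 * dotv (u - x) (u - x)) =
  1050 * eps ^+ 2 * dotv (u - x) (u - x) by field.
clearbody b1 b2 w1 w2; apply => //.
- rewrite mulrA; apply: normal_ineq.
  have := B (pt_in l1' l1''); rewrite N_pt.
  have -> : u - 4^-1 *: (b1 - x) + f2 - w1 =
    (u - pt l - 4^-1 *: (b1 - pt (3 / 4 * l)) + f2) - (w1 - pt (13 / 16 * l)).
    by apply/rowP => j; rewrite !mxE; field.
  by [].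
- have -> : 3 / 4 * (13 / 16 * (l * Q)) = 3 / 4 * (13 / 16 * l) * Q by field.
  apply: normal_ineq.
  have := A' (pt_in l2' l2''); rewrite N_pt.
  have -> : x + (3 / 4) *: (w1 - x) + g1 - b2 =
    ((3 / 4) *: (w1 - pt (13 / 16 * l)) + g1) - (b2 - pt (3 / 4 * (13 / 16 * l))).
    by apply/rowP => j; rewrite !mxE; field.
  by [].
- have -> : 13 / 16 * (13 / 16 * (l * Q)) = 169 / 256 * l * Q by field.
  apply: normal_ineq.
  have := B' (pt_in l3' l3''); rewrite N_pt.
  have -> : w1 - 4^-1 *: (b2 - x) + g2 - w2 =
    (w1 - pt (13 / 16 * l) - 4^-1 *: (b2 - pt (3 / 4 * (13 / 16 * l))) + g2)
    - (w2 - pt (169 / 256 * l)).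
    by apply/rowP => j; rewrite !mxE; field.
  by [].
- have := K (segment_in Z_convex b0' b0'' Zw1 Zw2).
  have -> : x + (3 / 4) *: (u - x) + f1 - b1 =
    (3 / 4) *: (u - pt l) + f1 - (b1 - pt (3 / 4 * l)).
    by apply/rowP => j; rewrite !mxE; field.
  have E : b1 - (w1 + (16 / 39) *: (w2 - w1)) = b1 - pt (3 / 4 * l)
      - (23 / 39) *: (w1 - pt (13 / 16 * l)) - (16 / 39) *: (w2 - pt (169 / 256 * l)).
    by apply/rowP => j; rewrite !mxE; field.
  rewrite {1}E.
  have -> : dotv N (b1 - (w1 + (16 / 39) *: (w2 - w1))) =
    23 / 39 * dotv N (x - w1) + 16 / 39 * dotv N (x - w2) - dotv N (x - b1).
    have -> : b1 - (w1 + (16 / 39) *: (w2 - w1)) =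
      (23 / 39) *: (x - w1) + (16 / 39) *: (x - w2) - (x - b1).
      by apply/rowP => j; rewrite !mxE; field.
    by rewrite (dotvDr _ (- (x - b1))) (dotvNr (x - b1)) (dotvDr ((23 / 39) *: (x - w1)))
      (dotvZr _ (x - w1)) (dotvZr _ (x - w2)).
  by rewrite !addrA.
- by rewrite mulr_ge0.
Qed.

(** A crude bound, needed once when [H] is odd. *)
Lemma eg_one_step u l : Z u -> 0 <= l -> l <= 1 ->
  dotv (eg_step Z G rho u - pt (13 / 16 * l)) (eg_step Z G rho u - pt (13 / 16 * l)) <=
  11 / 10 * dotv (u - pt l) (u - pt l) + 22 / 10 * (l * Q)
  + 6 * eps ^+ 2 * dotv (u - x) (u - x).
Proof.
move=> Zu l0 l1.
have [l1' l1''] : 0 <= 13 / 16 * l /\ 13 / 16 * l <= 1 by split; lra.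
have [l2' l2''] : 0 <= 3 / 4 * l /\ 3 / 4 * l <= 1 by split; lra.
set w := eg_step Z G rho u.
have Zw : Z w by exact: Zproj.
have Q0 : 0 <= Q := N_normal Zy.
have [f1 f1_le F1] := eg_half_vi Zu; have [f2 f2_le F2] := eg_step_vi Zu.
have du := eg_half_dist Zu; rewrite -/w in F2.
have Zb : Z (half u) := Zproj _; have Hv := N_normal Zb; have H2 := N_normal Zw.
have {}f2_le : dotv f2 f2 <= eps ^+ 2 / 4 * dotv (u - x) (u - x).
  by apply: le_trans f2_le _; apply: ler_wpM2l; rewrite ?divr_ge0 ?sqr_ge0.
set b := half u in F1 F2 Zb Hv du.
have A' := F1 (pt (3 / 4 * l)) (pt_in l2' l2''); have B := F2 (pt (13 / 16 * l)) (pt_in l1' l1'').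
clearbody b w; rewrite !N_pt in A' B.
have E1 : x + (3 / 4) *: (u - x) + f1 - b = ((3 / 4) *: (u - pt l) + f1) - (b - pt (3 / 4 * l)).
  by apply/rowP => j; rewrite !mxE; field.
have E2 : u - 4^-1 *: (b - x) + f2 - w =
    (u - pt l - 4^-1 *: (b - pt (3 / 4 * l)) + f2) - (w - pt (13 / 16 * l)).
  by apply/rowP => j; rewrite !mxE; field.
rewrite E1 in A'; rewrite E2 in B.
have {}A' := normal_ineq A'; have {}B := normal_ineq B.
have q0 : 0 <= l * Q by rewrite mulr_ge0.
rewrite -(mulrA (3 / 4) l Q) in A'; rewrite -(mulrA (13 / 16) l Q) in B; rewrite -(mulrA 6).
move: A' B f1_le f2_le; rewrite -(mulrA (eps ^+ 2)).
have -> : eps ^+ 2 * (4^-1 * dotv (u - x) (u - x)) = 4^-1 * (eps ^+ 2 * dotv (u - x) (u - x)).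
  by ring.
move: (u - pt l) (b - pt _) (w - pt _) (l * Q) q0 (dotv N (x - b)) Hv (dotv N (x - w)) H2
  (eps ^+ 2 * _) => {E1 E2 F1 F2}.
move=> a v r q q0 hv hv0 h h0 e A' B f1_le f2_le.
have y1 := dotv_young (a - 4^-1 *: v + f2) r ltr01.
have y2 := @dotv_young R d 20^-1 (a - 4^-1 *: v) f2 ltac:(rewrite invr_gt0; exact: ltr0n).
have y3 := dotv_young f1 v ltr01.
have vv := dotv_ge0 v; have aa := dotv_ge0 a; have ff := dotv_ge0 f1.
move: A' B y1 y2 y3; rewrite (dotv_sqrD (a - 4^-1 *: v) f2) (dotvDl _ f1 v) (dotv_sqrB a)
  invr1 !mul1r invrK !(dotvZl (4^-1)) !(dotvZr (4^-1)) !(dotvZl (3 / 4)).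
move: f1_le f2_le vv aa ff q0 hv0 h0.
move: (dotv f1 f1) (dotv f2 f2) (dotv v v) (dotv a a) (dotv a v) (dotv f1 v)
  (dotv (a - _) f2) (dotv r r) (dotv (_ + f2) r).
by intros; lra.
Qed.

Lemma eg_iter_dist u k : Z u -> Z (iter k (eg_step Z G rho) u) /\
  dotv (iter k (eg_step Z G rho) u - x) (iter k (eg_step Z G rho) u - x)
  <= dotv (u - x) (u - x).
Proof.
move=> Zu.
have [||Zi] := @eg_iter_contraction _ _ _ Z_nonempty Z_closed Z_convex G rho 1 u x k _ Zu.
- exact: ler01.
- by move=> v Zv; rewrite mul1r eg_step_dist.
by rewrite expr1n mul1r.
Qed.

(** Each pair of steps adds [33 / 10] times the current parameter times [Q]. The parameter decreases
    by [169 / 256], faster than [671 / 1000], so the coefficient grows linearly in [j], by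
    [(33 / 10) / (671 / 1000) < 492 / 100] each time. The [eps] terms form a geometric series, with
    [1050 / (1 - 671 / 1000) < 3200]. *)
Lemma eg_even_steps u l j : Z u -> 0 <= l -> l <= 1 ->
  let w := iter j.*2 (eg_step Z G rho) u in
  let lj := (169 / 256) ^+ j * l in
  dotv (w - pt lj) (w - pt lj) <=
  (671 / 1000) ^+ j * (dotv (u - pt l) (u - pt l) + 492 / 100 * j%:R * (l * Q))
  + 3200 * (eps ^+ 2 * dotv (u - x) (u - x)).
Proof.
move=> Zu l0 l1; cbv zeta.
have e0 : 0 <= eps ^+ 2 * dotv (u - x) (u - x) by rewrite mulr_ge0 ?sqr_ge0 ?dotv_ge0.
have q0 : 0 <= l * Q by rewrite mulr_ge0// N_normal.
have c0 : 0 <= 169 / 256 :> R by lra.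
have c1 : 169 / 256 <= 671 / 1000 :> R by lra.
have c2 : 671 / 1000 <= 1 :> R by lra.
have c3 : 0 <= 3200 :> R by lra.
elim: j => [|j IH].
  rewrite !expr0 !mul1r mulr0 mul0r addr0 lerDl; exact: mulr_ge0 c3 e0.
have [Zv vx] := eg_iter_dist j.*2 Zu.
rewrite doubleS !iterS; move: IH Zv vx; set v := iter _ _ _ => IH Zv vx.
have p0 : 0 <= (169 / 256) ^+ j :> R by exact: exprn_ge0 c0.
have p1 : (169 / 256) ^+ j <= (671 / 1000) ^+ j :> R.
  by apply: lerXn2r (c1); rewrite nnegrE; [exact: c0|exact: le_trans c0 c1].
have p2 : (671 / 1000) ^+ j <= 1 :> R by apply: exprn_ile1 c2; exact: le_trans c0 c1.
have lj0 : 0 <= (169 / 256) ^+ j * l by rewrite mulr_ge0.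
have lj1 : (169 / 256) ^+ j * l <= 1 by exact: mulr_ile1 p0 l0 (le_trans p1 p2) l1.
have /= D := eg_two_steps Zv lj0 lj1.
rewrite !(exprS _ j) -(mulrA (169 / 256)); apply: le_trans D _.
have hv : eps ^+ 2 * dotv (v - x) (v - x) <= eps ^+ 2 * dotv (u - x) (u - x).
  by rewrite ler_wpM2l ?sqr_ge0.
have hq : (169 / 256) ^+ j * (l * Q) <= (671 / 1000) ^+ j * (l * Q) by rewrite ler_wpM2r.
have hq0 : 0 <= (671 / 1000) ^+ j * (l * Q) by apply: mulr_ge0 q0; exact: le_trans p0 p1.
rewrite -(mulrA _ l Q) -(mulrA 1050) -[j.+1%:R]natr1.
move: IH hv hq hq0 e0; rewrite !mulrDr.
have -> : (671 / 1000) ^+ j * (492 / 100 * j%:R * (l * Q)) =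
  492 / 100 * (j%:R * ((671 / 1000) ^+ j * (l * Q))) by ring.
have -> : 671 / 1000 * (671 / 1000) ^+ j * ((492 / 100 * j%:R + 492 / 100 * 1) * (l * Q)) =
  671 / 1000 * (492 / 100 * (j%:R * ((671 / 1000) ^+ j * (l * Q)))) +
  671 / 1000 * (492 / 100 * ((671 / 1000) ^+ j * (l * Q))) by ring.
rewrite -(mulrA (671 / 1000) _ (dotv _ _)).
clear c1 c2 c3 p0 p1 p2 lj0 lj1 vx.
move: ((671 / 1000) ^+ j * (l * Q)) ((169 / 256) ^+ j * (l * Q)) => a b.
move: ((671 / 1000) ^+ j * _) (j%:R * a) => e f.
move: (dotv (v - pt _) _) (eps ^+ 2 * dotv (v - x) _) (eps ^+ 2 * _).
by intros; lra.
Qed.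

(* 13/16 = 1 - 1/4 (1 - 1/4) is the multiplier of an extragradient step of size 1/4
   for the identity. *)
Lemma eg_alignment u H : Z u ->
  let w := iter H (eg_step Z G rho) u in
  dotv (w - pt ((13 / 16) ^+ H)) (w - pt ((13 / 16) ^+ H)) <=
  (671 / 1000) ^+ H./2 * (11 / 10 * dotv (u - y) (u - y) + (492 / 100 * H./2%:R + 22 / 10) * Q)
  + 3206 * (eps ^+ 2 * dotv (u - x) (u - x)).
Proof.
move=> Zu; cbv zeta.
have e0 : 0 <= eps ^+ 2 * dotv (u - x) (u - x) by rewrite mulr_ge0 ?sqr_ge0 ?dotv_ge0.
have Q0 : 0 <= Q := N_normal Zy.
have pt1 : pt 1 = y by rewrite /pt scale1r opprB addrC subrK.
have c0 : 0 <= 671 / 1000 :> R by lra.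
have c1 : 671 / 1000 <= 1 :> R by lra.
have m0 : 0 <= 13 / 16 :> R by lra.
have m1 : 13 / 16 <= 1 :> R by lra.
have sqr : (13 / 16) ^+ 2 = 169 / 256 :> R by field.
have k0 : 0 <= (671 / 1000) ^+ H./2 :> R by exact: exprn_ge0 c0.
have k1 : (671 / 1000) ^+ H./2 <= 1 :> R by exact: exprn_ile1 c0 c1.
have ru := dotv_ge0 (u - y).
have [oddH|evenH] := boolP (odd H).
  (* The spare step is performed first, so that its loss [11 / 10] enters once; it moves the
     parameter from [1] to [13 / 16]. *)
  have HE : H = (H./2.*2).+1 by rewrite -[LHS]odd_double_half oddH.
  rewrite [in iter H _ _]HE iterSr; set v := eg_step Z G rho u.
  have Zv : Z v by exact: Zproj.
  have D := eg_even_steps H./2 Zv m0 m1; cbv zeta in D.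
  have ptE : (169 / 256) ^+ H./2 * (13 / 16) = (13 / 16) ^+ H :> R.
    by rewrite -sqr -exprM mulnC muln2 [in RHS]HE exprSr.
  rewrite ptE in D; apply: le_trans D _.
  have := eg_one_step Zu ler01 (lexx 1); rewrite !mulr1 -/v pt1 mul1r -(mulrA 6) => D.
  have hv : eps ^+ 2 * dotv (v - x) (v - x) <= eps ^+ 2 * dotv (u - x) (u - x).
    by rewrite ler_wpM2l ?sqr_ge0 ?eg_step_dist.
  have jQ : 0 <= H./2%:R * Q by rewrite mulr_ge0.
  have h : dotv (v - pt (13 / 16)) (v - pt (13 / 16)) + 492 / 100 * H./2%:R * (13 / 16 * Q) <=
      (11 / 10 * dotv (u - y) (u - y) + (492 / 100 * H./2%:R + 22 / 10) * Q) +
      6 * (eps ^+ 2 * dotv (u - x) (u - x)).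
    move: D jQ; rewrite (mulrDl (492 / 100 * _)) -!(mulrA (492 / 100)) (mulrCA H./2%:R).
    move: (dotv (v - pt _) _) (H./2%:R * Q) (eps ^+ 2 * _) (dotv (u - y) _).
    by intros; lra.
  have {}h := ler_wpM2l k0 h; rewrite (mulrDr _ (11 / 10 * _ + _)) in h.
  have h6 : (671 / 1000) ^+ H./2 * (6 * (eps ^+ 2 * dotv (u - x) (u - x))) <=
      6 * (eps ^+ 2 * dotv (u - x) (u - x)).
    by apply: ler_piMl k1; apply: mulr_ge0 e0; exact: ler0n.
  have c32 : 0 <= 3200 :> R by exact: ler0n.
  apply: le_trans (lerD h (ler_wpM2l c32 hv)) _; rewrite -addrA lerD2l.
  by apply: le_trans (lerD h6 (lexx _)) _; rewrite -mulrDl -natrD.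
have HE : H = H./2.*2 by rewrite -[LHS]odd_double_half (negbTE evenH).
have := eg_even_steps H./2 Zu ler01 (lexx 1); cbv zeta; rewrite -HE.
have -> : (169 / 256) ^+ H./2 * 1 = (13 / 16) ^+ H :> R.
  by rewrite mulr1 -sqr -exprM mulnC muln2 -HE.
rewrite pt1 !mul1r => D; apply: le_trans D _.
apply: lerD; last by move: e0; move: (eps ^+ 2 * _) => e e0; lra.
apply: (ler_wpM2l k0); rewrite (mulrDl (492 / 100 * _)); move: ru Q0.
move: (dotv (u - y) (u - y)); by intros; lra.
Qed.

End alignment.

(** * Numerical bounds for exponentials and for the inner rates *)

Lemma exprn_double_ge (R : realType) (a b c : R) n : 0 <= a -> a <= b ^+ n -> c <= a ^+ 2 -> c <= b ^+ (n * 2).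
Proof.
move=> a0 ab ca; apply: le_trans ca _; rewrite exprM.
by apply: lerXn2r; rewrite ?nnegrE// (le_trans a0 ab).
Qed.

Lemma expR_nat_ge (R : realType) (y : R) n : (0 < n)%N -> y <= n%:R -> (1 - y / n%:R) ^+ n <= expR (- y).
Proof.
move=> n0 yn; have -> : - y = n%:R * - (y / n%:R).
  by rewrite mulrN mulrC divfK// pnatr_eq0 -lt0n.
rewrite expRM_natl; apply: lerXn2r; rewrite ?nnegrE ?expR_ge0 ?expR_ge1Dx//.
by rewrite subr_ge0 ler_pdivrMr ?ltr0n// mul1r.
Qed.

Lemma expR_3_8 (R : realType) : 6867 / 10000 <= expR (- (3 / 8)) :> R.
Proof.
have h8 : 3 / 8 <= 128 :> R by lra.
have h := @expR_nat_ge R (3 / 8) 128 isT h8; apply: le_trans h.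
(* Seven squarings reach the power 128; each result is rounded down to keep the rationals short. *)
have -> : 1 - 3 / 8 / 128 = 1021 / 1024 :> R by field.
have n0 : (994 / 1000 + 149 / (1000 * 1000)) <= (1021 / 1024) ^+ 2 :> R by clear; lra.
have n1 : (988 / 1000 + 332 / (1000 * 1000)) <= ((994 / 1000 + 149 / (1000 * 1000))) ^+ 2 :> R by clear; lra.
have n2 : (976 / 1000 + 800 / (1000 * 1000)) <= ((988 / 1000 + 332 / (1000 * 1000))) ^+ 2 :> R by clear; lra.
have n3 : (954 / 1000 + 138 / (1000 * 1000)) <= ((976 / 1000 + 800 / (1000 * 1000))) ^+ 2 :> R by clear; lra.
have n4 : (910 / 1000 + 379 / (1000 * 1000)) <= ((954 / 1000 + 138 / (1000 * 1000))) ^+ 2 :> R by clear; lra.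
have n5 : (828 / 1000 + 789 / (1000 * 1000)) <= ((910 / 1000 + 379 / (1000 * 1000))) ^+ 2 :> R by clear; lra.
have n6 : 6867 / 10000 <= (828 / 1000 + 789 / (1000 * 1000)) ^+ 2 :> R by clear; lra.
have p0 : 0 <= (994 / 1000 + 149 / (1000 * 1000)) :> R by clear; lra.
have p1 : 0 <= (988 / 1000 + 332 / (1000 * 1000)) :> R by clear; lra.
have p2 : 0 <= (976 / 1000 + 800 / (1000 * 1000)) :> R by clear; lra.
have p3 : 0 <= (954 / 1000 + 138 / (1000 * 1000)) :> R by clear; lra.
have p4 : 0 <= (910 / 1000 + 379 / (1000 * 1000)) :> R by clear; lra.
have p5 : 0 <= (828 / 1000 + 789 / (1000 * 1000)) :> R by clear; lra.
have b0 : 0 <= 1021 / 1024 :> R by clear; lra.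
move: (1021 / 1024) b0 n0 => b b0 n0.
have h0 : b <= b ^+ 1 by rewrite expr1.
have := exprn_double_ge b0 h0 n0.
move=> /(exprn_double_ge p0)/(_ n1).
move=> /(exprn_double_ge p1)/(_ n2).
move=> /(exprn_double_ge p2)/(_ n3).
move=> /(exprn_double_ge p3)/(_ n4).
move=> /(exprn_double_ge p4)/(_ n5).
move=> /(exprn_double_ge p5)/(_ n6).
by [].
Qed.

Lemma expR_1_8 (R : realType) : expR (1 / 8) <= 2267 / 2000 :> R.
Proof.
have h8 : 1 / 8 <= 32 :> R by lra.
have h := @expR_nat_ge R (1 / 8) 32 isT h8.
have e : 1 - 1 / 8 / 32 = 255 / 256 :> R by field.
rewrite e in h.
(* The upper bound is the inverse of a lower bound at the opposite argument, again by repeated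
   squaring. *)
suff : 2000 / 2267 <= expR (- (1 / 8)) :> R.
  by rewrite expRN -invf_div lef_pV2 ?posrE ?expR_gt0 ?divr_gt0 ?ltr0n.
apply: le_trans h; move: e => _.
have n0 : (992 / 1000 + 202 / (1000 * 1000)) <= (255 / 256) ^+ 2 :> R by clear; lra.
have n1 : (984 / 1000 + 464 / (1000 * 1000)) <= ((992 / 1000 + 202 / (1000 * 1000))) ^+ 2 :> R by clear; lra.
have n2 : (969 / 1000 + 169 / (1000 * 1000)) <= ((984 / 1000 + 464 / (1000 * 1000))) ^+ 2 :> R by clear; lra.
have n3 : (939 / 1000 + 288 / (1000 * 1000)) <= ((969 / 1000 + 169 / (1000 * 1000))) ^+ 2 :> R by clear; lra.
have n4 : 2000 / 2267 <= (939 / 1000 + 288 / (1000 * 1000)) ^+ 2 :> R by clear; lra.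
have p0 : 0 <= (992 / 1000 + 202 / (1000 * 1000)) :> R by clear; lra.
have p1 : 0 <= (984 / 1000 + 464 / (1000 * 1000)) :> R by clear; lra.
have p2 : 0 <= (969 / 1000 + 169 / (1000 * 1000)) :> R by clear; lra.
have p3 : 0 <= (939 / 1000 + 288 / (1000 * 1000)) :> R by clear; lra.
have b0 : 0 <= 255 / 256 :> R by clear; lra.
move: (255 / 256) b0 n0 => b b0 n0.
have h0 : b <= b ^+ 1 by rewrite expr1.
have := exprn_double_ge b0 h0 n0.
move=> /(exprn_double_ge p0)/(_ n1).
move=> /(exprn_double_ge p1)/(_ n2).
move=> /(exprn_double_ge p2)/(_ n3).
move=> /(exprn_double_ge p3)/(_ n4).
by [].
Qed.

Lemma ler_exp_nonneg (R : realType) (a b : R) n : 0 <= a -> a <= b -> a ^+ n <= b ^+ n.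
Proof. by move=> a0 ab; apply: lerXn2r; rewrite ?nnegrE// (le_trans a0 ab). Qed.

Lemma x_power_bounds (R : realType) (x : R) (H : nat) : 160 <= x -> 8 * ln x <= H%:R ->
  [/\ (6867 / 10000) ^+ H <= x ^- 3, (169 / 256) ^+ H <= x ^- 3 & (40 <= H)%N].
Proof.
move=> x160 hH; have x0 : 0 < x by apply: lt_le_trans x160; rewrite ltr0n.
have xE : x = expR (ln x) by rewrite lnK// posrE.
have q0 : 0 <= 6867 / 10000 :> R by exact: divr_ge0 (ler0n _ _) (ler0n _ _).
have q1 : 0 <= 169 / 256 :> R by exact: divr_ge0 (ler0n _ _) (ler0n _ _).
have q2 : 169 / 256 <= 6867 / 10000 :> R by clear; lra.
have f : (6867 / 10000) ^+ H <= x ^- 3.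
  apply: le_trans (ler_exp_nonneg H q0 (expR_3_8 R)) _.
  have -> : x ^- 3 = expR (- (3 * ln x)) by rewrite expRN expRM_natl -xE.
  rewrite -expRM_natl ler_expR.
  by move: hH; move: (ln x) (H%:R : R) => l h; clear; lra.
split; [exact: f | exact: le_trans (ler_exp_nonneg H q1 q2) f |].
(* With fewer than 40 steps, [x] would be at most [exp 5], which is below 160. *)
rewrite leqNgt; apply/negP => H40.
have xe : x <= expR (1 / 8) ^+ 40.
  rewrite -expRM_natl [leLHS]xE ler_expR.
  have : H%:R <= 40 :> R by rewrite ler_nat ltnW.
  by move: hH; move: (ln x) (H%:R : R) => l h; clear; lra.
have h1 : expR (1 / 8) ^+ 5 <= (2267 / 2000) ^+ 5 :> R.
  exact: ler_exp_nonneg (expR_ge0 _) (expR_1_8 R).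
have s2 : (2267 / 2000) ^+ 5 <= 1872 / 1000 :> R by clear; lra.
have s3 : (1872 / 1000) ^+ 8 < 160 :> R by clear; lra.
have h2 := ler_exp_nonneg 8 (exprn_ge0 5 (expR_ge0 (1 / 8 : R))) (le_trans h1 s2).
rewrite -exprM in h2.
by have := le_lt_trans (le_trans x160 (le_trans xe h2)) s3; rewrite ltxx.
Qed.

(** The base bounds [(671 / 1000) * (2267 / 2000)^2] from above, that is, the rate of two steps
    times a bound of [exp (1 / 4)]. From [j = 20] on the geometric decay beats the linear factor, so
    only the value at 20 is computed. *)
Lemma alignment_rate_nat (R : realType) (j : nat) : (20 <= j)%N ->
  (862 / 1000 + 2 / 10000) ^+ j * ((492 / 100 * j%:R + 22 / 10) / 4) <= 13 / 10 :> R.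
Proof.
set t : R := 862 / 1000 + 2 / 10000.
have t0 : 0 <= t by rewrite /t; clear; lra.
have t1 : t * (492 / 100 + (492 / 100 * 20 + 22 / 10)) <= 492 / 100 * 20 + 22 / 10.
  by rewrite /t; clear; lra.
have t2 : t <= 1 by rewrite /t; clear; lra.
have s4 : t ^+ 4 <= 5527 / 10000 by rewrite /t; clear; lra.
have u0 : 0 <= 5527 / 10000 :> R by clear; lra.
have s20 : (5527 / 10000) ^+ 5 * ((492 / 100 * 20 + 22 / 10) / 4) <= 13 / 10 :> R.
  by clear; lra.
have k20 : 0 <= (492 / 100 * 20 + 22 / 10) / 4 :> R by clear; lra.
elim: j => // j IH; rewrite leq_eqVlt => /orP[/eqP <-|].
  apply: le_trans s20; apply: (ler_wpM2r k20); rewrite (exprM t 4 5).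
  exact: ler_exp_nonneg (exprn_ge0 4 t0) s4.
rewrite ltnS => j20; apply: le_trans (IH j20); rewrite exprSr -mulrA.
apply: ler_wpM2l; first exact: exprn_ge0.
have : 20 <= j%:R :> R by rewrite ler_nat.
rewrite -[j.+1%:R]natr1; move: (j%:R : R) => r r20; move: t1 t2 t0; clear -r20.
move: t => t t1 t2 t0.
have : 0 <= (1 - t) * (r - 20) by apply: mulr_ge0; lra.
lra.
Qed.

Lemma alignment_rate (R : realType) (x : R) (H : nat) : 160 <= x -> 8 * ln x <= H%:R ->
  (671 / 1000) ^+ H./2 * ((492 / 100 * H./2%:R + 22 / 10) / 4) <= 3 / (2 * x).
Proof.
move=> x160 hH; have [_ _ H40] := x_power_bounds x160 hH.
have x0 : 0 < x by apply: lt_le_trans x160; rewrite ltr0n.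
have j20 : (20 <= H./2)%N by rewrite (half_leq H40).
have := alignment_rate_nat R j20.
set c := (_ + 22 / 10) / 4; move=> hc.
have c0 : 0 <= c.
  rewrite /c; have := ler0n R H./2; move: (H./2%:R : R) => r; clear; lra.
(* Halving [H] loses at most one step, hence the separate factor [exp (1 / 8)]; its bound times
   [13 / 10] is below [3 / 2], the constant in [3 / (2 * x)]. *)
have xe : x <= expR (1 / 8) * (expR (1 / 8) ^+ 2) ^+ H./2.
  have e1 : 1 <= expR (1 / 8) :> R.
    apply: le_trans (expR_ge1Dx (1 / 8)); clear; lra.
  apply: (@le_trans _ _ (expR (1 / 8) ^+ H)).
    have xE : x = expR (ln x) by rewrite lnK// posrE.
    rewrite -expRM_natl [leLHS]xE ler_expR.
    by move: hH; move: (ln x) (H%:R : R) => l h; clear; lra.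
  rewrite -exprM -exprS; apply: ler_weXn2l => //.
  by rewrite mul2n -[leqLHS]odd_double_half -add1n leq_add2r; case: (odd H).
have g0 : 0 <= 2267 / 2000 :> R by clear; lra.
have g2 : 671 / 1000 * (2267 / 2000) ^+ 2 <= 862 / 1000 + 2 / 10000 :> R by clear; lra.
have k0 : 0 <= 671 / 1000 :> R by clear; lra.
have xg : x <= (2267 / 2000) * ((2267 / 2000) ^+ 2) ^+ H./2.
  apply: le_trans xe _; apply: ler_pM; rewrite ?expR_ge0 ?exprn_ge0 ?expR_ge0 ?expR_1_8//.
  apply: ler_exp_nonneg; first by rewrite exprn_ge0 ?expR_ge0.
  exact: ler_exp_nonneg (expR_ge0 _) (expR_1_8 R).
rewrite ler_pdivlMr ?mulr_gt0 ?ltr0n//.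
have h1 : (671 / 1000) ^+ H./2 * x <= 2267 / 2000 * (862 / 1000 + 2 / 10000) ^+ H./2.
  apply: (@le_trans _ _ ((671 / 1000) ^+ H./2 * (2267 / 2000 * ((2267 / 2000) ^+ 2) ^+ H./2))).
    by rewrite ler_wpM2l ?exprn_ge0.
  rewrite mulrCA -exprMn; apply: (ler_wpM2l g0).
  by apply: ler_exp_nonneg g2; rewrite mulr_ge0 ?exprn_ge0.
have {h1} := ler_wpM2r c0 h1; have {hc} := ler_wpM2l g0 hc; rewrite mulrA.
move: (_ / _ * _ * c) => a h1 h2; have {}h1 := le_trans h2 h1.
have -> : (671 / 1000) ^+ H./2 * c * (2 * x) = 2 * ((671 / 1000) ^+ H./2 * x * c) by ring.
move: h1; move: (_ * c) => b; clear; lra.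
Qed.

(** * A potential for inaccurate rounds *)

(** The computed point minus [zstar] is [(1 - lam) * q + lam * (al + q) + rh]. By convexity the
    first two terms contribute [1 - lam] times the estimate of an exact round and [lam] times the
    old distance; only [rh] is paid for by Young's inequality with the free parameter [tau]. *)
Lemma potential_descent (R : realType) (d : nat) (p lam t tau th eps phx : R) (q al be e rh Y1 Y2 : 'rV[R]_d) :
  0 < p -> p <= 4^-1 -> 0 <= lam -> lam <= 2000^-1 -> 0 < t -> 0 < tau -> tau <= 1 ->
  0 <= th -> th <= 2000^-1 -> eps ^+ 2 <= t * p / 4000 -> eps ^+ 2 <= p / 4000 ->
  0 <= phx -> lam ^+ 2 <= th ->
  e = lam *: al + rh ->
  dotv e e <= th * dotv al al ->
  dotv Y1 Y1 <= 4 * eps ^+ 2 * dotv e e ->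
  dotv Y2 Y2 <= 4 * eps ^+ 2 * dotv (be - e) (be - e) ->
  dotv (Y2 - Y1) (Y2 - Y1) <= 4 * eps ^+ 2 * dotv be be ->
  t * dotv q q + phx + dotv (Y2 - Y1) q <= (1 - p) * dotv al q + p * dotv be q ->
  dotv (e + q) (e + q) + 2 * dotv Y2 (e + q) + 4 * eps ^+ 2 * dotv (be - e) (be - e) <=
  (1 - lam) * ((1 - p) * dotv (al + q) (al + q) + p * dotv (be + q) (be + q))
  + lam * dotv (al + q) (al + q)
  - 74 / 100 * dotv al al - 97 / 100 * (p * dotv be be) - 17 / 10 * (t * dotv q q)
  - 199 / 100 * phx + 101 / 100 * (tau * dotv q q) + 2 / tau * dotv rh rh.
Proof.
move=> p0 p4 l0 l1 t0 tau0 tau1 th0 th1 ept ep phx0 lth eE he hY1 hY2 hY hvi.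
have s0 := dotv_ge0 al; have r0 := dotv_ge0 be; have e0 := dotv_ge0 e; have d0 := dotv_ge0 q.
have rh0 := dotv_ge0 rh.
have y1 := @dotv_young R d (20 / t) Y1 q ltac:(by rewrite divr_gt0 ?ltr0n).
have y2 := @dotv_young R d (20 / t) (lam *: (Y2 - Y1)) q ltac:(by rewrite divr_gt0 ?ltr0n).
have y3 := @dotv_young R d 1 Y2 e ltr01.
have y4 := @dotv_young R d tau (q + lam *: al) rh tau0.
have y5 := @dotv_young R d 1 al q ltr01.
have y6 := dotv_ge0 (be + e).
have l2 : lam ^+ 2 <= 2000^-1 by apply: le_trans lth th1.
(* The weight [20 / t] is affordable because [eps^2] is at most [t * p / 4000]. *)
have c1 : 20 / t * dotv Y1 Y1 <= p / 50 * dotv e e.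
  apply: le_trans (ler_wpM2l _ hY1) _; first by rewrite divr_ge0 ?ler0n// ltW.
  rewrite mulrA; apply: ler_wpM2r => //.
  have -> : p / 50 = 20 / t * (4 * (t * p / 4000)) by field; rewrite gt_eqF.
  by rewrite ler_pM2l ?divr_gt0 ?ltr0n// ler_pM2l ?ltr0n.
have c2 : 20 / t * (lam * (lam * dotv (Y2 - Y1) (Y2 - Y1))) <= p / 50 * (2000^-1 * dotv be be).
  rewrite (mulrA lam) -expr2 mulrCA [leRHS]mulrCA; apply: ler_pM => //.
  - exact: sqr_ge0.
  - by rewrite mulr_ge0 ?dotv_ge0// divr_ge0 ?ler0n// ltW.
  apply: le_trans (ler_wpM2l _ hY) _; first by rewrite divr_ge0 ?ler0n// ltW.
  rewrite mulrA; apply: ler_wpM2r => //.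
  have -> : p / 50 = 20 / t * (4 * (t * p / 4000)) by field; rewrite gt_eqF.
  by rewrite ler_pM2l ?divr_gt0 ?ltr0n// ler_pM2l ?ltr0n.
have c3 : eps ^+ 2 * dotv (be - e) (be - e) <= p / 4000 * (2 * dotv be be + 2 * dotv e e).
  apply: ler_pM; rewrite ?sqr_ge0 ?dotv_ge0//.
  by move: y6; rewrite (dotv_sqrD be e) (dotv_sqrB be e); move: (dotv be e) (dotv be be) (dotv e e) => x y z; clear; lra.
have c4 : dotv e e <= 2000^-1 * dotv al al.
  by apply: le_trans he _; apply: ler_wpM2r.
have c5 : dotv rh rh <= tau^-1 * dotv rh rh.
  by rewrite ler_peMl// invf_ge1.
have c6 : p * dotv al al <= 4^-1 * dotv al al by apply: ler_wpM2r.
have c7 : p * dotv e e <= 4^-1 * dotv e e by apply: ler_wpM2r.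
have c8 : lam * dotv al al <= 2000^-1 * dotv al al by apply: ler_wpM2r.
have c9 : lam * (p * dotv be be) <= 2000^-1 * (p * dotv be be).
  by apply: ler_wpM2r => //; rewrite mulr_ge0// ltW.
have c10 : 0 <= lam * (p * dotv al al) by rewrite !mulr_ge0// ltW.
have c11 : lam ^+ 2 * dotv al al <= 2000^-1 * dotv al al by apply: ler_wpM2r.
have c12 : lam * (t * dotv q q) <= 2000^-1 * (t * dotv q q).
  by apply: ler_wpM2r => //; rewrite mulr_ge0// ltW.
have c13 : lam * phx <= 2000^-1 * phx by apply: ler_wpM2r.
have c14 : tau * (dotv q q + lam * (dotv al al + dotv q q) + lam ^+ 2 * dotv al al) <=
    tau * (1001 / 1000 * dotv q q) + 1000^-1 * dotv al al.
  have h : lam * dotv q q <= 2000^-1 * dotv q q by apply: ler_wpM2r.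
  apply: (@le_trans _ _ (tau * (1001 / 1000 * dotv q q + 1000^-1 * dotv al al))).
    rewrite ler_pM2l// mulrDr; move: c8 c11 h d0.
    move: (lam ^+ 2 * dotv al al) (lam * dotv al al) (lam * dotv q q) (dotv al al) (dotv q q).
    by clear; intros; lra.
  rewrite mulrDr lerD2l; have i0 : 0 <= 1000^-1 :> R by rewrite invr_ge0; exact: ler0n.
  exact: ler_piMl (mulr_ge0 i0 s0) tau1.
have c15 : 0 <= p * dotv be be by rewrite mulr_ge0// ltW.
have c16 : 0 <= t * dotv q q by rewrite mulr_ge0// ltW.
have c18 : 0 <= tau * dotv q q by rewrite mulr_ge0// ltW.
have c17 : tau * (lam * (2 * dotv al q)) <= tau * (lam * (dotv al al + dotv q q)).
  by rewrite ler_pM2l// ler_wpM2l//; move: y5; rewrite invr1 !mul1r.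
have {}hvi : (1 - lam) * (t * dotv q q + phx + dotv (Y2 - Y1) q) <=
    (1 - lam) * ((1 - p) * dotv al q + p * dotv be q).
  by apply: ler_wpM2l hvi; clear -l1; lra.
have q1 : dotv (q + lam *: al) (q + lam *: al) =
    dotv q q + lam * (2 * dotv al q) + lam ^+ 2 * dotv al al.
  by rewrite (dotv_sqrD q) !(dotvZl lam) !(dotvZr lam) (dotvC q al); ring.
have q2 : dotv (e + q) (e + q) = dotv (q + lam *: al) (q + lam *: al)
    + 2 * dotv (q + lam *: al) rh + dotv rh rh.
  have -> : e + q = (q + lam *: al) + rh by rewrite eE addrC addrA.
  exact: dotv_sqrD.
have q3 : dotv Y2 (e + q) = dotv Y2 e + dotv Y2 q by rewrite dotvDr.
have q4 : dotv (Y2 - Y1) q = dotv Y2 q - dotv Y1 q by rewrite dotvDl dotvNl.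
rewrite q2 q3 !(dotv_sqrD _ q) q1.
move: y1 y2 y3 y4 hvi c14; rewrite q1 q4.
rewrite !(dotvZl lam) !(dotvZr lam) !invf_div invr1 !mul1r q4.
rewrite -(mulrA 2 tau^-1) -(mulrA 4 (eps ^+ 2)).
rewrite -(mulrA 4 (eps ^+ 2)) in hY2.
move: c1 c2 c3 c4 c5 c6 c7 c8 c9 c10 c11 c12 c13 c15 c16 c17 c18 hY2 p0 s0 r0 e0 d0 rh0 phx0.
move: (20 / t * dotv Y1 Y1) (20 / t * (lam * _))
  (eps ^+ 2 * dotv (be - e) (be - e)) (tau^-1 * dotv rh rh) (dotv (q + lam *: al) rh).
move: (dotv al al) (dotv be be) (dotv e e) (dotv q q) (dotv rh rh) (dotv al q) (dotv be q)
  (dotv Y1 q) (dotv Y2 q) (dotv Y2 e) (dotv Y2 Y2).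
clear; intros; lra.
Qed.

(** This allows the term [tau * |q|^2] to be charged to the distances that occur in the
    potential. *)
Lemma potential_dist (R : realType) (d : nat) (p t eps phx : R) (q al be Y : 'rV[R]_d) :
  0 < p -> p <= 4^-1 -> 0 < t -> eps ^+ 2 <= t * p / 4000 -> 0 <= phx ->
  dotv Y Y <= 4 * eps ^+ 2 * dotv be be ->
  t * dotv q q + phx + dotv Y q <= (1 - p) * dotv al q + p * dotv be q ->
  dotv q q <= (1 - p) * dotv (al + q) (al + q) + p * dotv (be + q) (be + q).
Proof.
move=> p0 p4 t0 ept phx0 hY hvi.
have s0 := dotv_ge0 al; have r0 := dotv_ge0 be; have d0 := dotv_ge0 q.
have := @dotv_young R d (20 / t) (- Y) q ltac:(by rewrite divr_gt0 ?ltr0n).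
have c2 : 20 / t * dotv Y Y <= p / 50 * dotv be be.
  apply: le_trans (ler_wpM2l _ hY) _; first by rewrite divr_ge0 ?ler0n// ltW.
  rewrite mulrA; apply: ler_wpM2r => //.
  have -> : p / 50 = 20 / t * (4 * (t * p / 4000)) by field; rewrite gt_eqF.
  by rewrite ler_pM2l ?divr_gt0 ?ltr0n// ler_pM2l ?ltr0n.
have c6 : p * dotv al al <= 4^-1 * dotv al al by apply: ler_wpM2r.
have c15 : 0 <= p * dotv be be by rewrite mulr_ge0// ltW.
have c16 : 0 <= t * dotv q q by rewrite mulr_ge0// ltW.
rewrite !(dotvNl Y) !(dotvNr Y) opprK invf_div !(dotv_sqrD _ q).
move: hvi c2 c6 c15 c16 s0 r0 d0 phx0; move: (20 / t * _).
move: (dotv al al) (dotv be be) (dotv q q) (dotv al q) (dotv be q) (dotv Y q).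
clear; intros; lra.
Qed.

(** A round reproduces [a + (1 - lam) * b] exactly, because the contributions of [lam] and [p]
    cancel, and leaves gains. These absorb the factor [k], the inverse of the contraction; the
    decrease from [B] to [B'] and a part of [t * D] absorb [tau * D]. *)
Lemma value_contraction (R : realType) (p lam t tau k B B' D s r a b phx rr EA : R) :
  0 < p -> p <= 4^-1 -> 0 <= lam -> lam <= 2000^-1 -> 0 < t -> t <= p / 100 -> 0 < tau ->
  0 <= s -> 0 <= r -> 0 <= D -> 0 <= phx -> 0 <= a -> 0 <= b ->
  k * (1 - t / 2) = 1 -> 1 <= B' -> B' <= B ->
  102 / 100 * (k * B' * tau) <= B - B' + 36 / 100 * t ->
  a <= 11 / 10 * D + 11 * s -> b <= 11 / 10 * D + 11 * r ->
  D <= (1 - p) * a + p * b ->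
  EA <= (1 - lam) * ((1 - p) * a + p * b) + lam * a - 74 / 100 * s - 97 / 100 * (p * r)
    - 17 / 10 * (t * D) - 199 / 100 * phx + 101 / 100 * (tau * D) + rr ->
  k * B' * (EA + (1 - lam) * (p * a + (1 - p) * b)) <=
  B * (a + (1 - lam) * b) - 199 / 100 * phx - 7 / 10 * s - 9 / 10 * (p * r) - t * D / 5
  + k * B' * rr.
Proof.
move=> p0 p4 l0 l1 t0 tp tau0 s0 r0 D0 phx0 a0 b0 kE B1 BB htau ha hb hD hE.
have t4 : t <= 400^-1 by clear -tp p4; lra.
have k1 : 1 <= k.
  have kp : 0 < k.
    have h : 0 < k * (1 - t / 2) by rewrite kE ltr01.
    by move: h; rewrite pmulr_lgt0//; clear -t4; lra.
  have h : 0 <= k * t by rewrite mulr_ge0// ltW.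
  by clear -kE h; lra.
have kB1 : 1 <= k * B' by rewrite (le_trans B1)// ler_peMl// (le_trans ler01).
set kB := k * B' in kB1 htau *.
set V := a + (1 - lam) * b.
have VD : D <= 2000 / 1999 * V.
  apply: le_trans hD _; rewrite /V.
  have c1 : lam * b <= 2000^-1 * b by apply: ler_wpM2r.
  have c2 : p * b <= 4^-1 * b by apply: ler_wpM2r.
  have c3 : 0 <= p * a by rewrite mulr_ge0// ltW.
  clear -c1 c2 c3 a0 b0; lra.
have V0 : 0 <= V.
  by rewrite /V addr_ge0// mulr_ge0// subr_ge0; clear -l1; lra.
have kBE : kB * V = B' * V + kB * (t / 2 * V).
  rewrite /kB; have -> : k * B' * V = k * (1 - t / 2) * (B' * V) + k * B' * (t / 2 * V) by ring.
  by rewrite kE mul1r.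
have ts : t * s <= 400^-1 * s by apply: ler_wpM2r.
have tr : t * r <= p / 100 * r by apply: ler_wpM2r.
have tD : 0 <= t * D by rewrite mulr_ge0// ltW.
have pr : 0 <= p * r by rewrite mulr_ge0// ltW.
(* The excess caused by [k] costs [11 / 10 * t * D], less than the available [17 / 10 * t * D]; its
   other terms are small against the gains in [s] and [p * r]. *)
have hV : t / 2 * V <= t / 2 * (22 / 10 * D + 11 * s + 11 * r).
  rewrite ler_pM2l ?divr_gt0 ?ltr0n// /V.
  have : 0 <= lam * b by rewrite mulr_ge0.
  clear -ha hb; lra.
have h1 : EA + (1 - lam) * (p * a + (1 - p) * b) <= V - 74 / 100 * s - 97 / 100 * (p * r)
    - 17 / 10 * (t * D) - 199 / 100 * phx + 101 / 100 * (tau * D) + rr.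
  by rewrite /V; clear -hE; lra.
pose X := t / 2 * V - 74 / 100 * s - 97 / 100 * (p * r) - 17 / 10 * (t * D)
  - 199 / 100 * phx.
pose Y := 199 / 100 * phx + 7 / 10 * s + 9 / 10 * (p * r) + 6 / 10 * (t * D).
have XY : X <= - Y.
  by rewrite /X /Y; move: hV; move: (t / 2 * V) => v hV; clear -hV ts tr tD pr s0; lra.
have Y0 : 0 <= Y by rewrite /Y; clear -phx0 s0 pr tD; lra.
have h2 : kB * X <= - Y.
  have : kB * X <= kB * - Y by rewrite ler_pM2l// (lt_le_trans ltr01).
  have : 1 * Y <= kB * Y by apply: ler_wpM2r.
  by rewrite mul1r mulrN; move: (kB * _) (kB * _) => u v; clear; lra.
have h3 : 101 / 100 * (kB * (tau * D)) <= (B - B') * V + 36 / 100 * (t * D).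
  have c1 := ler_wpM2r D0 htau.
  have c2 : (B - B') * D <= (B - B') * (2000 / 1999 * V) by rewrite ler_wpM2l// subr_ge0.
  have c3 : 0 <= (B - B') * V by rewrite mulr_ge0// subr_ge0.
  have -> : kB * (tau * D) = 100 / 102 * (102 / 100 * (kB * tau) * D) by field.
  have E1 : (B - B' + 36 / 100 * t) * D = (B - B') * D + 36 / 100 * (t * D) by ring.
  have E2 : (B - B') * (2000 / 1999 * V) = 2000 / 1999 * ((B - B') * V) by ring.
  rewrite E1 in c1; rewrite E2 in c2; move: c1 c2 c3.
  move: (102 / 100 * (kB * tau) * D) ((B - B') * D) ((B - B') * V) => u v w.
  clear -tD; lra.
have {}h1 := ler_wpM2l (le_trans ler01 kB1) h1.
apply: le_trans h1 _.
have -> : kB * (V - 74 / 100 * s - 97 / 100 * (p * r) - 17 / 10 * (t * D) - 199 / 100 * phx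
    + 101 / 100 * (tau * D) + rr) =
  kB * V - kB * (t / 2 * V) + kB * X + 101 / 100 * (kB * (tau * D)) + kB * rr.
  by rewrite /X; ring.
rewrite kBE; move: h2 h3; rewrite /Y (mulrBl V B).
move: (kB * (t / 2 * V)) (kB * X) (kB * (tau * D)) (kB * rr) (B' * V) (B * V).
clear -tD; intros; lra.
Qed.

(** The source of decrease of the gap: [G] is the displacement of an exact round, [w] the deviation
    of the state from its shadows, [f] the change of the operator relative to [zstar]. *)
Lemma normal_progress (R : realType) (d : nat) (G w f : 'rV[R]_d) :
  dotv (G - f) (w - G) <= - (9 / 10) * dotv G G + 11 / 2 * dotv w w + 11 / 2 * dotv f f.
Proof.
have y1 := @dotv_young R d 10 w G ltac:(exact: ltr0n).
have y2 := @dotv_young R d 10 f G ltac:(exact: ltr0n).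
have y3 := dotv_young (- f) w ltr01.
move: y1 y2 y3; rewrite !dotvE !(dotvC w G) invr1.
move: (dotv w w) (dotv G G) (dotv f f) (dotv G w) (dotv f w) (dotv f G).
clear; intros; lra.
Qed.

(** With [W = v / p], the kept anchor gap becomes [(1 - t) * om - t * W] with [t] close to [p].
    Convexity gives one factor [1 - p], the probability of keeping the anchor another, so nearly
    [1 - 2 * p]; a refreshed anchor contributes only third order in [p]. *)
Lemma anchor_gap_step (R : realType) (d : nat) (p lam : R) (om v : 'rV[R]_d) :
  0 < p -> p <= 4^-1 -> 0 <= lam -> lam <= 2000^-1 ->
  let D := (1 - lam) *: (v + p *: om) in
  p * dotv D D + (1 - p) * dotv (om - D) (om - D) <=
  (1 - 16 / 10 * p) * dotv om om + 9 / 8 * (p^-1 * dotv v v).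
Proof.
move=> p0 p4 l0 l1; cbv zeta.
pose W := p^-1 *: v; pose t := (1 - lam) * p.
have vE : v = p *: W by rewrite /W scalerA divff ?scale1r// gt_eqF.
have -> : p^-1 * dotv v v = p * dotv W W.
  by rewrite /W dotvZl dotvZr; field; rewrite gt_eqF.
have -> : (1 - lam) *: (v + p *: om) = t *: (om + W).
  by rewrite vE /t; apply/rowP => j; rewrite !mxE; ring.
have t0 : 0 <= t by rewrite /t mulr_ge0 ?(ltW p0)// subr_ge0; clear -l1; lra.
have tp : t <= p by rewrite /t ler_piMl ?(ltW p0)//; clear -l0; lra.
have tp2 : 1999 / 2000 * p <= t by rewrite /t ler_pM2r//; clear -l1; lra.
have -> : om - t *: (om + W) = (1 - t) *: om - t *: W.
  by apply/rowP => j; rewrite !mxE; ring.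
clearbody t W; clear vE v.
have o0 := dotv_ge0 om; have w0 := dotv_ge0 W; have ow := dotv_ge0 (om - W).
have ow' := dotv_ge0 (om + W).
rewrite (dotvZl t) (dotvZr t) (dotv_sqrB ((1 - t) *: om)) !(dotvZl (1 - t)) !(dotvZr (1 - t))
  !(dotvZl t) !(dotvZr t).
move: ow ow'; rewrite (dotv_sqrB om) (dotv_sqrD om W).
move: (dotv om om) o0 (dotv W W) w0 (dotv om W) => O O0 w w0 c h1 h2.
have k1 : t * t <= p * p by rewrite ler_pM.
have s0 : 0 <= O + 2 * c + w by [].
have k2 : p * (t * (t * (O + 2 * c + w))) <= p * (p * (p * (2 * O + 2 * w))).
  rewrite ler_pM2l// !mulrA ler_pM ?mulr_ge0//; clear -h1; lra.
have k3 : (1 - t) * ((1 - t) * O) - 2 * ((1 - t) * (t * c)) + t * (t * w) <=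
    (1 - t) * O + t * w.
  have : 0 <= t * ((1 - t) * (O + 2 * c + w)).
    by rewrite !mulr_ge0// subr_ge0 (le_trans tp)//; clear -p4; lra.
  clear; lra.
have k4 : (1 - p) * ((1 - t) * ((1 - t) * O) - 2 * ((1 - t) * (t * c)) + t * (t * w)) <=
    (1 - p) * ((1 - t) * O + t * w).
  by apply: ler_wpM2l k3; clear -p4; lra.
have k5 : p * (p * (p * (2 * O + 2 * w))) <= p * (8^-1 * (O + w)).
  rewrite ler_pM2l// mulrA; have -> : p * p * (2 * O + 2 * w) = 2 * (p * p) * (O + w) by ring.
  rewrite ler_wpM2r ?addr_ge0//.
  by have := ler_pM (ltW p0) (ltW p0) p4 p4; clear; lra.
have k6 : t * w <= p * w by rewrite ler_wpM2r.
have k7 : 1999 / 2000 * p * O <= t * O by rewrite ler_wpM2r.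
have k8 : p * (t * O) <= 4^-1 * (p * O).
  rewrite [leRHS]mulrCA ler_pM2l// mulrC [leRHS]mulrC ler_wpM2l// (le_trans tp)//.
have k9 : 0 <= p * (t * w) by rewrite !mulr_ge0// ltW.
apply: (@le_trans _ _ (p * (8^-1 * (O + w)) + (1 - p) * ((1 - t) * O + t * w))).
  by apply: lerD k4; apply: le_trans k5; rewrite (mulrA t) in k2 *; apply: le_trans k2 _.
clear -k6 k7 k8 k9 O0 p0; have : 0 <= p * O by rewrite mulr_ge0// ltW.
lra.
Qed.

(* [Q] is the pairing of the new normal vector with the last displacement:
   it is controlled by the variation of the normal vector. *)
Lemma speed_step (R : realType) (d : nat) (p lam Q M M' hp : R)
    (G Gp w om n np Y : 'rV[R]_d) :
  0 < p -> p <= 4^-1 -> 0 <= M' -> 0 <= hp ->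
  n - np = G - Gp - Y ->
  dotv n (w - G + p *: om) = Q ->
  dotv n om = Q - M' -> dotv np om = hp - M ->
  dotv np (w - G + p *: om) <= hp ->
  2^-1 * dotv G G + p * (p * Q + (1 - p) * M') + lam * Q <=
  2^-1 * dotv Gp Gp + p * M + hp + 2^-1 * dotv w w - dotv Y (w - G)
  - (1 - p - p * p - lam) * Q.
Proof.
move=> p0 p4 M0 hp0 nE hQ hn hnp hh.
have c1 : dotv (n - np) (w - G) = Q - p * (Q - M') - dotv np (w - G).
  rewrite dotvDl dotvNl -hn -hQ (dotvDr (w - G) (p *: om) n) (dotvZr p om n); ring.
have c2 : dotv np (w - G) <= hp - p * (hp - M).
  by rewrite -hnp -(dotvZr p om np) lerBrDr -(dotvDr (w - G)).
have c3 := dotv_ge0 (G - Gp - w).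
have c4 : 0 <= p * hp by rewrite mulr_ge0// ltW.
have c5 : 0 <= p * (p * M') by rewrite !mulr_ge0// ltW.
rewrite nE in c1; move: c1 c2 c3; rewrite !dotvE (dotvC Gp G) (dotvC w G) (dotvC w Gp).
move: (dotv G G) (dotv Gp Gp) (dotv w w) (dotv G w) (dotv G Gp) (dotv Gp w) (dotv Y w)
  (dotv Y G) (dotv np w) (dotv np G).
clear -c4 c5; intros; lra.
Qed.

(** [Y] is the change of the operators between consecutive rounds, of order [eps] times the
    displacements. The Young weight [1 / (4 * eps)] makes the cost linear in [eps], and
    [w * eps <= p / 200] lets it be multiplied by [w^2]. *)
Lemma drift_bound (R : realType) (d : nat) (p eps ep tm : R) (v om e Y : 'rV[R]_d) :
  0 < eps -> dotv e e = ep ->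
  dotv Y Y <= 2 * (eps ^+ 2 * dotv (v + p *: om + e) (v + p *: om + e)) + 8 * (eps ^+ 2 * tm) ->
  - dotv Y v <= eps * (3 * dotv v v + p * (p * dotv om om) + 2^-1 * ep + tm).
Proof.
move=> e0 <- hY.
have c0 : 0 < (4 * eps)^-1 by rewrite invr_gt0 mulr_gt0.
have := dotv_young (- Y) v c0; rewrite !dotvNl dotvNr opprK invrK => h.
have h1 : (4 * eps)^-1 * dotv Y Y <=
    eps * (2^-1 * dotv (v + p *: om + e) (v + p *: om + e) + 2 * tm).
  apply: le_trans (ler_wpM2l (ltW c0) hY) _; rewrite le_eqVlt; apply/orP; left; apply/eqP.
  by field; rewrite gt_eqF.
have h2 : dotv (v + p *: om + e) (v + p *: om + e) <=
    4 * dotv v v + 4 * (p * (p * dotv om om)) + 2 * dotv e e.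
  have a := dotv_ge0 (v + p *: om - e); have b := dotv_ge0 (v - p *: om).
  move: a b; rewrite (dotv_sqrD (v + p *: om) e) (dotv_sqrB (v + p *: om) e) (dotv_sqrB v (p *: om)) (dotv_sqrD v (p *: om)).
  rewrite !(dotvZl p om) !(dotvZr p om).
  move: (dotv (v + _) e) (dotv v v) (dotv v om) (dotv e e) (dotv om om).
  clear; intros; lra.
have h3 := ler_wpM2l (ltW e0) h2.
move: h h1 h3; clear -e0; move: ((4 * eps)^-1 * _) (dotv (_ + e) _) (dotv Y v) => a b c.
move: (dotv v v) (dotv om om) (dotv e e) => x y z; lra.
Qed.

(* One step of all potentials but the first one.  [phmp] and [N2p] stand for
   [phm / p] and [N2 / p]; [a] and [b] are the next weights [w] and [w ^ 2],
   divided by the contraction factor. *)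
Lemma weighted_step (R : realType) (p lam t k w a b eps eta : R)
    (s r D phx phy phm phmp g Q M' U O N1 N2 N2p tm ep zm pw pf vv EO ep' EN1 X EU : R) :
  0 < p -> p <= 4^-1 -> 0 <= lam -> lam <= 2000^-1 -> 0 <= t ->
  1 <= k -> k <= 1 + p / 90 ->
  0 < w -> w <= a -> a <= (1 + 3 / 40 * p) * w -> a - w <= 255 / 1000 ->
  w * w <= b -> b <= (1 + 3 / 20 * p) * (w * w) -> b - w * w <= 53 / 100 * w ->
  0 < eps -> w * eps <= p / 200 -> w * eps ^+ 2 <= t / 500 -> w * eps ^+ 2 <= p / 4000 ->
  (14 * w + 3 * (w * w)) * eps ^+ 2 <= p / (50 * 1000) -> 0 <= eta -> eta <= 106^-1 ->
  0 <= s -> 0 <= r -> 0 <= D -> 0 <= phx -> 0 <= phy -> 0 <= phmp -> phm = p * phmp ->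
  0 <= g -> 0 <= Q -> 0 <= M' -> 0 <= O -> 0 <= N1 -> 0 <= N2p -> N2 = p * N2p ->
  0 <= tm -> 0 <= ep -> 0 <= pw -> 0 <= pf -> 0 <= vv -> 0 <= EO -> 0 <= EN1 ->
  phx - (1 - p) * phy - p * phm <=
    - (9 / 10) * g + 11 / 2 * pw + 11 / 2 * pf - (1 - p) * Q - p * M' ->
  p * EO <= (1 - 16 / 10 * p) * (p * O) + 9 / 8 * vv ->
  vv <= 2 * pw + 2 * g -> pw <= (1 - p) * N1 + p * N2 ->
  pf <= eps ^+ 2 * (2 * D + 8 * r) -> zm <= 3 * (N1 + O + N2) ->
  ep' <= lam ^+ 2 * (2 * vv + 2 * (p * (p * O))) ->
  EU = 2^-1 * g + p * (p * Q + (1 - p) * M') + lam * Q ->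
  EU <= U + 2^-1 * pw + X - (1 - p - p * p - lam) * Q ->
  X <= eps * (3 * vv + p * (p * O) + 2^-1 * ep + tm) ->
  EN1 <= 2 * (eta * (Q + N1)) + 6420 * (eps ^+ 2 * s) + 16 * (eps ^+ 2 * r) ->
  k * ((1 - lam) * phx + lam * phy) + k * (3 / 10 * (phy + (1 - p) * phmp)) +
  a * ((1 - lam) * phx + lam * phy + (1 - lam) * (p * phy + (1 - p) * phm)
       + 20^-1 * (p * EO) + 100^-1 * (p * (p * zm)) + 100^-1 * ep') +
  b * EU + (14 * a + 3 * b) * (2 * EN1 + (N1 + (1 - p) * N2p)) <=
  phy + 3 / 10 * phmp +
  w * (phy + (1 - lam) * phm + 20^-1 * (p * O) + 100^-1 * (p * tm) + 100^-1 * ep) +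
  w * w * U + (14 * w + 3 * (w * w)) * (2 * N1 + N2p) +
  199 / 100 * phx + s / 10 + p * r / 20 + t * D / 20 - 3 / 10 * (w * w * (Q + N1)).
Proof.
move=> p0 p4 l0 l1 t0 k1 kp w0 wa aw aw' wb bw bw' e0 we wet wep nue eta0 eta1.
move=> s0 r0 D0 phx0 phy0 phmp0 phmE g0 Q0 M0 O0 N10 N20 N2E tm0 ep0 pw0 pf0 vv0 EO0 EN0.
move=> hT hO hv hpw hpf hzm hep hEU hU hX hEN.
have w0' := ltW w0; have p0' := ltW p0; have e0' := ltW e0.
have a0 : 0 <= a := le_trans w0' wa.
have ww0 : 0 <= w * w by rewrite mulr_ge0.
have b0 : 0 <= b := le_trans ww0 wb.
have aw2 : a <= 102 / 100 * w.
  apply: le_trans aw _; rewrite ler_pM2r//; clear -p4; lra.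
have nu0 : 0 <= 14 * w + 3 * (w * w) by clear -w0' ww0; lra.
have S1 : a * (1 - lam) * (phx - (1 - p) * phy - p * phm) <=
    - (88 / 100) * (w * g) - 74 / 100 * (w * Q) - 99 / 100 * (w * (p * M'))
    + 57 / 10 * (w * pw) + 57 / 10 * (w * pf).
  have c0 : 0 <= 1 - lam by clear -l1; lra.
  have c1 : a * (1 - lam) <= 102 / 100 * w.
    by apply: le_trans aw2; rewrite ler_piMr//; clear -l0; lra.
  have c2 : 99 / 100 * w <= a * (1 - lam).
    have h : 99 / 100 <= 1 - lam by clear -l1; lra.
    by have := ler_wpM2r w0' h; have := ler_wpM2r c0 wa; clear; lra.
  have c3 := ler_wpM2l (mulr_ge0 a0 c0) hT.
  have d1 := ler_wpM2r g0 c2; have d3 := ler_wpM2r (mulr_ge0 p0' M0) c2.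
  have d2 : 99 / 100 * w * (3 / 4 * Q) <= a * (1 - lam) * ((1 - p) * Q).
    have q0 : 0 <= 3 / 4 :> R by clear; lra.
    have q1 : 0 <= 99 / 100 :> R by clear; lra.
    have q2 : 3 / 4 <= 1 - p by clear -p4; lra.
    exact: ler_pM (mulr_ge0 q1 w0') (mulr_ge0 q0 Q0) c2 (ler_wpM2r Q0 q2).
  have d4 := ler_wpM2r pw0 c1; have d5 := ler_wpM2r pf0 c1.
  have d6 := mulr_ge0 w0' g0; have d7 := mulr_ge0 w0' Q0.
  have d8 := mulr_ge0 w0' (mulr_ge0 p0' M0).
  have d9 := mulr_ge0 w0' pw0; have d10 := mulr_ge0 w0' pf0.
  move: c3 d1 d2 d3 d4 d5; move: (a * (1 - lam)) => c; clear -d6 d7 d8 d9 d10 => *; lra.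
have S2 : a * (20^-1 * (p * EO)) <= w * (20^-1 * (p * O)) - 7 / 100 * (w * (p * (p * O)))
    + 6 / 100 * (w * vv).
  have c1 : a * (p * EO) <= a * ((1 - 16 / 10 * p) * (p * O) + 9 / 8 * vv) by rewrite ler_wpM2l.
  have c2 : a * (1 - 16 / 10 * p) <= (1 - 14 / 10 * p) * w.
    have pw1 : 0 <= 1 - 16 / 10 * p by clear -p4; lra.
    apply: le_trans (ler_wpM2r pw1 aw) _; rewrite mulrAC ler_pM2r//.
    by have := mulr_ge0 p0' p0'; clear -p0'; lra.
  have c3 := ler_wpM2r (mulr_ge0 p0' O0) c2; have c4 := ler_wpM2r vv0 aw2.
  by have := mulr_ge0 w0' vv0; clear -c1 c3 c4; lra.
have S3 : a * (100^-1 * (p * (p * zm))) <= 31 / 1000 * (w * (p * (p * (N1 + O + N2)))).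
  have c1 : p * (p * zm) <= p * (p * (3 * (N1 + O + N2))) by rewrite !ler_pM2l.
  have c0 : 0 <= p * (p * (N1 + O + N2)).
    by rewrite !mulr_ge0// !addr_ge0// N2E mulr_ge0.
  have c2 := ler_wpM2l a0 c1; have c3 := ler_wpM2r c0 aw2.
  have c4 : p * (p * (3 * (N1 + O + N2))) = 3 * (p * (p * (N1 + O + N2))) by ring.
  rewrite c4 in c2; move: c0 c2 c3; move: (p * (p * (N1 + O + N2))) => u.
  move: (p * (p * zm)) => v u0 c2 c3; have := mulr_ge0 w0' u0; clear -c2 c3; lra.
have S4 : a * (100^-1 * ep') <= 100^-1 * (w * (vv + p * (p * O))).
  have c0 : 0 <= vv + p * (p * O) by rewrite addr_ge0// !mulr_ge0.
  have l2 : lam ^+ 2 <= 4^-1.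
    by rewrite expr2; have := ler_pM l0 l0 l1 l1; clear; lra.
  have c1 : ep' <= 2^-1 * (vv + p * (p * O)).
    apply: le_trans hep _; rewrite -mulrDr mulrA; apply: ler_wpM2r => //; clear -l2; lra.
  have c2 : a * ep' <= 102 / 100 * w * (2^-1 * (vv + p * (p * O))).
    by apply: le_trans (ler_wpM2l a0 c1) _; apply: ler_wpM2r => //; rewrite mulr_ge0// invr_ge0.
  by have := mulr_ge0 w0' c0; move: c2; move: (vv + _) => u; clear; lra.
have S5 : b * EU <= w * w * U + 2^-1 * (w * w * pw) + w * w * X - 68 / 100 * (w * w * Q)
   + 53 / 100 * (w * EU).
  have E0 : 0 <= EU.
    rewrite hEU !addr_ge0//; rewrite ?mulr_ge0 ?invr_ge0 ?ler0n ?addr_ge0 ?mulr_ge0//.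
    by clear -p4; lra.
  have c1 := ler_wpM2r E0 bw'; have c2 := ler_wpM2l ww0 hU.
  have c3 : 68 / 100 * (w * w * Q) <= w * w * ((1 - p - p * p - lam) * Q).
    rewrite mulrCA; apply: ler_wpM2l => //; apply: ler_wpM2r => //.
    by have := ler_pM p0' p0' p4 p4; clear -p4 l1; lra.
  move: c1 c2 c3; rewrite (mulrBl EU b) -(mulrA (53 / 100) w EU).
  move: ((_ - lam) * Q) => q; clear; move: (w * w) => v; lra.
have S6 : w * w * X <= w * (p / 200 * (3 * vv + p * (p * O) + 2^-1 * ep + tm)).
  have u0 : 0 <= 3 * vv + p * (p * O) + 2^-1 * ep + tm.
    by rewrite !addr_ge0// ?mulr_ge0// ?mulr_ge0// ?invr_ge0 ler0n.
  apply: (@le_trans _ _ (w * w * (eps * (3 * vv + p * (p * O) + 2^-1 * ep + tm)))).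
    by rewrite ler_wpM2l.
  by rewrite -mulrA ler_pM2l// mulrA ler_wpM2r.
have S7 : (14 * a + 3 * b) * (2 * EN1 + (N1 + (1 - p) * N2p)) <=
   (14 * w + 3 * (w * w)) * (2 * N1 + N2p) - 95 / 100 * ((14 * w + 3 * (w * w)) * N1)
   - 8 / 10 * ((14 * w + 3 * (w * w)) * (p * N2p))
   + 208 / 100 * ((14 * w + 3 * (w * w)) * EN1).
  have n1 : 14 * a + 3 * b <= (1 + 3 / 20 * p) * (14 * w + 3 * (w * w)).
    have : 0 <= p * w by rewrite mulr_ge0.
    clear -aw bw; lra.
  have n2 : 14 * a + 3 * b <= 104 / 100 * (14 * w + 3 * (w * w)).
    by apply: le_trans n1 _; apply: ler_wpM2r => //; clear -p4; lra.
  have n0 : 0 <= 14 * a + 3 * b by clear -a0 b0; lra.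
  have m1 := ler_wpM2r EN0 n2; have m2 := ler_wpM2r N10 n2.
  have c0 : 0 <= (1 - p) * N2p by rewrite mulr_ge0// subr_ge0 (le_trans p4)//; clear; lra.
  have m3 := ler_wpM2r c0 n1.
  have m4 : 0 <= (14 * w + 3 * (w * w)) * (p * N2p) by rewrite !mulr_ge0.
  have m5 : 0 <= (14 * w + 3 * (w * w)) * N1 by rewrite !mulr_ge0.
  have m6 : 0 <= (14 * w + 3 * (w * w)) * (p * (p * N2p)) by rewrite !mulr_ge0.
  move: m1 m2 m3 m4 m5 m6; move: (14 * a + 3 * b) (14 * w + 3 * (w * w)) => x y; clear; lra.
have S8 : (14 * w + 3 * (w * w)) * EN1 <= 2 / 106 * ((14 * w + 3 * (w * w)) * (Q + N1))
   + 1284 / 10000 * (p * s) + 4 / 10000 * (p * r).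
  have h := ler_wpM2l nu0 hEN.
  have e1 : (14 * w + 3 * (w * w)) * (eta * (Q + N1)) <=
      106^-1 * ((14 * w + 3 * (w * w)) * (Q + N1)).
    by rewrite [leRHS]mulrCA ler_wpM2l// ler_wpM2r// addr_ge0.
  have e2 := ler_wpM2r s0 nue; have e3 := ler_wpM2r r0 nue.
  have ps := mulr_ge0 p0' s0; have pr := mulr_ge0 p0' r0.
  move: h e1 e2 e3; move: (14 * w + 3 * (w * w)) (eps ^+ 2) => y e; clear -ps pr; lra.
have S9 : w * pf <= t / 500 * (2 * D) + p / 4000 * (8 * r).
  have c1 := ler_wpM2l w0' hpf; have c2 := ler_wpM2r D0 wet; have c3 := ler_wpM2r r0 wep.
  move: c1 c2 c3; move: (eps ^+ 2) => e; clear; lra.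
have S10 : w * vv <= w * (2 * pw + 2 * g) by rewrite ler_pM2l.
have S11 : w * pw <= w * (N1 + p * N2).
  have : 0 <= p * N1 by rewrite mulr_ge0.
  rewrite ler_pM2l//; clear -hpw; lra.
have S12 : w * w * pw <= w * w * (N1 + p * N2).
  have : 0 <= p * N1 by rewrite mulr_ge0.
  move=> h; apply: ler_wpM2l => //; clear -hpw h; lra.
have S13 : (a - w) * (phy + (1 - lam) * phm) <= 255 / 1000 * (phy + p * phmp).
  have m0 : 0 <= p * phmp by rewrite mulr_ge0.
  apply: (@le_trans _ _ (255 / 1000 * (phy + (1 - lam) * phm))).
    by apply: ler_wpM2r aw'; rewrite phmE addr_ge0// mulr_ge0//; clear -l1; lra.
  have : 0 <= lam * (p * phmp) by rewrite mulr_ge0.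
  rewrite phmE; clear; lra.
have S14 : k * ((1 - lam) * phx + lam * phy) + k * (3 / 10 * (phy + (1 - p) * phmp)) <=
    101 / 100 * phx + 4 / 10 * phy + 3 / 10 * phmp - 29 / 100 * (p * phmp).
  have k2 : k <= 1 + 360^-1 by clear -kp p4; lra.
  have k0 : 0 <= k := le_trans ler01 k1.
  have c1 : k * phx <= (1 + 360^-1) * phx by rewrite ler_wpM2r.
  have c2 : k * phy <= (1 + 360^-1) * phy by rewrite ler_wpM2r.
  have c3 : k * phmp <= (1 + p / 90) * phmp by rewrite ler_wpM2r.
  have l2 : lam <= 20^-1 by clear -l1; lra.
  have c4 := ler_pM k0 (mulr_ge0 l0 phy0) k2 (ler_wpM2r phy0 l2).
  have c5 : 0 <= k * (lam * phx) by rewrite !mulr_ge0.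
  have c6 : 1 * (p * phmp) <= k * (p * phmp) by rewrite ler_wpM2r// mulr_ge0.
  by have := mulr_ge0 p0' phmp0; clear -c1 c2 c3 c4 c5 c6 phx0 phy0; lra.
have S15 : w * EU <= 2^-1 * (w * g) + 10^-1 * (w * Q) + w * (p * M').
  have c1 : p * p <= 16^-1 by have := ler_pM p0' p0' p4 p4; clear; lra.
  have c2 : (p * p + lam) * Q <= 10^-1 * Q.
    by apply: ler_wpM2r => //; clear -c1 l1; lra.
  have c3 : 0 <= p * (p * M') by rewrite !mulr_ge0.
  have c4 : EU <= 2^-1 * g + 10^-1 * Q + p * M' by rewrite hEU; clear -c2 c3; lra.
  have := ler_wpM2l w0' c4; clear; lra.
have {}S6 : w * w * X <= 800^-1 * (w * (3 * vv + p * (p * O) + 2^-1 * ep)) +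
    200^-1 * (w * (p * tm)).
  apply: le_trans S6 _.
  have u0 : 0 <= 3 * vv + p * (p * O) + 2^-1 * ep.
    by rewrite !addr_ge0// ?mulr_ge0// ?mulr_ge0// ?invr_ge0 ler0n.
  have := ler_wpM2r (mulr_ge0 w0' u0) p4.
  move: (3 * vv + _ + _) => u; clear; lra.
rewrite phmE in S1 S13 *.
have a1 := mulr_ge0 w0' g0; have a2 := mulr_ge0 w0' Q0.
have a3 := mulr_ge0 w0' (mulr_ge0 p0' M0); have a4 := mulr_ge0 w0' pw0.
have a6 := mulr_ge0 w0' (mulr_ge0 p0' (mulr_ge0 p0' O0)).
have a7 := mulr_ge0 w0' (mulr_ge0 p0' tm0); have a8 := mulr_ge0 w0' ep0.
have a9 := mulr_ge0 ww0 Q0; have a10 := mulr_ge0 w0' N10; have a11 := mulr_ge0 ww0 N10.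
have a12 : 0 <= w * N2 by rewrite N2E !mulr_ge0.
have a13 : 0 <= w * w * N2 by rewrite N2E !mulr_ge0.
have a14 := mulr_ge0 w0' vv0.
have p2 : p * p <= 16^-1 by have := ler_pM p0' p0' p4 p4; clear; lra.
have b1 : w * (p * (p * (N1 + O + N2))) <= 16^-1 * (w * N1 + w * N2) + w * (p * (p * O)).
  have := ler_wpM2r a10 p2; have := ler_wpM2r a12 p2; clear; lra.
have b2 := ler_wpM2r a12 p4; have b3 := ler_wpM2r a13 p4.
have ps : p * s <= 4^-1 * s by rewrite ler_wpM2r.
have pr := mulr_ge0 p0' r0; have tD := mulr_ge0 t0 D0.
have mp := mulr_ge0 p0' phmp0.
have E1 : a * ((1 - lam) * phx + lam * phy + (1 - lam) * (p * phy + (1 - p) * (p * phmp)) +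
   20^-1 * (p * EO) + 100^-1 * (p * (p * zm)) + 100^-1 * ep') =
  w * (phy + (1 - lam) * (p * phmp)) + (a - w) * (phy + (1 - lam) * (p * phmp)) +
  a * (1 - lam) * (phx - (1 - p) * phy - p * (p * phmp)) +
  a * (20^-1 * (p * EO)) + a * (100^-1 * (p * (p * zm))) + a * (100^-1 * ep').
  by ring.
rewrite E1.
rewrite -N2E in S7.
move: S1 S2 S3 S4 S5 S6 S7 S8 S9 S10 S11 S12 S13 S14 S15.
move: a1 a2 a3 a4 a6 a7 a8 a9 a10 a11 a12 a13 a14 b1 b2 b3 ps pr tD mp s0 phx0 phy0.
move: (a * (1 - lam) * _) (a * (20^-1 * _)) (a * (100^-1 * ep')) (a * (100^-1 * _)).
move: ((a - w) * _) (b * EU) (w * EU) (w * w * X) ((14 * a + 3 * b) * _) => ? ? ? ? ?.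
clear; intros; lra.
Qed.

Lemma dotv_sqrD_young (R : realType) (d : nat) (u v : 'rV[R]_d) :
  dotv (u + v) (u + v) <= 11 / 10 * dotv v v + 11 * dotv u u.
Proof.
have := @dotv_young R d 10 u v ltac:(exact: ltr0n); rewrite (dotv_sqrD u).
by move: (dotv u u) (dotv u v) (dotv v v) => a b c; clear; lra.
Qed.

Lemma contraction_inverse (R : realType) (k t p : R) : 0 < p -> p <= 4^-1 ->
  0 < t -> t <= p / 100 -> k * (1 - t / 2) = 1 ->
  [/\ 0 < 1 - t / 2, 0 < k, 1 <= k & k <= 1 + p / 90].
Proof.
move=> p0 p4 t0 tp kE.
have t1 : 0 < 1 - t / 2 by clear -tp p4; lra.
have k0 : 0 < k by rewrite -(pmulr_lgt0 k t1) kE ltr01.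
have kt : 0 <= k * t by rewrite mulr_ge0// ltW.
have k1 : k * t <= k * (p / 100) by rewrite ler_pM2l.
have k2 : k * p <= k * 4^-1 by rewrite ler_pM2l.
have k3 : k <= 11 / 10 by clear -k1 k2 kE k0; lra.
have k4 : k * p <= 11 / 10 * p by rewrite ler_pM2r.
have k5 : 1 <= k by clear -kt kE; lra.
have k6 : k <= 1 + p / 90 by clear -k1 k4 kE p0; lra.
by split.
Qed.

Lemma le1_of_le (R : realType) (x : R) : x <= 2000^-1 -> x <= 1.
Proof. by move=> h; lra. Qed.

Lemma sqr_sum_le (R : realType) (d : nat) (u v : 'rV[R]_d) :
  dotv (u + v) (u + v) <= 2 * dotv u u + 2 * dotv v v.
Proof.
have := dotv_ge0 (u - v); rewrite (dotv_sqrD u v) (dotv_sqrB u v).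
by move: (dotv u u) (dotv u v) (dotv v v) => a b c; clear; lra.
Qed.

Lemma sqr_sum3_le (R : realType) (d : nat) (u v w : 'rV[R]_d) :
  dotv (u - v - w) (u - v - w) <= 3 * (dotv u u + dotv v v + dotv w w).
Proof.
have := dotv_ge0 (u + v); have := dotv_ge0 (u + w); have := dotv_ge0 (v - w).
rewrite (dotv_sqrB (u - v) w) (dotvDl u (- v) w) (dotvNl v w) (dotv_sqrB u v) (dotv_sqrB v w)
  (dotv_sqrD u v) (dotv_sqrD u w).
by move: (dotv u u) (dotv u v) (dotv v v) (dotv u w) (dotv v w) (dotv w w); clear; intros; lra.
Qed.

Lemma convex_sqr_le (R : realType) (d : nat) (p : R) (u v : 'rV[R]_d) : 0 < p -> p <= 4^-1 ->
  dotv ((1 - p) *: u + p *: v) ((1 - p) *: u + p *: v) <= (1 - p) * dotv u u + p * dotv v v.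
Proof.
move=> p0 p4; have h : 0 <= p * ((1 - p) * dotv (u - v) (u - v)).
  by rewrite !mulr_ge0 ?dotv_ge0 ?(ltW p0)// subr_ge0; clear -p4; lra.
move: h; rewrite (dotv_sqrB u) (dotv_sqrD ((1 - p) *: u)) !(dotvZl (1 - p)) !(dotvZr (1 - p))
  !(dotvZl p) !(dotvZr p).
by move: (dotv u u) (dotv u v) (dotv v v); clear; intros; lra.
Qed.

Lemma dotvNDr (R : realType) (d : nat) (u v w : 'rV[R]_d) : dotv w (u - v) = dotv w u - dotv w v.
Proof. by rewrite dotvDr dotvNr. Qed.

Lemma sqr_sum_bound (R : realType) (a b c : R) : 0 <= a + 2 * b + c ->
  a - 2 * b + c <= 2 * a + 2 * c.
Proof. by move=> h; lra. Qed.

Lemma pf_bound (R : realType) (e D r a b : R) : a <= e * D -> b <= 4 * e * r ->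
  2 * a + 2 * b <= e * (2 * D + 8 * r).
Proof. by move=> h1 h2; lra. Qed.

Lemma drift_sum (R : realType) (e x m a b : R) : a <= e * x -> b <= 4 * e * m ->
  2 * a + 2 * b <= 2 * (e * x) + 8 * (e * m).
Proof. by move=> h1 h2; lra. Qed.

Lemma noise_sum (R : realType) (e s r E v y k Y EN et : R) : 0 <= e -> 0 <= s ->
  2 * Y <= y + v -> EN <= v + 2 * Y + 4 * e * k -> y <= 4 * e * k -> k <= 2 * r + 2 * E ->
  E <= 2000^-1 * s -> v <= et + 3206 * (e * s) ->
  EN <= 2 * et + 6420 * (e * s) + 16 * (e * r).
Proof.
move=> e0 s0 h1 h2 h3 h4 h5 h6.
have h7 : e * k <= e * (2 * r + 2 * (2000^-1 * s)).
  by apply: ler_wpM2l => //; clear -h4 h5; lra.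
have := mulr_ge0 e0 s0; clear -h1 h2 h3 h6 h7; lra.
Qed.

Lemma combine_bounds (R : realType) (a b c d f g x y q lhs rhs : R) :
  0 <= x -> 0 <= y ->
  a <= b - 199 / 100 * f - g / 10 - 9 / 10 * x - y / 5 + 3 / 10 * q ->
  c <= d + 199 / 100 * f + g / 10 + x / 20 + y / 20 - 3 / 10 * q ->
  lhs = a + c -> b + d = rhs -> lhs <= rhs.
Proof. by move=> x0 y0 h1 h2 -> <-; clear -x0 y0 h1 h2; lra. Qed.

(** * One round of the potential for small steps *)

Section hard_regime.
Variables (R : realType) (d n : nat) (Z : set 'rV[R]_d)
  (F : 'I_n.+1 -> 'rV[R]_d -> 'rV[R]_d) (L mu : R).
Hypotheses (Z_nonempty : Z !=set0) (Z_closed : closed Z)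
  (Z_convex : @convex_set R 'rV[R]_d Z)
  (L_gt0 : 0 < L) (mu_gt0 : 0 < mu)
  (F_lipschitz : forall i u v, Z u -> Z v ->
    enorm (F i u - F i v) <= L * enorm (u - v))
  (F_strongly_monotone : forall u v, Z u -> Z v ->
    mu * enorm (u - v) ^+ 2 <= dotv (avg_op F u - avg_op F v) (u - v)).
Variable zstar : 'rV[R]_d.
Hypotheses (zstar_in : Z zstar)
  (zstar_sol : forall z, Z z -> 0 <= dotv (avg_op F zstar) (z - zstar)).
Variables (gamma eta p : R) (H : nat).
Hypotheses (gamma_gt0 : 0 < gamma) (p_gt0 : 0 < p) (p_le : p <= 4^-1).

Let eps := gamma * L.
Let t := gamma * mu.
Let N : R := n.+1%:R^-1.

Let Av v := gamma *: F ord0 v.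
Let Dv v := gamma *: (avg_op F v - F ord0 v).

Let eps_gt0 : 0 < eps. Proof. by rewrite mulr_gt0. Qed.
Let t_gt0 : 0 < t. Proof. by rewrite mulr_gt0. Qed.
Let N_ge0 : 0 <= N. Proof. by rewrite invr_ge0. Qed.

Let enorm_sqr_le (a b : 'rV[R]_d) (c : R) : 0 <= c -> enorm a <= c * enorm b ->
  dotv a a <= c ^+ 2 * dotv b b.
Proof.
move=> c0 ab; rewrite -!sqr_enorm -exprMn; apply: lerXn2r => //.
  by rewrite nnegrE enorm_ge0.
by rewrite nnegrE mulr_ge0// enorm_ge0.
Qed.

Let avg_lipschitz u v : Z u -> Z v ->
  enorm (avg_op F u - avg_op F v) <= L * enorm (u - v).
Proof.
move=> Zu Zv; have := avg_op_lipschitz L_gt0 F_lipschitz Zu Zv.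
by rewrite -!sqr_enorm -exprMn ler_pXn2r ?nnegrE ?mulr_ge0 ?enorm_ge0 ?(ltW L_gt0).
Qed.

Let enormZ (a : R) (u : 'rV[R]_d) : 0 <= a -> enorm (a *: u) = a * enorm u.
Proof.
by move=> a0; rewrite /enorm dotvZl dotvZr mulrA -expr2 sqrtrM ?sqr_ge0// sqrtr_sqr ger0_norm.
Qed.

Lemma Av_lipschitz u v : Z u -> Z v ->
  dotv (Av u - Av v) (Av u - Av v) <= eps ^+ 2 * dotv (u - v) (u - v).
Proof.
move=> Zu Zv; apply: enorm_sqr_le; first exact: ltW.
by rewrite -scalerBr enormZ ?(ltW gamma_gt0)// /eps -mulrA ler_pM2l// F_lipschitz.
Qed.

Lemma avg_Lv u v : Z u -> Z v ->
  dotv (gamma *: avg_op F u - gamma *: avg_op F v) (gamma *: avg_op F u - gamma *: avg_op F v)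
  <= eps ^+ 2 * dotv (u - v) (u - v).
Proof.
move=> Zu Zv; apply: enorm_sqr_le; first exact: ltW.
by rewrite -scalerBr enormZ ?(ltW gamma_gt0)// /eps -mulrA ler_pM2l// avg_lipschitz.
Qed.

Lemma Dv_lipschitz u v : Z u -> Z v ->
  dotv (Dv u - Dv v) (Dv u - Dv v) <= 4 * eps ^+ 2 * dotv (u - v) (u - v).
Proof.
move=> Zu Zv; have -> : 4 * eps ^+ 2 = (2 * eps) ^+ 2 by ring.
apply: enorm_sqr_le; first by rewrite mulr_ge0// ltW.
rewrite -scalerBr enormZ ?(ltW gamma_gt0)// /eps.
have -> : 2 * (gamma * L) * enorm (u - v) = gamma * (2 * (L * enorm (u - v))) by ring.
rewrite ler_pM2l//.
have -> : avg_op F u - F ord0 u - (avg_op F v - F ord0 v) =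
    (avg_op F u - avg_op F v) - (F ord0 u - F ord0 v).
  by apply/rowP => j; rewrite !mxE; ring.
apply: le_trans (ler_enormD _ _) _; rewrite enormN.
by have := avg_lipschitz Zu Zv; have := F_lipschitz ord0 Zu Zv; lra.
Qed.

Lemma noise_le i m u : Z m -> Z u ->
  gamma ^+ 2 * dotv (F i m - F ord0 m - F i u + F ord0 u) (F i m - F ord0 m - F i u + F ord0 u)
  <= 4 * eps ^+ 2 * dotv (m - u) (m - u).
Proof.
move=> Zm Zu; have -> : 4 * eps ^+ 2 = gamma ^+ 2 * (2 * L) ^+ 2 by rewrite /eps; ring.
rewrite -mulrA ler_pM2l ?exprn_gt0//; apply: enorm_sqr_le; first by rewrite mulr_ge0// ltW.
have -> : F i m - F ord0 m - F i u + F ord0 u = (F i m - F i u) - (F ord0 m - F ord0 u).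
  by apply/rowP => j; rewrite !mxE; ring.
apply: le_trans (ler_enormD _ _) _; rewrite enormN.
by have := F_lipschitz i Zm Zu; have := F_lipschitz ord0 Zm Zu; lra.
Qed.

(** The target [y] is free: it is [zstar] for the distances and the next shadow for the noise terms.
    The noise is bounded through [L], which suffices because [gamma * L] is small. *)
Lemma outer_step_dist z m y : Z m -> Z y ->
  let u := inner_loop Z F gamma eta p H z m in Z u ->
  N * (\sum_i dotv (outer_step Z F gamma eta p H i z m - y)
                  (outer_step Z F gamma eta p H i z m - y)) <=
  dotv (u - y) (u - y) + 2 * dotv (Dv m - Dv u) (u - y)
  + 4 * eps ^+ 2 * dotv (m - u) (m - u).
Proof.
move=> Zm Zy; cbv zeta; set u := inner_loop _ _ _ _ _ _ _ _ => Zu.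
pose D i := F i m - F ord0 m - F i u + F ord0 u.
have step i : dotv (outer_step Z F gamma eta p H i z m - y)
                  (outer_step Z F gamma eta p H i z m - y) <=
    dotv (u - y) (u - y) + 2 * gamma * dotv (D i) (u - y) + 4 * eps ^+ 2 * dotv (m - u) (m - u).
  have := proj_nonexpansive Z_nonempty Z_closed Z_convex (u + gamma *: D i) y.
  rewrite (proj_fixed Z_nonempty Z_closed Z_convex Zy).
  rewrite -(@ler_pXn2r _ 2)// ?nnegrE ?enorm_ge0// !sqr_enorm => h.
  apply: le_trans h _.
  have -> : u + gamma *: D i - y = (u - y) + gamma *: D i by rewrite addrAC.
  have := noise_le i Zm Zu; rewrite -/(D i).
  rewrite (dotv_sqrD (u - y)) !(dotvZl gamma) !(dotvZr gamma) (dotvC (u - y) (D i)).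
  by rewrite (mulrA gamma gamma) -expr2; move: (_ ^+ 2 * dotv (D i) _) => *; lra.
have avgD : N *: \sum_i D i = avg_op F m - F ord0 m - (avg_op F u - F ord0 u).
  by rewrite -avg_op_diff.
apply: le_trans (ler_wpM2l N_ge0 (ler_sum _ (fun i _ => step i))) _.
rewrite !big_split /= !mulrDr !avg_cst -!mulr_sumr -dotv_suml lerD2r lerD2l.
have -> : Dv m - Dv u = gamma *: (N *: \sum_i D i) by rewrite avgD /Dv -scalerBr.
by rewrite !dotvZl le_eqVlt; apply/orP; left; apply/eqP; ring.
Qed.

Variables (lam : R) (X : 'rV[R]_d -> 'rV[R]_d -> 'rV[R]_d).
Hypotheses (lam_ge0 : 0 <= lam) (lam_le : lam <= 2000^-1)
  (X_sol : forall z m, inner_solution Z F gamma p z m (X z m)).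

Let ph v := gamma * dotv (avg_op F zstar) (v - zstar).
Let Gv z m := z + p *: (m - z) - X z m.

(** An exact inner step is implicit: its displacement [Gv] is the scaled operator plus a vector
    normal to [Z] at the new point. This is the normal vector. *)
Definition inner_normal z m := Gv z m - Av (X z m) - Dv m.

Let X_in z m : Z (X z m). Proof. by case: (X_sol z m). Qed.

Lemma inner_normalE z m :
  inner_normal z m = - (gamma *: inner_op F gamma p z m (X z m)).
Proof.
rewrite /inner_normal /Gv /Av /Dv /inner_op.
move: (avg_op F m) (F ord0 m) (F ord0 _) => a b c.
by apply/rowP => j; rewrite !mxE; field; rewrite gt_eqF.
Qed.

Lemma inner_normal_ge0 z m y : Z y -> 0 <= dotv (inner_normal z m) (X z m - y).
Proof.
move=> Zy; rewrite inner_normalE dotvNl -dotvNr opprB dotvZl pmulr_rge0//.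
by case: (X_sol z m) => _; apply.
Qed.

(* The pairings of the normal vector with the shadows are nonnegative by the inner
   variational inequality; they are what makes this nonincreasing for exact rounds. *)
Definition speed zp mp yt mb :=
  2^-1 * dotv (Gv zp mp) (Gv zp mp) + p * dotv (inner_normal zp mp) (X zp mp - mb)
  + dotv (inner_normal zp mp) (X zp mp - yt).

(* [(zp, mp)] is the state of the previous round, [yt] and [mb] are the shadows of
   [z] and [m]; [ph], affine and nonnegative on [Z], plays the role of a function gap. *)
Definition potential (B w : R) zp mp z m yt mb :=
  B * (dotv (z - zstar) (z - zstar) + (1 - lam) * dotv (m - zstar) (m - zstar))
  + ph yt + 3 / 10 * (ph mb / p)
  + w * (ph yt + (1 - lam) * ph mb + 20^-1 * (p * dotv (mb - yt) (mb - yt))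
         + 100^-1 * (p * dotv (m - mp) (m - mp)) + 100^-1 * dotv (yt - X zp mp) (yt - X zp mp))
  + w * w * speed zp mp yt mb
  + (14 * w + 3 * (w * w)) * (2 * dotv (z - yt) (z - yt) + dotv (m - mb) (m - mb) / p).

Let ph_ge0 y : Z y -> 0 <= ph y.
Proof. by move=> Zy; rewrite mulr_ge0 ?zstar_sol// ltW. Qed.

Lemma speed_ge0 zp mp yt mb : Z yt -> Z mb -> 0 <= speed zp mp yt mb.
Proof.
move=> Zy Zm; rewrite !addr_ge0// ?mulr_ge0 ?invr_ge0 ?dotv_ge0 ?inner_normal_ge0//.
exact: ltW.
Qed.

Lemma potential_ge B w zp mp z m yt mb : 0 <= w -> Z yt -> Z mb ->
  B * (dotv (z - zstar) (z - zstar) + (1 - lam) * dotv (m - zstar) (m - zstar))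
  <= potential B w zp mp z m yt mb.
Proof.
move=> w0 Zy Zm; have p0 := ltW p_gt0; have l0 : 0 <= 1 - lam.
  by move: lam_le; lra.
have h1 := ph_ge0 Zy; have h2 := ph_ge0 Zm.
have a1 : 0 <= ph mb / p by rewrite divr_ge0.
have a2 : 0 <= w * (ph yt + (1 - lam) * ph mb + 20^-1 * (p * dotv (mb - yt) (mb - yt))
    + 100^-1 * (p * dotv (m - mp) (m - mp)) + 100^-1 * dotv (yt - X zp mp) (yt - X zp mp)).
  have b1 := mulr_ge0 l0 h2.
  have b2 c v : 0 <= c -> 0 <= c * (p * dotv v v) :> R by move=> c0; rewrite !mulr_ge0 ?dotv_ge0.
  have c1 : 0 <= 20^-1 :> R by rewrite invr_ge0 ler0n.
  have c2 : 0 <= 100^-1 :> R by rewrite invr_ge0 ler0n.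
  by apply: (mulr_ge0 w0); rewrite !addr_ge0 ?b2// mulr_ge0 ?dotv_ge0.
have a3 : 0 <= w * w * speed zp mp yt mb by rewrite !mulr_ge0// speed_ge0.
have a4 : 0 <= (14 * w + 3 * (w * w)) *
    (2 * dotv (z - yt) (z - yt) + dotv (m - mb) (m - mb) / p).
  apply: mulr_ge0; first by rewrite addr_ge0// !mulr_ge0// ler0n.
  by apply: addr_ge0; [rewrite mulr_ge0 ?ler0n ?dotv_ge0 | rewrite divr_ge0 ?dotv_ge0].
rewrite /potential; move: a1 a2 a3 a4 h1; move: (w * _) (w * w * _) (_ * (2 * _ + _)) => a b c.
by move: (ph mb / p) (ph yt) (B * _) => *; lra.
Qed.

(** Beyond [t * |q|^2] the gap [ph] of the exact point is kept on the left; it pays for the gaps of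
    the shadows. *)
Lemma exact_step z m : Z z -> Z m ->
  t * dotv (X z m - zstar) (X z m - zstar) + ph (X z m)
  + dotv (Dv m - Dv (X z m)) (X z m - zstar)
  <= (1 - p) * dotv (z - X z m) (X z m - zstar) + p * dotv (m - X z m) (X z m - zstar).
Proof.
move=> Zz Zm; have := inner_normal_ge0 z m zstar_in.
have := F_strongly_monotone (X_in z m) zstar_in; rewrite sqr_enorm.
rewrite -(ler_pM2l gamma_gt0) mulrA -/t /ph.
set x := X z m; set q := x - zstar => h1.
have -> : inner_normal z m = ((1 - p) *: (z - x) + p *: (m - x))
    - (gamma *: avg_op F x + (Dv m - Dv x)).
  rewrite /inner_normal /Gv /Av /Dv -/x; move: (avg_op F x) (avg_op F m) => a b.
  by apply/rowP => j; rewrite !mxE; ring.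
rewrite (dotvDl _ (- (gamma *: _ + _))) (dotvNl (gamma *: _ + _)) (dotvDl (gamma *: _))
  (dotvDl ((1 - p) *: _)) (dotvZl (1 - p)) (dotvZl p) (dotvZl gamma).
move: h1; rewrite (dotvDl (avg_op F x)) (dotvNl (avg_op F zstar)) mulrDr mulrN.
move: (gamma * dotv (avg_op F x) q) (gamma * dotv (avg_op F zstar) q) => a b.
move: (t * _) (dotv (Dv m - _) q) (_ * dotv (z - x) q) (_ * dotv (m - x) q) => *; lra.
Qed.

Let next_shadow z m yt := X z m - lam *: (X z m - yt).

(** The distances, weighted by [B], are separated from all other terms. They leave gains in the gap
    of the exact point and in the squares of [z - x], [m - x] and [x - zstar]; the other terms spend
    these gains, and in return finance the alignment error by the decrease of the speed. *)
Lemma potential_step zp mp z m yt mb (B B' w w' k tau th et : R) :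
  let x := X z m in let u := inner_loop Z F gamma eta p H z m in
  let rh := u - x - lam *: (z - x) in
  let Q := dotv (inner_normal z m) (x - yt) in
  Z mp -> Z z -> Z m -> Z yt -> Z mb -> Z u ->
  0 < tau -> tau <= 1 -> 0 <= th -> th <= 2000^-1 -> lam ^+ 2 <= th ->
  t <= p / 100 -> eps ^+ 2 <= t * p / 4000 -> eps ^+ 2 <= p / 4000 ->
  k * (1 - t / 2) = 1 -> 1 <= B' -> B' <= B ->
  102 / 100 * (k * B' * tau) <= B - B' + 36 / 100 * t ->
  0 < w -> w <= k * w' -> k * w' <= (1 + 3 / 40 * p) * w -> k * w' - w <= 255 / 1000 ->
  w * w <= k * (w' * w') -> k * (w' * w') <= (1 + 3 / 20 * p) * (w * w) ->
  k * (w' * w') - w * w <= 53 / 100 * w ->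
  w * eps <= p / 200 -> w * eps ^+ 2 <= t / 500 -> w * eps ^+ 2 <= p / 4000 ->
  (14 * w + 3 * (w * w)) * eps ^+ 2 <= p / (50 * 1000) -> 0 <= et -> et <= 106^-1 ->
  dotv (u - x) (u - x) <= th * dotv (z - x) (z - x) ->
  dotv (u - next_shadow z m yt) (u - next_shadow z m yt) <=
    et * (Q + dotv (z - yt) (z - yt)) + 3206 * (eps ^+ 2 * dotv (z - x) (z - x)) ->
  k * B' * (2 / tau * dotv rh rh) <= 6 / 10 * dotv (z - x) (z - x)
    + 3 / 10 * (w * w * (Q + dotv (z - yt) (z - yt))) ->
  N * (\sum_i
    (p * potential B' w' z m (outer_step Z F gamma eta p H i z m) z (next_shadow z m yt) yt +
     (1 - p) * potential B' w' z m (outer_step Z F gamma eta p H i z m) m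
                 (next_shadow z m yt) mb))
  <= (1 - t / 2) * potential B w zp mp z m yt mb.
Proof.
cbv zeta; set x := X z m; set u := inner_loop _ _ _ _ _ _ _ _.
set rh := u - x - lam *: (z - x); set Q := dotv _ (x - yt).
move=> Zmp Zz Zm Zy Zb Zu tau0 tau1 th0 th1 lth tp ept ep kE B1 BB htau w0 w1 w2 w3 w4 w5 w6.
move=> we wet wep nue et0 et1 hth hr hrh.
have p0 := ltW p_gt0.
set y' := next_shadow z m yt.
have Zy' : Z y'.
  have l1 := le1_of_le lam_le.
  have := segment_in Z_convex lam_ge0 l1 (X_in z m) Zy; congr (Z _).
  by rewrite /y' /next_shadow -scalerN opprB.
pose al := z - x; pose be := m - x; pose e := u - x; pose q := x - zstar.
pose EA := N * (\sum_i dotv (outer_step Z F gamma eta p H i z m - zstar)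
                            (outer_step Z F gamma eta p H i z m - zstar)).
pose EN := N * (\sum_i dotv (outer_step Z F gamma eta p H i z m - y')
                            (outer_step Z F gamma eta p H i z m - y')).
have [t1 k0 k1 kp] := contraction_inverse p_gt0 p_le t_gt0 tp kE.
have hEA : EA <= _ := outer_step_dist Zm zstar_in Zu.
have hEN : EN <= _ := outer_step_dist Zm Zy' Zu.
rewrite -/u in hEA hEN.
(* The part of the next potential, averaged over the coin, that does not involve the new point. Only
   the distances of the new point to [zstar] and to the next shadow depend on the index. *)
pose C := B' * ((1 - lam) * (p * dotv (z - zstar) (z - zstar)
                         + (1 - p) * dotv (m - zstar) (m - zstar)))
  + ph y' + 3 / 10 * (ph yt / p * p + (1 - p) * (ph mb / p))
  + w' * (ph y' + (1 - lam) * (p * ph yt + (1 - p) * ph mb)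
     + 20^-1 * (p * (p * dotv (yt - y') (yt - y') + (1 - p) * dotv (mb - y') (mb - y')))
     + 100^-1 * (p * (p * dotv (z - m) (z - m))) + 100^-1 * dotv (y' - x) (y' - x))
  + w' * w' * (p * speed z m y' yt + (1 - p) * speed z m y' mb)
  + (14 * w' + 3 * (w' * w')) * ((p * dotv (z - yt) (z - yt)
      + (1 - p) * dotv (m - mb) (m - mb)) / p).
have Ei i : p * potential B' w' z m (outer_step Z F gamma eta p H i z m) z y' yt +
     (1 - p) * potential B' w' z m (outer_step Z F gamma eta p H i z m) m y' mb =
     B' * dotv (outer_step Z F gamma eta p H i z m - zstar)
               (outer_step Z F gamma eta p H i z m - zstar)
     + (14 * w' + 3 * (w' * w')) * 2 * dotv (outer_step Z F gamma eta p H i z m - y')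
               (outer_step Z F gamma eta p H i z m - y') + C.
  rewrite /potential /C (subrr m) dotv0l -/x.
  move: (dotv (outer_step _ _ _ _ _ _ _ _ _ - zstar) _)
    (dotv (outer_step _ _ _ _ _ _ _ _ _ - y') _) => a1 a2.
  move: (dotv (z - zstar) _) (dotv (m - zstar) _) (dotv (yt - y') _) (dotv (mb - y') _)
    (dotv (z - m) _) (dotv (y' - x) _) (dotv (z - yt) _) (dotv (m - mb) _)
    (speed z m y' yt) (speed z m y' mb) (ph yt) (ph mb) (ph y') => *.
  by ring.
have {Ei}LE : N * (\sum_i
    (p * potential B' w' z m (outer_step Z F gamma eta p H i z m) z y' yt +
     (1 - p) * potential B' w' z m (outer_step Z F gamma eta p H i z m) m y' mb)) =
  B' * EA + (14 * w' + 3 * (w' * w')) * 2 * EN + C.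
  under eq_bigr do rewrite Ei.
  clearbody C; rewrite !big_split /= !mulrDr avg_cst -!mulr_sumr /EA /EN.
  by rewrite !mulrDl; congr (_ + _ + _); ring.
rewrite {}LE /C.
rewrite -(ler_pM2l k0) (mulrA k (1 - t / 2)) kE mul1r.
(* [om] is the gap between the shadows and [pi] the deviation of the state from them. Then [v] is
   [x] minus the combination of [yt] and [mb] with weights [1 - p] and [p]: the move of an exact
   round started at the shadows. *)
pose om := mb - yt; pose pi := (1 - p) *: (z - yt) + p *: (m - mb).
pose G := Gv z m; pose v := pi - G.
pose pf := Av x + Dv m - gamma *: avg_op F zstar.
pose xp := X zp mp; pose Y := Av x - Av xp + (Dv m - Dv mp).
have vom : v + p *: om = x - yt.
  by rewrite /v /pi /om /G /Gv -/x; apply/rowP => j; rewrite !mxE; ring.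
have y'x : y' - x = - lam *: (v + p *: om).
  by rewrite vom /y' /next_shadow -/x; apply/rowP => j; rewrite !mxE; ring.
have yy' : yt - y' = - ((1 - lam) *: (v + p *: om)).
  by rewrite vom /y' /next_shadow -/x; apply/rowP => j; rewrite !mxE; ring.
have by' : mb - y' = om - (1 - lam) *: (v + p *: om).
  by rewrite vom /y' /next_shadow -/x /om; apply/rowP => j; rewrite !mxE; ring.
have Q0 : 0 <= Q := inner_normal_ge0 z m Zy.
pose M' := dotv (inner_normal z m) (x - mb).
have M0 : 0 <= M' := inner_normal_ge0 z m Zb.
have phx0 := ph_ge0 (X_in z m); have phy0 := ph_ge0 Zy; have phm0 := ph_ge0 Zb.
rewrite -/x in phx0.
have s0 := dotv_ge0 al; have r0 := dotv_ge0 be; have D0 := dotv_ge0 q.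
have muE : m - u = be - e by rewrite /be /e; apply/rowP => j; rewrite !mxE; ring.
pose Y1 := Dv x - Dv u; pose Y2 := Dv m - Dv u.
have hY1 : dotv Y1 Y1 <= 4 * eps ^+ 2 * dotv e e.
  have := Dv_lipschitz (X_in z m) Zu; rewrite -/x -/Y1 => h; apply: le_trans h _.
  by rewrite -(opprB u) dotvNl dotvNr opprK.
have hY2 : dotv Y2 Y2 <= 4 * eps ^+ 2 * dotv (be - e) (be - e).
  by rewrite -muE; exact: (Dv_lipschitz Zm Zu).
have Y12 : Y2 - Y1 = Dv m - Dv x by rewrite /Y1 /Y2 opprB addrA subrK.
have hY : dotv (Y2 - Y1) (Y2 - Y1) <= 4 * eps ^+ 2 * dotv be be.
  by rewrite Y12; exact: (Dv_lipschitz Zm (X_in z m)).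
have hvi : t * dotv q q + ph x + dotv (Y2 - Y1) q <= (1 - p) * dotv al q + p * dotv be q.
  by rewrite Y12; exact: exact_step.
have zE : z - zstar = al + q by rewrite /al /q addrA subrK.
have mE : m - zstar = be + q by rewrite /be /q addrA subrK.
have uE : u - zstar = e + q by rewrite /e /q addrA subrK.
have eE : e = lam *: al + rh by rewrite /rh -/al -/e addrC subrK.
have hV : k * B' * (EA + (1 - lam) * (p * dotv (z - zstar) (z - zstar)
      + (1 - p) * dotv (m - zstar) (m - zstar))) <=
    B * (dotv (z - zstar) (z - zstar) + (1 - lam) * dotv (m - zstar) (m - zstar))
    - 199 / 100 * ph x - dotv al al / 10 - 9 / 10 * (p * dotv be be) - t * dotv q q / 5
    + 3 / 10 * (w * w * (Q + dotv (z - yt) (z - yt))).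
  have pd := potential_descent p_gt0 p_le lam_ge0 lam_le t_gt0 tau0 tau1 th0 th1 ept ep phx0
    lth eE hth hY1 hY2 hY hvi.
  rewrite -zE -mE in pd.
  have hE : EA <= dotv (e + q) (e + q) + 2 * dotv Y2 (e + q)
      + 4 * eps ^+ 2 * dotv (be - e) (be - e) by rewrite -uE -muE.
  have {}hE := le_trans hE pd.
  have ha := dotv_sqrD_young al q; have hb := dotv_sqrD_young be q; rewrite -zE in ha; rewrite -mE in hb.
  have hD := potential_dist p_gt0 p_le t_gt0 ept phx0 hY hvi; rewrite -zE -mE in hD.
  have vc := value_contraction p_gt0 p_le lam_ge0 lam_le t_gt0 tp tau0 s0 r0 D0 phx0
    (dotv_ge0 _) (dotv_ge0 _) kE B1 BB htau ha hb hD hE.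
  apply: le_trans vc _; apply: le_trans (lerD (lexx _) hrh) _; rewrite -/al.
  by rewrite le_eqVlt; apply/orP; left; apply/eqP; ring.
have divpK a : a = p * (a / p) by rewrite mulrC divfK// gt_eqF.
have EO0 : 0 <= p * dotv (yt - y') (yt - y') + (1 - p) * dotv (mb - y') (mb - y').
  by rewrite addr_ge0// mulr_ge0// ?dotv_ge0// subr_ge0 (le_trans p_le)// invf_le1 ?ler1n.
have EN0 : 0 <= EN.
  by rewrite mulr_ge0// sumr_ge0// => i _; exact: dotv_ge0.
(* The vector defining [ph] is [G - pf] minus the normal vector. Paired with [v], its first part
   gives the progress, and the normal part gives the nonnegative [Q] and [M'] with a favourable
   sign. *)
have hT : ph x - (1 - p) * ph yt - p * ph mb <= - (9 / 10) * dotv G G + 11 / 2 * dotv pi pi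
    + 11 / 2 * dotv pf pf - (1 - p) * Q - p * M'.
  have E : ph x - (1 - p) * ph yt - p * ph mb = dotv (G - pf) v - (1 - p) * Q - p * M'.
    have Ga : gamma *: avg_op F zstar = G - pf - inner_normal z m.
      rewrite /pf /inner_normal -/x -/G; move: (gamma *: avg_op F zstar) (Av x) (Dv m) (G).
      by move=> a1 a2 a3 a4; apply/rowP => j; rewrite !mxE; ring.
    rewrite /ph -!(dotvZl gamma) Ga /Q /M'.
    have vx : v = (1 - p) *: (x - yt) + p *: (x - mb).
      by rewrite /v /pi /G /Gv -/x; apply/rowP => j; rewrite !mxE; ring.
    rewrite vx; move: (inner_normal z m) (G - pf) => a1 a2.
    rewrite (dotvDl a2) (dotvDr ((1 - p) *: _)) (dotvZr (1 - p)) (dotvZr p) (dotvNl a1).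
    have D1 c c' : dotv c (x - zstar) = dotv c (c' - zstar) + dotv c (x - c').
      by rewrite -dotvDr; congr dotv; apply/rowP => j; rewrite !mxE; ring.
    rewrite (dotvDl a2 (- a1) (yt - zstar)) (dotvDl a2 (- a1) (mb - zstar)) !(dotvNl a1).
    move: (D1 a2 yt) (D1 a2 mb) (D1 a1 yt) (D1 a1 mb).
    move: (dotv a2 (x - zstar)) (dotv a1 (x - zstar)) (dotv a2 (yt - zstar))
      (dotv a1 (yt - zstar)) (dotv a2 (mb - zstar)) (dotv a1 (mb - zstar)).
    move: (dotv a2 (x - yt)) (dotv a1 (x - yt)) (dotv a2 (x - mb)) (dotv a1 (x - mb)).
    move=> b1 b2 b3 b4 b5 b6 b7 b8 b9 b10 e1 e2 e3 e4.
    have -> : b7 = b5 - b1 by rewrite e1 addrK.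
    have -> : b9 = b5 - b3 by rewrite e2 addrK.
    have -> : b8 = b6 - b2 by rewrite e3 addrK.
    have -> : b10 = b6 - b4 by rewrite e4 addrK.
    ring.
  by rewrite E lerD2r lerD2r; exact: normal_progress.
have hO : p * (p * dotv (yt - y') (yt - y') + (1 - p) * dotv (mb - y') (mb - y')) <=
    (1 - 16 / 10 * p) * (p * dotv om om) + 9 / 8 * dotv v v.
  rewrite yy' by' dotvNl dotvNr opprK.
  have h := ler_wpM2l p0 (anchor_gap_step om v p_gt0 p_le lam_ge0 lam_le).
  apply: le_trans h _; rewrite mulrDr (mulrCA p (9 / 8)) (mulrA p p^-1) divff ?gt_eqF// mul1r.
  by rewrite mulrCA.
have hv : dotv v v <= 2 * dotv pi pi + 2 * dotv G G.
  rewrite /v; have := dotv_ge0 (pi + G); rewrite (dotv_sqrD pi G) (dotv_sqrB pi G).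
  by move: (dotv pi pi) (dotv pi G) (dotv G G) => a1 a2 a3; exact: sqr_sum_bound.
have hpw : dotv pi pi <= (1 - p) * dotv (z - yt) (z - yt) + p * dotv (m - mb) (m - mb).
  exact: convex_sqr_le.
have hpf : dotv pf pf <= eps ^+ 2 * (2 * dotv q q + 8 * dotv be be).
  have -> : pf = (gamma *: avg_op F x - gamma *: avg_op F zstar) + (Dv m - Dv x).
    rewrite /pf /Av /Dv; move: (avg_op F x) (avg_op F zstar) (avg_op F m) => a1 a2 a3.
    by apply/rowP => j; rewrite !mxE; ring.
  have h1 := avg_Lv (X_in z m) zstar_in; have h2 := Dv_lipschitz Zm (X_in z m).
  rewrite -/x -/q -/be in h1 h2; apply: le_trans (sqr_sum_le _ _) _.
  by move: h1 h2; move: (dotv (_ - gamma *: _) _) (dotv (Dv m - _) _) => a1 a2; exact: pf_bound.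
have hzm : dotv (z - m) (z - m) <= 3 * (dotv (z - yt) (z - yt) + dotv om om + dotv (m - mb) (m - mb)).
  have -> : z - m = (z - yt) - om - (m - mb) by rewrite /om; apply/rowP => j; rewrite !mxE; ring.
  exact: sqr_sum3_le.
have hep : dotv (y' - x) (y' - x) <= lam ^+ 2 * (2 * dotv v v + 2 * (p * (p * dotv om om))).
  rewrite y'x dotvZl dotvZr mulrA mulrNN -expr2.
  apply: ler_wpM2l; first exact: sqr_ge0.
  apply: le_trans (sqr_sum_le _ _) _; rewrite dotvZl dotvZr; exact: lexx.
have hEU : p * speed z m y' yt + (1 - p) * speed z m y' mb =
    2^-1 * dotv G G + p * (p * Q + (1 - p) * M') + lam * Q.
  rewrite /speed -/G -/x -/Q -/M'.
  have -> : dotv (inner_normal z m) (x - y') = lam * Q.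
    by rewrite -opprB y'x vom scaleNr opprK dotvZr.
  by ring.
have hU : p * speed z m y' yt + (1 - p) * speed z m y' mb <=
    speed zp mp yt mb + 2^-1 * dotv pi pi + (- dotv Y v) - (1 - p - p * p - lam) * Q.
  rewrite hEU.
  have hn : dotv (inner_normal z m) om = Q - M'.
    by rewrite /Q /M' /om -[RHS]dotvNDr; congr dotv; apply/rowP => j; rewrite !mxE; ring.
  have hnp : dotv (inner_normal zp mp) om =
      dotv (inner_normal zp mp) (xp - yt) - dotv (inner_normal zp mp) (xp - mb).
    by rewrite /om -[RHS]dotvNDr; congr dotv; apply/rowP => j; rewrite !mxE; ring.
  have hh : dotv (inner_normal zp mp) (pi - G + p *: om) <= dotv (inner_normal zp mp) (xp - yt).
    have -> : pi - G + p *: om = (xp - yt) - (xp - x).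
      by rewrite -/v vom; apply/rowP => j; rewrite !mxE; ring.
    by rewrite dotvDr dotvNr gerBl; exact: (inner_normal_ge0 zp mp (X_in z m)).
  have nE : inner_normal z m - inner_normal zp mp = G - Gv zp mp - Y.
    rewrite /inner_normal /Y -/x -/xp -/G.
    move: (G) (Gv zp mp) (Av x) (Av xp) (Dv m) (Dv mp) => a1 a2 a3 a4 a5 a6.
    by apply/rowP => j; rewrite !mxE; ring.
  have hQ : dotv (inner_normal z m) (pi - G + p *: om) = Q by rewrite -/v vom.
  exact: (@speed_step R d p lam _ _ _ _ _ _ _ _ _ _ _ p_gt0 p_le M0 (inner_normal_ge0 zp mp Zy)
    nE hQ hn hnp hh).
have hX : - dotv Y v <= eps * (3 * dotv v v + p * (p * dotv om om)
    + 2^-1 * dotv (yt - xp) (yt - xp) + dotv (m - mp) (m - mp)).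
  apply: (@drift_bound R d p eps _ _ v om (yt - xp) Y eps_gt0 erefl).
  have -> : v + p *: om + (yt - xp) = x - xp by rewrite vom addrA subrK.
  have h1 := Av_lipschitz (X_in z m) (X_in zp mp); have h2 := Dv_lipschitz Zm Zmp.
  apply: le_trans (sqr_sum_le _ _) _; rewrite -/x -/xp in h1.
  by move: h1 h2; move: (dotv (Av x - _) _) (dotv (Dv m - _) _) => a1 a2; exact: drift_sum.
have hEN' : EN <= 2 * (et * (Q + dotv (z - yt) (z - yt))) + 6420 * (eps ^+ 2 * dotv al al)
    + 16 * (eps ^+ 2 * dotv be be).
  have h1 := dotv_young Y2 (u - y') ltr01; rewrite invr1 !mul1r in h1.
  have h2 := hEN; rewrite -/Y2 muE in h2; have h3 := hY2.
  have h4 : dotv (be - e) (be - e) <= 2 * dotv be be + 2 * dotv e e.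
    by have := sqr_sum_le be (- e); rewrite (dotvNl e) (dotvNr e) opprK.
  have h5 := le_trans hth (ler_wpM2r s0 th1).
  exact: (noise_sum (sqr_ge0 eps) s0 h1 h2 h3 h4 h5 hr).
have hW := weighted_step p_gt0 p_le lam_ge0 lam_le (ltW t_gt0) k1 kp w0 w1 w2 w3 w4 w5 w6
  eps_gt0 we wet wep nue et0 et1 s0 r0 D0 phx0 phy0 (divr_ge0 phm0 p0) (divpK (ph mb))
  (dotv_ge0 G) Q0 M0 (dotv_ge0 om) (dotv_ge0 (z - yt)) (divr_ge0 (dotv_ge0 (m - mb)) p0)
  (divpK _) (dotv_ge0 (m - mp)) (dotv_ge0 (yt - xp)) (dotv_ge0 pi) (dotv_ge0 pf)
  (dotv_ge0 v) EO0 EN0 hT hO hv hpw hpf hzm hep hEU hU hX hEN'.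
have phy' : ph y' = (1 - lam) * ph x + lam * ph yt.
  have -> : y' = (1 - lam) *: x + lam *: yt.
    by rewrite /y' /next_shadow -/x; apply/rowP => j; rewrite !mxE; ring.
  rewrite /ph; have -> : (1 - lam) *: x + lam *: yt - zstar =
    (1 - lam) *: (x - zstar) + lam *: (yt - zstar).
    by apply/rowP => j; rewrite !mxE; ring.
  by rewrite dotvDr !dotvZr; ring.
have prD := mulr_ge0 p0 r0; have tDD := mulr_ge0 (ltW t_gt0) D0.
apply: (combine_bounds prD tDD hV hW).
  have E1 : (p * dotv (z - yt) (z - yt) + (1 - p) * dotv (m - mb) (m - mb)) / p =
      dotv (z - yt) (z - yt) + (1 - p) * (dotv (m - mb) (m - mb) / p).
    by field; rewrite gt_eqF.
  have E2 : ph yt / p * p = ph yt by rewrite divfK// gt_eqF.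
  by rewrite phy' E1 E2; ring.
by rewrite /potential -/om -/xp; ring.
Qed.

End hard_regime.

(** * Weights of the potential *)

(* As in the potentials k gap + k^2 speed of gradient methods, [w] ends up growing
   linearly; before that it grows geometrically, at the rate at which the anchors are
   refreshed.  It stops once [w ^ 2 * t] exceeds 60 times [3 / (2 * x)], the accuracy of
   the alignment: the contraction by [1 - t / 2] then absorbs the error. *)
Definition next_weight (R : realType) (p t x w : R) :=
  if w * w * t < 60 * (3 / (2 * x)) then
    (if w < 4 / p then w * (1 + p / 36) ^+ 2 else w + 4^-1)
  else w.

(* Its decrease along [next_weight] pays for the Young parameter [tau] of
   [value_weight_step] while [w] is growing. *)
Definition value_weight (R : realType) (p x w : R) :=
  1 + 77 * (3 / (2 * x)) * Num.min (w^-1) (p / 4)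
  + 1400 * x ^- 3 / (p * Num.sqrt p) / Num.sqrt w.

(** The growth may pass the threshold [60] by one round, a factor at most [(65 / 64)^2] on [w^2];
    hence [62]. *)
Definition good_weight (R : realType) (p t x w : R) :=
  p / 128 <= w /\ w * w * t <= 62 * (3 / (2 * x)).

(** [p * x / 40] is [L / mu], so a bound on [t] is also a bound on [eps]; the decay [x^-3] leaves
    room for [eps * x^2]. *)
Lemma hard_params (R : realType) (p t eps x : R) :
  0 < p -> p <= 4^-1 -> 160 <= x -> 40 <= p * x -> 0 < t -> t <= 10 * x ^- 3 ->
  eps = t * (p * x / 40) ->
  [/\ x ^- 3 <= 2000^-1 / 2000, t <= p / 1000, eps * x ^+ 2 <= p / 4 & x ^- 3 <= p / 10000].
Proof.
move=> p0 p4 x160 px t0 tl epsE.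
have x0 : 0 < x by apply: lt_le_trans x160; rewrite ltr0n.
have v0 : 0 < x^-1 by rewrite invr_gt0.
have vx : x * x^-1 = 1 by rewrite divff// gt_eqF.
have v1 : x^-1 <= 160^-1 by rewrite lef_pV2// posrE ltr0n.
have pv : 40 * x^-1 <= p.
  by have := ler_wpM2r (ltW v0) px; rewrite -mulrA vx mulr1.
have v2 : x^-1 * x^-1 <= 160^-1 * 160^-1 by apply: ler_pM => //; exact: ltW.
have E3 : x ^- 3 = x^-1 * (x^-1 * x^-1) by rewrite -exprVn !exprS expr0 mulr1.
have v3 : x ^- 3 <= x^-1 * (160^-1 * 160^-1) by rewrite E3 ler_pM2l.
split.
- by clear -v3 v1; lra.
- by clear -tl v3 pv v0; lra.
- have h : eps * x ^+ 2 <= 10 * x ^- 3 * (p * x / 40) * x ^+ 2.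
    rewrite epsE; apply: ler_wpM2r; first exact: sqr_ge0.
    by apply: ler_wpM2r tl; rewrite divr_ge0 ?ler0n// mulr_ge0// ltW.
  apply: le_trans h _; rewrite le_eqVlt; apply/orP; left; apply/eqP.
  by field; rewrite gt_eqF.
- by clear -v3 pv v0; lra.
Qed.

Lemma ler_sqr_pos (R : realType) (a b : R) : 0 <= b -> a * a <= b * b -> a <= b.
Proof.
move=> b0 h; rewrite leNgt; apply/negP => ba; move: h; apply/negP; rewrite -ltNge.
by apply: ltr_pM.
Qed.

Lemma good_weight_bounds (R : realType) (p t eps x w : R) :
  0 < p -> p <= 4^-1 -> 160 <= x -> 40 <= p * x -> 0 < t -> t <= 10 * x ^- 3 ->
  eps = t * (p * x / 40) -> good_weight p t x w ->
  [/\ 0 < w, w * eps * x <= 4 / 5 * p & t * w <= 800^-1].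
Proof.
move=> p0 p4 x160 px t0 tl epsE [w128 wwt].
have [_ _ ex2 _] := hard_params p0 p4 x160 px t0 tl epsE.
have x0 : 0 < x by apply: lt_le_trans x160; rewrite ltr0n.
have w0 : 0 < w by apply: lt_le_trans w128; rewrite divr_gt0// ltr0n.
have e0 : 0 < eps by rewrite epsE mulr_gt0// divr_gt0 ?ltr0n// mulr_gt0.
split => //.
  apply: ler_sqr_pos; first by rewrite mulr_ge0 ?divr_ge0 ?ler0n ?(ltW p0).
  have -> : w * eps * x * (w * eps * x) = (w * w * t) * ((p * x / 40) * (eps * x ^+ 2)).
    by rewrite {2}epsE; ring.
  have h1 : 0 <= p * x / 40 by rewrite divr_ge0 ?ler0n// mulr_ge0// ltW.
  have h2 := ler_wpM2l h1 ex2.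
  have h3 : 0 <= p * x / 40 * (eps * x ^+ 2) by rewrite mulr_ge0// mulr_ge0 ?sqr_ge0// ltW.
  have h4 : 0 <= w * w * t by rewrite !mulr_ge0// ltW.
  apply: le_trans (ler_pM h4 h3 wwt h2) _.
  have -> : 62 * (3 / (2 * x)) * (p * x / 40 * (p / 4)) = 93 / 160 * (p * p).
    by field; rewrite gt_eqF.
  have := mulr_ge0 (ltW p0) (ltW p0); clear; lra.
apply: ler_sqr_pos; first by rewrite invr_ge0 ler0n.
have -> : t * w * (t * w) = t * (w * w * t) by ring.
have h4 : 0 <= w * w * t by rewrite !mulr_ge0// ltW.
apply: le_trans (ler_pM (ltW t0) h4 tl wwt) _.
have v0 : 0 < x^-1 by rewrite invr_gt0.
have v1 : x^-1 <= 160^-1 by rewrite lef_pV2// posrE ltr0n.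
have -> : 10 * x ^- 3 * (62 * (3 / (2 * x))) = 930 * ((x^-1 * x^-1) * (x^-1 * x^-1)).
  by field; rewrite gt_eqF.
have v2 : x^-1 * x^-1 <= 160^-1 * 160^-1 by apply: ler_pM => //; exact: ltW.
have v20 : 0 <= x^-1 * x^-1 by rewrite mulr_ge0// ltW.
have := ler_pM v20 v20 v2 v2; clear; lra.
Qed.

(** At [w = 4 / p] the increments [p * w / 16] and [1 / 4] coincide, so each phase of the growth
    obeys both bounds. *)
Lemma next_weight_growth (R : realType) (p t x w : R) :
  0 < p -> p <= 4^-1 -> 0 < w ->
  [/\ w <= next_weight p t x w, next_weight p t x w <= (1 + p / 16) * w &
      next_weight p t x w <= w + 4^-1].
Proof.
move=> p0 p4 w0; rewrite /next_weight.
have pw : 0 < p * w by rewrite mulr_gt0.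
have pp : p * (p * w) <= 4^-1 * (p * w) by rewrite ler_pM2r.
have pp0 : 0 <= p * (p * w) by rewrite mulr_ge0// ltW.
have E : w * (1 + p / 36) ^+ 2 = w + 18^-1 * (p * w) + 1296^-1 * (p * (p * w)) by field.
case: ifP => _; last by split; [clear|clear -pw|clear]; lra.
case: ifP => [w4|/negbT].
  have pw4 : p * w <= 4 by rewrite mulrC -ler_pdivlMr// ltW.
  by rewrite E; split; clear -pw pp pp0 pw4; lra.
rewrite -leNgt ler_pdivrMr// => pw4.
by split; clear -pw4; lra.
Qed.

Lemma next_weight_good (R : realType) (p t x w : R) :
  0 < p -> p <= 4^-1 -> 160 <= x -> 0 < t ->
  good_weight p t x w -> good_weight p t x (next_weight p t x w).
Proof.
move=> p0 p4 x160 t0 [w128 wwt].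
have w0 : 0 < w by apply: lt_le_trans w128; rewrite divr_gt0// ltr0n.
have [g1 g2 g3] := next_weight_growth t x p0 p4 w0.
split; first exact: le_trans g1.
have x0 : 0 < x by apply: lt_le_trans x160; rewrite ltr0n.
have [h|h] := ltP (w * w * t) (60 * (3 / (2 * x))); last first.
  by rewrite /next_weight ltNge h.
set w' := next_weight p t x w in g1 g2 *.
have w'0 : 0 <= w' := le_trans (ltW w0) g1.
have h1 : w' <= 65 / 64 * w.
  by apply: le_trans g2 _; rewrite ler_pM2r//; clear -p4; lra.
have h2 := ler_pM w'0 w'0 h1 h1.
have h3 := ler_wpM2r (ltW t0) h2.
apply: le_trans h3 _.
have y0 : 0 < 3 / (2 * x) by rewrite divr_gt0 ?mulr_gt0 ?ltr0n.
have -> : 65 / 64 * w * (65 / 64 * w) * t = 4225 / 4096 * (w * w * t) by field.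
by clear -h y0; move: (3 / _) (w * w * t) h y0 => y z h y0; lra.
Qed.

Lemma weight_conditions (R : realType) (p t eps x w k : R) :
  0 < p -> p <= 4^-1 -> 160 <= x -> 40 <= p * x -> 0 < t -> t <= 10 * x ^- 3 ->
  eps = t * (p * x / 40) -> good_weight p t x w -> k * (1 - t / 2) = 1 ->
  let w' := next_weight p t x w in
  [/\ [/\ w <= k * w', k * w' <= (1 + 3 / 40 * p) * w & k * w' - w <= 255 / 1000],
      [/\ w * w <= k * (w' * w'), k * (w' * w') <= (1 + 3 / 20 * p) * (w * w) &
          k * (w' * w') - w * w <= 53 / 100 * w],
      [/\ w * eps <= p / 200, w * eps ^+ 2 <= t / 500 & w * eps ^+ 2 <= p / 4000] &
      (14 * w + 3 * (w * w)) * eps ^+ 2 <= p / (50 * 1000)].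
Proof.
move=> p0 p4 x160 px t0 tl epsE gw kE; cbv zeta; set w' := next_weight p t x w.
have [w0 wex tw] := good_weight_bounds p0 p4 x160 px t0 tl epsE gw.
have [_ tp ex2 _] := hard_params p0 p4 x160 px t0 tl epsE.
have tp' : t <= p / 100 by clear -tp p0; lra.
have [_ k0 k1 kp] := contraction_inverse p0 p4 t0 tp' kE.
have [g1 g2 g3] := next_weight_growth t x p0 p4 w0; rewrite -/w' in g1 g2 g3.
have x0 : 0 < x by apply: lt_le_trans x160; rewrite ltr0n.
have e0 : 0 < eps by rewrite epsE mulr_gt0// divr_gt0 ?ltr0n// mulr_gt0.
have w'0 : 0 <= w' := le_trans (ltW w0) g1.
have kt : k <= 1 + t.
  have h : k <= 2 by clear -kp p4; lra.
  have := ler_wpM2r (ltW t0) h; clear -kE; lra.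
have pw : 0 < p * w by rewrite mulr_gt0.
have ww : 0 <= w * w by rewrite mulr_ge0// ltW.
have pww : 0 <= p * (w * w) by rewrite mulr_ge0// ltW.
have kw : k * w' <= w' + t * w'.
  by have := ler_wpM2r w'0 kt; rewrite mulrDl mul1r.
have tw' : t * w' <= 65 / 64 * (t * w).
  have h1 : w' <= 65 / 64 * w.
    by apply: le_trans g2 _; rewrite ler_pM2r//; clear -p4; lra.
  by have := ler_wpM2l (ltW t0) h1; clear; lra.
have tpw : t * w <= p / 1000 * w by rewrite ler_pM2r.
have w'w : 0 <= w' - w by rewrite subr_ge0.
have d1 : w' - w <= p / 16 * w by clear -g2; lra.
have d2 : w' - w <= 4^-1 by clear -g3; lra.
have pp : p * w <= 4^-1 * w by rewrite ler_pM2r.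
have d3 : w' - w <= 64^-1 * w by clear -d1 pp; lra.
have s1 : w' * w' - w * w = 2 * (w * (w' - w)) + (w' - w) * (w' - w) by ring.
have s2 : (w' - w) * (w' - w) <= 4^-1 * (64^-1 * w) by apply: ler_pM.
have s3 : (w' - w) * (w' - w) <= 64^-1 * w * (p / 16 * w) by apply: ler_pM.
have s4 : w * (w' - w) <= w * 4^-1 by rewrite ler_pM2l.
have s5 : w * (w' - w) <= w * (p / 16 * w) by rewrite ler_pM2l.
have s6 : 0 <= w * (w' - w) by rewrite mulr_ge0// ltW.
have s7 : 0 <= (w' - w) * (w' - w) by rewrite mulr_ge0.
have kww : k * (w' * w') <= w' * w' + t * (w' * w').
  by have := ler_wpM2r (mulr_ge0 w'0 w'0) kt; rewrite mulrDl mul1r.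
have tww' : t * (w' * w') <= 11 / 10 * (t * w * w).
  have h1 : w' * w' <= 11 / 10 * (w * w).
    clear -s1 s3 s5 pww p4 ww; have := ler_wpM2r ww p4; lra.
  by have := ler_wpM2l (ltW t0) h1; clear; lra.
have tww : t * w * w <= 800^-1 * w by rewrite ler_pM2r.
have tpww : t * w * w <= p / 1000 * (w * w) by rewrite -mulrA ler_wpM2r.
have kw0 : w' <= k * w' by rewrite ler_peMl.
have kww0 : w' * w' <= k * (w' * w') by rewrite ler_peMl// mulr_ge0.
have we0 : 0 < w * eps by rewrite mulr_gt0.
have we : w * eps <= p / 200.
  have h := ler_wpM2l (ltW we0) x160; clear -h wex; lra.
have xx : 160 * 160 <= x ^+ 2 by rewrite expr2 ler_pM// ler0n.
have e1 : eps <= p / 4 / (160 * 160).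
  have c0 : 0 < 160 * 160 :> R by apply: mulr_gt0; rewrite ltr0n.
  rewrite ler_pdivlMr//; apply: le_trans ex2; rewrite ler_pM2l//.
have wee : w * eps ^+ 2 = w * eps * eps by rewrite expr2 mulrA.
split.
- by split; clear -g1 g2 g3 kw tw tw' tpw kw0 pw w0; lra.
- by split; clear -s1 s2 s3 s4 s5 s6 s7 kww kww0 tww tww' tpww pww w0 pw ww; [lra|lra|lra].
- split; first exact: we.
    have -> : w * eps ^+ 2 = w * eps * x * (t * (p / 40)).
      by rewrite wee {2}epsE; ring.
    have h0 : 0 <= t * (p / 40) by rewrite mulr_ge0 ?divr_ge0 ?ler0n// ltW.
    have := ler_wpM2r h0 wex.
    have h1 : t * (p * p) <= t * (4^-1 * 4^-1).
      by rewrite ler_pM2l// ler_pM// ltW.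
    clear -h1 t0; lra.
  rewrite wee; have := ler_pM (ltW we0) (ltW e0) we e1.
  have h1 : p * p <= 4^-1 * p by rewrite ler_pM2r.
  clear -h1 p0; lra.
have q1 : w * w * eps ^+ 2 <= (p / 200) * (p / 200).
  have -> : w * w * eps ^+ 2 = (w * eps) * (w * eps) by ring.
  by apply: ler_pM => //; exact: ltW.
have q2 := ler_pM (ltW we0) (ltW e0) we e1; rewrite -wee in q2.
have h1 : p * p <= 4^-1 * p by rewrite ler_pM2r.
have -> : (14 * w + 3 * (w * w)) * eps ^+ 2 = 14 * (w * eps ^+ 2) + 3 * (w * w * eps ^+ 2).
  by ring.
clear -q1 q2 h1 p0; lra.
Qed.

Lemma value_weight_bounds (R : realType) (p t x w : R) :
  0 < p -> p <= 4^-1 -> 160 <= x -> 40 <= p * x -> good_weight p t x w ->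
  1 <= value_weight p x w /\ value_weight p x w <= 112 / 100.
Proof.
move=> p0 p4 x160 px [w128 _].
have x0 : 0 < x by apply: lt_le_trans x160; rewrite ltr0n.
have w0 : 0 < w by apply: lt_le_trans w128; rewrite divr_gt0// ltr0n.
have v0 : 0 < x^-1 by rewrite invr_gt0.
have v1 : x^-1 <= 160^-1 by rewrite lef_pV2// posrE ltr0n.
have e0 : 0 <= 77 * (3 / (2 * x)) by rewrite mulr_ge0 ?divr_ge0 ?mulr_ge0 ?ler0n// ltW.
have m0 : 0 <= Num.min (w^-1) (p / 4).
  by rewrite le_min invr_ge0 (ltW w0) divr_ge0 ?ler0n// ltW.
have r0 : 0 < Num.sqrt p by rewrite sqrtr_gt0.
have s0 : 0 < Num.sqrt w by rewrite sqrtr_gt0.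
have c0 : 0 <= 1400 * x ^- 3 / (p * Num.sqrt p).
  by rewrite divr_ge0 ?mulr_ge0 ?invr_ge0 ?exprn_ge0 ?ler0n// ltW.
rewrite /value_weight; split.
  rewrite -addrA lerDl; apply: addr_ge0; first exact: mulr_ge0 e0 m0.
  by apply: (mulr_ge0 c0); rewrite invr_ge0; exact: ltW.
have a1 : 77 * (3 / (2 * x)) * Num.min (w^-1) (p / 4) <= 46 / 1000.
  have b1 : Num.min (w^-1) (p / 4) <= 16^-1.
    by rewrite ge_min; apply/orP; right; clear -p4; lra.
  have b2 : 77 * (3 / (2 * x)) <= 77 * (3 / 2 * 160^-1).
    have -> : 3 / (2 * x) = 3 / 2 * x^-1 by rewrite invfM mulrA.
    clear -v1; lra.
  have := ler_pM e0 m0 b2 b1; clear; lra.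
(* [p / 128] is relaxed to [p / 144], whose square root is explicit. *)
have sr : Num.sqrt p / 12 <= Num.sqrt w.
  have -> : Num.sqrt p / 12 = Num.sqrt (p / 144).
    rewrite sqrtrM ?(ltW p0)//; congr (_ * _).
    have -> : 144^-1 = (12^-1) ^+ 2 :> R by field.
    by rewrite sqrtr_sqr ger0_norm// invr_ge0 ler0n.
  by rewrite ler_sqrt//; apply: le_trans w128; clear -p0; lra.
have a2 : 1400 * x ^- 3 / (p * Num.sqrt p) / Num.sqrt w <= 66 / 1000.
  apply: (@le_trans _ _ (1400 * x ^- 3 / (p * Num.sqrt p) / (Num.sqrt p / 12))).
    apply: (ler_wpM2l c0); rewrite lef_pV2 ?posrE//; apply: divr_gt0 => //; exact: ltr0n.
  have pp : Num.sqrt p * Num.sqrt p = p by rewrite -expr2 sqr_sqrtr// ltW.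
  have -> : 1400 * x ^- 3 / (p * Num.sqrt p) / (Num.sqrt p / 12) =
      1400 * 12 * x^-1 * ((p * x)^-1 * (p * x)^-1).
    have -> : 1400 * x ^- 3 / (p * Num.sqrt p) / (Num.sqrt p / 12) =
       1400 * 12 * x ^- 3 / (p * (Num.sqrt p * Num.sqrt p)).
      by field; rewrite !gt_eqF.
    by rewrite pp; field; rewrite !gt_eqF.
  have u0 : 0 < (p * x)^-1 by rewrite invr_gt0 mulr_gt0.
  have u1 : (p * x)^-1 <= 40^-1 by rewrite lef_pV2 ?posrE ?mulr_gt0 ?ltr0n.
  have u2 : (p * x)^-1 * (p * x)^-1 <= 40^-1 * 40^-1 by apply: ler_pM => //; exact: ltW.
  have u20 : 0 <= (p * x)^-1 * (p * x)^-1 by rewrite mulr_ge0// ltW.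
  have := ler_pM (ltW v0) u20 v1 u2; clear; lra.
by clear -a1 a2; lra.
Qed.

(** [tau] must be small enough to be financed and large enough that [2 / tau * rr] is absorbed.
    While [w] grows geometrically, [rr] is bounded by the contraction of the inner loop; afterwards
    by its alignment, which is useful because [w^2 * q] is then large. *)
Lemma value_weight_step (R : realType) (p t eps x w k lam : R) :
  0 < p -> p <= 4^-1 -> 160 <= x -> 40 <= p * x -> 0 < t -> t <= 10 * x ^- 3 ->
  eps = t * (p * x / 40) -> good_weight p t x w -> k * (1 - t / 2) = 1 ->
  lam ^+ 2 <= x ^- 3 ->
  let B := value_weight p x w in let B' := value_weight p x (next_weight p t x w) in
  exists tau, [/\ 0 < tau, tau <= 1, B' <= B,
    102 / 100 * (k * B' * tau) <= B - B' + 36 / 100 * t &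
    forall s q N1 rr r2, 0 <= s -> 0 <= N1 -> N1 <= q -> 0 <= rr -> rr <= 4 * (x ^- 3 * s) ->
      rr <= 2 * r2 + 2 * (lam ^+ 2 * N1) ->
      r2 <= 3 / (2 * x) * q + 3206 * (eps ^+ 2 * s) ->
      k * B' * (2 / tau * rr) <= 6 / 10 * s + 3 / 10 * (w * w * q)].
Proof.
move=> p0 p4 x160 px t0 tl epsE gw kE lth; cbv zeta.
have gw' := next_weight_good p0 p4 x160 t0 gw.
have [B1 _] := value_weight_bounds p0 p4 x160 px gw.
have [B1' B2'] := value_weight_bounds p0 p4 x160 px gw'.
have [w0 wex tw] := good_weight_bounds p0 p4 x160 px t0 tl epsE gw.
have [_ tp ex2 _] := hard_params p0 p4 x160 px t0 tl epsE.
have tp' : t <= p / 100 by clear -tp p0; lra.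
have [_ k0 k1 _] := contraction_inverse p0 p4 t0 tp' kE.
have kB : k * value_weight p x (next_weight p t x w) <= 113 / 100.
  have t4 : t <= 4000^-1 by clear -tp p4; lra.
  have k2 : k <= 1001 / 1000.
    have h : 3999 / 4000 * k <= 1.
      have t4' : 3999 / 4000 <= 1 - t / 2 by clear -t4; lra.
      by have := ler_wpM2l (ltW k0) t4'; rewrite kE mulrC.
    by clear -h; lra.
  have := ler_pM (ltW k0) (le_trans ler01 B1') k2 B2'; clear; lra.
have kB0 : 0 <= k * value_weight p x (next_weight p t x w).
  by rewrite mulr_ge0 ?(ltW k0)// (le_trans ler01).
set kb := k * value_weight p x _ in kB kB0 *.
have x0 : 0 < x by apply: lt_le_trans x160; rewrite ltr0n.
have e0 : 0 < eps by rewrite epsE mulr_gt0// divr_gt0 ?ltr0n// mulr_gt0.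
have th0 : 0 < x ^- 3 by rewrite invr_gt0 exprn_gt0.
have et0 : 0 < 3 / (2 * x) by rewrite divr_gt0 ?mulr_gt0 ?ltr0n.
have eeE : eps ^+ 2 = t * (eps * (p * x / 40)) by rewrite expr2 {1}epsE; ring.
have v0 : 0 < x^-1 by rewrite invr_gt0.
have v1 : x^-1 <= 160^-1 by rewrite lef_pV2// posrE ltr0n.
have pp : p * p <= 4^-1 * 4^-1 by apply: ler_pM => //; exact: ltW.
have ee : eps * (p * x / 40) <= (16 * 160 * 160)^-1.
  have -> : eps * (p * x / 40) = eps * x ^+ 2 * (p / 40 * x^-1) by field; rewrite gt_eqF.
  have h1 : p / 40 * x^-1 <= p / 40 * 160^-1 by rewrite ler_pM2l// divr_gt0 ?ltr0n.
  have h2 : 0 <= eps * x ^+ 2 by rewrite mulr_ge0 ?sqr_ge0// ltW.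
  have h3 : 0 <= p / 40 * x^-1 by rewrite mulr_ge0 ?divr_ge0 ?ler0n// ltW.
  have := ler_pM h2 h3 ex2 h1; clear -pp; lra.
have v2 : x^-1 * x^-1 <= 160^-1 * 160^-1 by apply: ler_pM => //; exact: ltW.
have thet : x ^- 3 <= 3 / (2 * x) / 1000.
  have -> : x ^- 3 = x^-1 * (x^-1 * x^-1) by rewrite -exprVn !exprS expr0 mulr1.
  have -> : 3 / (2 * x) = 3 / 2 * x^-1 by rewrite invfM mulrA.
  have := ler_wpM2l (ltW v0) v2; clear -v0; lra.
have [th1 _ _ _] := hard_params p0 p4 x160 px t0 tl epsE.
have wwt : w * w * t <= 62 * (3 / (2 * x)) by case: gw.
have ww0 : 0 < w * w by rewrite mulr_gt0.
set B := value_weight p x w in B1 *; set B' := value_weight p x _ in B1' B2' kb kB kB0 *.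
have dropE (tau d : R) : 0 <= d -> d <= B - B' -> 0 <= tau -> 116 / 100 * tau <= d ->
    102 / 100 * (kb * tau) <= B - B' + 36 / 100 * t.
  move=> d0 dB tau0 td; have := ler_wpM2r tau0 kB; clear -dB td t0 d0 tau0; lra.
have errE (q N1 rr r2 s c : R) : 0 <= s -> 0 <= N1 -> N1 <= q -> 0 <= c ->
    c * (3 / (2 * x)) <= w * w / 8 -> c * eps ^+ 2 <= 1 / (42 * 1000) ->
    rr <= 2 * r2 + 2 * (lam ^+ 2 * N1) ->
    r2 <= 3 / (2 * x) * q + 3206 * (eps ^+ 2 * s) ->
    kb * (c * rr) <= 6 / 10 * s + 3 / 10 * (w * w * q).
  move=> s0 N0 Nq c0 cet cee hrr hr2.
  have q0 := le_trans N0 Nq.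
  have l1 : lam ^+ 2 * N1 <= 3 / (2 * x) / 1000 * q.
    by apply: ler_pM => //; [exact: sqr_ge0 | exact: le_trans thet].
  have h1 : rr <= 2002 / 1000 * (3 / (2 * x) * q) + 6412 * (eps ^+ 2 * s).
    clear -hrr hr2 l1; lra.
  have h2 := ler_wpM2l c0 h1.
  have h3 := ler_wpM2r q0 cet; have h4 := ler_wpM2r s0 cee.
  have h5 : c * rr <= 2002 / 1000 * (w * w / 8 * q) + 6412 / (42 * 1000) * s.
    clear -h2 h3 h4; lra.
  have h6 : 0 <= 2002 / 1000 * (w * w / 8 * q) + 6412 / (42 * 1000) * s.
    have a0 := mulr_ge0 (ltW ww0) q0; clear -a0 s0; lra.
  have h7 := ler_wpM2l kB0 h5; have h8 := ler_wpM2r h6 kB.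
  have a0 := mulr_ge0 (ltW ww0) q0; clear -h7 h8 a0 s0; lra.
have pw2 : 0 < Num.sqrt p by rewrite sqrtr_gt0.
have sw0 : 0 < Num.sqrt w by rewrite sqrtr_gt0.
have [g1 g2 g3] := next_weight_growth t x p0 p4 w0.
(* Once the weight has stopped, [B' = B] and [tau] is financed by the contraction itself, through
   [36 / 100 * t]. *)
have [grow|ngrow] := ltP (w * w * t) (60 * (3 / (2 * x))); last first.
  have w'E : next_weight p t x w = w by rewrite /next_weight ltNge ngrow.
  have BE : B' = B by rewrite /B' w'E.
  exists (3 / 10 * t); split.
  - by apply: mulr_gt0 => //; clear; lra.
  - by clear -tp' p4; lra.
  - by rewrite BE.
  - rewrite BE subrr add0r -/kb.
    have h := ler_wpM2r (ltW t0) kB; clear -h t0; lra.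
  move=> s q N1 rr r2 s0 N0 Nq rr0 _ hrr hr2.
  apply: (errE q N1 rr r2 s (2 / (3 / 10 * t)) s0 N0 Nq _ _ _ hrr hr2).
  - by rewrite divr_ge0 ?ler0n// mulr_ge0 ?divr_ge0 ?ler0n// ltW.
  - have -> : 2 / (3 / 10 * t) * (3 / (2 * x)) = 60 * (3 / (2 * x)) * (9 * t)^-1.
      by field; rewrite !gt_eqF.
    rewrite ler_pdivrMr ?mulr_gt0 ?ltr0n//; apply: le_trans ngrow _.
    have a0 := mulr_gt0 ww0 t0; clear -a0; lra.
  - have -> : 2 / (3 / 10 * t) * eps ^+ 2 = 20 / 3 * (eps * (p * x / 40)).
      by rewrite eeE; field; rewrite !gt_eqF.
    clear -ee; lra.
set w' := next_weight p t x w in g1 g2 g3.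
have w'0 : 0 < w' := lt_le_trans w0 g1.
have sw'0 : 0 < Num.sqrt w' by rewrite sqrtr_gt0.
have e77 : 0 <= 77 * (3 / (2 * x)) by apply: mulr_ge0 (ltW et0); exact: ler0n.
have c0 : 0 <= 1400 * x ^- 3 / (p * Num.sqrt p).
  apply: mulr_ge0; first by apply: mulr_ge0 (ltW th0); exact: ler0n.
  by rewrite invr_ge0; apply: ltW; exact: mulr_gt0.
have BB : B - B' = 77 * (3 / (2 * x)) * (Num.min (w^-1) (p / 4) - Num.min (w'^-1) (p / 4))
    + 1400 * x ^- 3 / (p * Num.sqrt p) * ((Num.sqrt w)^-1 - (Num.sqrt w')^-1).
  rewrite /B /B' /value_weight -/w'; move: (77 * _) (1400 * _ / _) => a b.
  move: (Num.min w^-1 _) (Num.min w'^-1 _) ((Num.sqrt w)^-1) ((Num.sqrt w')^-1) => m1 m2 v1' v2'.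
  by ring.
have [w4|w4] := ltP w (4 / p).
  have w'E : w' = w * (1 + p / 36) ^+ 2 by rewrite /w' /next_weight grow w4.
  have u0 : 0 < 1 + p / 36 by clear -p0; lra.
  (* The growth factor is a square, so that the decrease of the third term of [value_weight] is
     explicit. As [p * w] is at most 4, it is at least [1400 / (725 / 10)] times [x^-3], which
     finances [16 * x^-3]. *)
  have sE : Num.sqrt w' = Num.sqrt w * (1 + p / 36).
    by rewrite w'E sqrtrM ?(ltW w0)// sqrtr_sqr ger0_norm// ltW.
  have hm : Num.min (w'^-1) (p / 4) <= Num.min (w^-1) (p / 4).
    by rewrite le_min !ge_min lexx orbT andbT lef_pV2// g1.
  have D0 : 0 < 36 * (Num.sqrt p * Num.sqrt w * (1 + p / 36)).
    by apply: mulr_gt0; [rewrite ltr0n | do 2?apply: mulr_gt0].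
  have rv : Num.sqrt p * Num.sqrt w <= 2.
    rewrite -sqrtrM ?(ltW p0)//.
    have h : p * w <= 2 ^+ 2 by move: w4; rewrite ltr_pdivlMr// mulrC => /ltW; clear; lra.
    by apply: le_trans (ler_wsqrtr h) _; rewrite sqrtr_sqr ger0_norm// ler0n.
  have hd : 193 / 10 * x ^- 3 <= B - B'.
    rewrite BB; apply: (@le_trans _ _ (1400 * x ^- 3 / (p * Num.sqrt p) *
       ((Num.sqrt w)^-1 - (Num.sqrt w')^-1))); last first.
      by rewrite lerDr; apply: (mulr_ge0 e77); rewrite subr_ge0.
    have -> : 1400 * x ^- 3 / (p * Num.sqrt p) * ((Num.sqrt w)^-1 - (Num.sqrt w')^-1) =
        1400 * x ^- 3 / (36 * (Num.sqrt p * Num.sqrt w * (1 + p / 36))).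
      have -> : 36 * (Num.sqrt p * Num.sqrt w * (1 + p / 36)) =
          Num.sqrt p * Num.sqrt w * (36 + p) by field.
      have u36 : 0 < 36 + p by clear -p0; lra.
      rewrite sE; move: (x ^- 3) => y; field.
      by rewrite !gt_eqF.
    rewrite ler_pdivlMr//.
    have h : 36 * (Num.sqrt p * Num.sqrt w * (1 + p / 36)) <= 725 / 10.
      have := ler_pM (ltW (mulr_gt0 pw2 sw0)) (ltW u0) rv (lexx _); clear -p4; lra.
    have := ler_wpM2l (ltW th0) h; clear -th0; lra.
  exists (16 * x ^- 3); split.
  - by apply: mulr_gt0 th0; rewrite ltr0n.
  - by clear -th1; lra.
  - by rewrite -subr_ge0; apply: le_trans hd; clear -th0; lra.
  - apply: (dropE _ (193 / 10 * x ^- 3)) => //; clear -th0; lra.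
  move=> s q N1 rr r2 s0 N0 Nq rr0 hrr _ _.
  have q0 := le_trans N0 Nq.
  have h1 : 2 / (16 * x ^- 3) * rr <= 2^-1 * s.
    have -> : 2 / (16 * x ^- 3) * rr = rr / (8 * x ^- 3) by field; rewrite gt_eqF.
    rewrite ler_pdivrMr; first by clear -hrr; lra.
    by apply: mulr_gt0 th0; rewrite ltr0n.
  have h2 := ler_wpM2l kB0 h1; have h3 := ler_wpM2r s0 kB.
  have a0 := mulr_ge0 (ltW ww0) q0; clear -h2 h3 a0 s0; lra.
(* In the linear phase the minimum in [value_weight] is [1 / w], and its decrease [1 / (4 * w * w')]
   matches the accuracy of the alignment divided by [w^2]. *)
have w'E : w' = w + 4^-1 by rewrite /w' /next_weight grow ltNge w4.
have pw4 : 4 <= w * p by move: w4; rewrite ler_pdivrMr.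
have i1 (v : R) : w <= v -> Num.min (v^-1) (p / 4) = v^-1.
  move=> wv; have v0' : 0 < v := lt_le_trans w0 wv.
  apply: min_idPl; rewrite -(@ler_pM2l _ v)// divff ?gt_eqF//.
  by have := ler_wpM2r (ltW p0) wv; clear -pw4; lra.
have w16 : 16 <= w.
  have := ler_wpM2l (ltW w0) p4; clear -pw4; lra.
have hd : 77 * (3 / (2 * x)) / (4 * (w * w')) <= B - B'.
  rewrite BB !i1//; apply: (@le_trans _ _ (77 * (3 / (2 * x)) * (w^-1 - w'^-1))).
    have -> : w^-1 - w'^-1 = (4 * (w * w'))^-1.
      have w41 : 0 < 4 * w + 1 by clear -w0; lra.
      by rewrite w'E; field; rewrite !gt_eqF//; clear -w0; lra.
    exact: lexx.
  rewrite lerDl; apply: (mulr_ge0 c0).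
  by rewrite subr_ge0 lef_pV2 ?posrE// ler_wsqrtr.
have hd0 : 189 / 10 * ((3 / (2 * x)) / (w * w)) <= 77 * (3 / (2 * x)) / (4 * (w * w')).
  rewrite ler_pdivlMr; last by apply: mulr_gt0; [rewrite ltr0n | exact: mulr_gt0].
  have -> : 189 / 10 * ((3 / (2 * x)) / (w * w)) * (4 * (w * w')) =
     (3 / (2 * x)) * (756 / 10 * (w' / w)).
    move: (3 / _) => y; field; rewrite gt_eqF//.
  rewrite [leRHS]mulrC; apply: (ler_wpM2l (ltW et0)).
  have h : w' / w <= 65 / 64.
    by rewrite ler_pdivrMr// w'E; clear -w16; lra.
  clear -h; lra.
have tau0 : 0 < 3 / (2 * x) / (w * w) by rewrite divr_gt0.
exists (16 * (3 / (2 * x) / (w * w))); split.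
- by apply: mulr_gt0 tau0; rewrite ltr0n.
- have h : 16 * 16 <= w * w by apply: ler_pM => //; exact: ler0n.
  have h2 : 3 / (2 * x) / (w * w) <= 16^-1.
    rewrite ler_pdivrMr//; apply: (@le_trans _ _ (16^-1 * (16 * 16))).
      have -> : 3 / (2 * x) = 3 / 2 * x^-1 by rewrite invfM mulrA.
      clear -v1; lra.
    by rewrite ler_pM2l// invr_gt0 ltr0n.
  clear -h2; lra.
- rewrite -subr_ge0; apply: le_trans hd; apply: le_trans hd0.
  by apply: mulr_ge0 (ltW tau0); rewrite divr_ge0 ?ler0n.
- apply: (dropE _ (77 * (3 / (2 * x)) / (4 * (w * w')))) => //.
  + apply: mulr_ge0 e77 _; rewrite invr_ge0; apply: ltW; apply: mulr_gt0; first by rewrite ltr0n.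
    exact: mulr_gt0.
  + by apply: mulr_ge0 (ltW tau0); exact: ler0n.
  + by apply: le_trans hd0; clear -tau0; lra.
move=> s q N1 rr r2 s0 N0 Nq rr0 _ hrr hr2.
apply: (errE q N1 rr r2 s (2 / (16 * (3 / (2 * x) / (w * w)))) s0 N0 Nq _ _ _ hrr hr2).
- apply: mulr_ge0; first exact: ler0n.
  by rewrite invr_ge0; apply: mulr_ge0 (ltW tau0); exact: ler0n.
- by move: et0; move: (3 / (2 * x)) => y y0; rewrite le_eqVlt; apply/orP; left; apply/eqP; field; rewrite !gt_eqF.
- have -> : 2 / (16 * (3 / (2 * x) / (w * w))) * eps ^+ 2 =
     (w * w * t) * ((eps * (p * x / 40)) / (8 * (3 / (2 * x)))).
    by rewrite eeE; move: et0; move: (3 / (2 * x)) => y y0; field; rewrite !gt_eqF.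
  have f0 : 0 <= (eps * (p * x / 40)) / (8 * (3 / (2 * x))).
    apply: divr_ge0; last by apply: mulr_ge0 (ltW et0); exact: ler0n.
    by apply: mulr_ge0 (ltW e0) _; rewrite divr_ge0 ?ler0n// mulr_ge0// ltW.
  have h1 := ler_wpM2r f0 wwt.
  have h2 : 62 * (3 / (2 * x)) * ((eps * (p * x / 40)) / (8 * (3 / (2 * x)))) =
     62 / 8 * (eps * (p * x / 40)).
    by move: et0; move: (3 / (2 * x)) => y y0; field; rewrite gt_eqF.
  rewrite h2 in h1; apply: le_trans h1 _; clear -ee; lra.
Qed.

(** * Convergence rate for small steps *)

Lemma eg_step_scale (R : realType) (d : nat) (Z : set 'rV[R]_d)
  (G G' : 'rV[R]_d -> 'rV[R]_d) (a b : R) :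
  (forall v, a *: G v = b *: G' v) -> eg_step Z G a =1 eg_step Z G' b.
Proof. by move=> h u; rewrite /eg_step !h. Qed.

Lemma dotv0r (R : realType) (d : nat) (u : 'rV[R]_d) : dotv u 0 = 0.
Proof. by rewrite dotvC dotv0l. Qed.

Lemma alignment_error_le (R : realType) (x : R) : 160 <= x -> 3 / (2 * x) <= 106^-1.
Proof.
move=> x160; have x0 : 0 < x by apply: lt_le_trans x160; rewrite ltr0n.
by rewrite ler_pdivrMr ?mulr_gt0 ?ltr0n//; lra.
Qed.

Lemma small_mul16 (R : realType) (a : R) : a <= 2000^-1 -> 16 * a <= 1.
Proof. by move=> h; lra. Qed.

Lemma double_sum_le (R : realType) (a b c d e : R) : a <= e -> b <= e ->
  c <= 2 * a + 2 * b -> c <= 4 * e.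
Proof. by move=> *; lra. Qed.

Lemma value_step_bound (R : realType) (p lam th phx rr s pr tD D A B W : R) :
  rr <= 2^-1 * s -> 0 <= s -> 0 <= pr -> 0 <= tD -> 0 <= p * A -> 0 <= p * B ->
  p * A + p * ((1 - lam) * B) <= p * W -> th * D <= p / 10000 * D ->
  p * D <= p * (A + 4^-1 * B) -> p * lam * A <= p * 2000^-1 * A ->
  p * lam * B <= p * 2000^-1 * B -> 0 <= phx ->
  (1 - lam) * ((1 - p) * A + p * B) + lam * A - 74 / 100 * s - 97 / 100 * pr - 17 / 10 * tD
  - 199 / 100 * phx + 101 / 100 * (16 * th * D) + rr <= (1 - 2 * p) * A + 103 / 100 * p * W.
Proof. by move=> *; lra. Qed.

Lemma start_bound (R : realType) (v a p : R) :
  v <= 112 / 100 * (2 * a) -> p * (p * a) <= p * (4^-1 * a) -> p * a <= 4^-1 * a ->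
  0 <= p * a -> 0 <= a ->
  v + p / 128 * (100^-1 * (p * a)) +
    (14 / 128 * (2 * (p * a) + a) + 3 / (128 * 128) * (2 * (p * (p * a)) + p * a)) <= 5 / 2 * a.
Proof. by move=> *; lra. Qed.

Section hard_regime_rate.
Variables (R : realType) (d n : nat) (Z : set 'rV[R]_d)
  (F : 'I_n.+1 -> 'rV[R]_d -> 'rV[R]_d) (L mu : R).
Hypotheses (Z_nonempty : Z !=set0) (Z_closed : closed Z)
  (Z_convex : @convex_set R 'rV[R]_d Z)
  (L_gt0 : 0 < L) (mu_gt0 : 0 < mu)
  (F_lipschitz : forall i u v, Z u -> Z v ->
    enorm (F i u - F i v) <= L * enorm (u - v))
  (F_strongly_monotone : forall u v, Z u -> Z v ->
    mu * enorm (u - v) ^+ 2 <= dotv (avg_op F u - avg_op F v) (u - v))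
  (F_monotone : forall i u v, Z u -> Z v -> 0 <= dotv (F i u - F i v) (u - v)).
Variable zstar : 'rV[R]_d.
Hypotheses (zstar_in : Z zstar)
  (zstar_sol : forall z, Z z -> 0 <= dotv (avg_op F zstar) (z - zstar)).
Variables (gamma eta p x : R) (H : nat).
Hypotheses (gamma_gt0 : 0 < gamma) (eta_gt0 : 0 < eta) (p_gt0 : 0 < p) (p_le : p <= 4^-1)
  (eta_L : eta * (L + gamma^-1) = 4^-1) (x_ge : 160 <= x) (px_ge : 40 <= p * x)
  (t_le : gamma * mu <= 10 * x ^- 3) (epsE : gamma * L = gamma * mu * (p * x / 40))
  (H_ge : 8 * ln x <= H%:R).

Let eps := gamma * L.
Let t := gamma * mu.
Let lam : R := (13 / 16) ^+ H.

Let t_gt0 : 0 < t. Proof. exact: mulr_gt0. Qed.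
Let eps_gt0 : 0 < eps. Proof. exact: mulr_gt0. Qed.
Let x_gt0 : 0 < x. Proof. by apply: lt_le_trans x_ge; rewrite ltr0n. Qed.
Let th_gt0 : 0 < x ^- 3. Proof. by rewrite invr_gt0 exprn_gt0. Qed.

Let lam_ge0 : 0 <= lam.
Proof. by apply: exprn_ge0; apply: divr_ge0; exact: ler0n. Qed.

Let lam_sqr : lam ^+ 2 <= x ^- 3.
Proof.
have [_ h _] := x_power_bounds x_ge H_ge; apply: le_trans h.
rewrite /lam -exprM mulnC exprM; have -> // : (13 / 16) ^+ 2 = 169 / 256 :> R by field.
Qed.

Let th_le : x ^- 3 <= 2000^-1 / 2000.
Proof. by have [] := hard_params p_gt0 p_le x_ge px_ge t_gt0 t_le epsE. Qed.

Let lam_le : lam <= 2000^-1.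
Proof.
apply: ler_sqr_pos; first by rewrite invr_ge0 ler0n.
by rewrite -expr2; apply: le_trans lam_sqr th_le.
Qed.

Let th_le1 : x ^- 3 <= 2000^-1.
Proof. by move: th_le; lra. Qed.

Let eps_sqr : eps ^+ 2 <= t * p / 4000 /\ eps ^+ 2 <= p / 4000.
Proof.
have [_ tp ex2 _] := hard_params p_gt0 p_le x_ge px_ge t_gt0 t_le epsE.
have e1 : eps * x <= p / 640.
  have h : eps * x * 160 <= eps * x * x by apply: ler_wpM2l => //; apply: ltW; exact: mulr_gt0.
  by move: h ex2; rewrite -/eps expr2 mulrA; move: (eps * x * x) => *; lra.
have E : eps ^+ 2 = t * (p / 40 * (eps * x)) by rewrite expr2 {1}/eps epsE -/t; ring.
have h1 : eps ^+ 2 <= t * (p / 40 * (p / 640)).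
  rewrite E; apply: (ler_wpM2l (ltW t_gt0)); apply: ler_wpM2l => //.
  by apply: divr_ge0 (ler0n _ _); exact: ltW.
have h2 : t * (p * p) <= t * (p * 4^-1).
  by apply: (ler_wpM2l (ltW t_gt0)); apply: ler_wpM2l p_le; exact: ltW.
have h3 : t * p <= p / 1000 * p by apply: ler_wpM2r tp; exact: ltW.
have h4 : p * p <= 4^-1 * p by apply: ler_wpM2r p_le; exact: ltW.
have tp0 := mulr_gt0 t_gt0 p_gt0.
split; first by lra.
by move: h1 h2 h3 h4 tp0 p_gt0; lra.
Qed.

Let Lg : L * gamma <= 16^-1.
Proof.
have [_ h] := eps_sqr; rewrite mulrC -/eps; apply: ler_sqr_pos; first by rewrite invr_ge0 ler0n.
rewrite -expr2; apply: le_trans h _; move: p_le; lra.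
Qed.

Let X_ex z m := inner_solution_exists Z_nonempty Z_closed Z_convex L_gt0 F_lipschitz F_monotone
  p gamma_gt0 z m.

Definition inner_point z m : 'rV[R]_d := xget zstar (inner_solution Z F gamma p z m).

Lemma inner_point_sol z m : inner_solution Z F gamma p z m (inner_point z m).
Proof. by apply: xgetPex; exact: X_ex. Qed.

Let X := inner_point.
Let X_sol := inner_point_sol.

(** Serves the fictitious round before the first one: from state and anchor [zstar] nothing moves,
    so the initial speed is zero. *)
Let X_zstar : X zstar zstar = zstar.
Proof.
have [Zx sol] := X_sol zstar zstar; rewrite -/X in Zx sol.
have h1 := sol _ zstar_in.
have h2 : 0 <= dotv (inner_op F gamma p zstar zstar zstar) (X zstar zstar - zstar).
  by rewrite /inner_op !subrr scaler0 subr0 scaler0 addr0 add0r; exact: zstar_sol.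
have h3 := inner_op_mono F_monotone gamma p zstar zstar Zx zstar_in.
have h4 : dotv (X zstar zstar - zstar) (X zstar zstar - zstar) <= 0.
  rewrite -(@ler_pM2l _ gamma^-1) ?invr_gt0// mulr0; apply: le_trans h3 _.
  rewrite -opprB (dotvNr (X zstar zstar - zstar)) in h1.
  rewrite (dotvDl (inner_op _ _ _ _ _ _)) dotvNl.
  by move: h1 h2; move: (dotv _ _) (dotv _ _) => a b; lra.
by apply/eqP; rewrite -subr_eq0; apply/eqP; exact: dotv_eq0 h4.
Qed.

Let Qv z m yt := dotv (inner_normal F gamma p X z m) (X z m - yt).

(** Multiplied by [gamma], the inner operator is the identity plus the small [A], up to a constant;
    the step becomes [rho = eta / gamma], with [rho * (1 + eps) = 1 / 4]. As [rho <= 1 / 4], the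
    scaled normal vector brings the divisor 4 in [alignment_rate]. *)
Let inner_loop_aligned z m yt : Z z -> Z m -> Z yt ->
  let u := inner_loop Z F gamma eta p H z m in
  let y' := X z m - lam *: (X z m - yt) in
  dotv (u - y') (u - y') <=
    3 / (2 * x) * (Qv z m yt + dotv (z - yt) (z - yt)) +
    3206 * (eps ^+ 2 * dotv (z - X z m) (z - X z m)).
Proof.
move=> Zz Zm Zy; cbv zeta.
pose A v := gamma *: F ord0 v; pose c := z + p *: (m - z) - gamma *: (avg_op F m - F ord0 m).
pose rho := eta / gamma.
have rho0 : 0 < rho by rewrite divr_gt0.
have g0 : gamma != 0 by rewrite gt_eqF.
have rho_eps : rho * (1 + eps) = 4^-1.
  by rewrite -eta_L /rho /eps; field.
have GE v : eta *: inner_op F gamma p z m v = rho *: (A v + v - c).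
  rewrite /A /c /inner_op /rho; move: (F ord0 v) (F ord0 m) (avg_op F m) => a1 a2 a3.
  by apply/rowP => j; rewrite !mxE; field.
have [Zx sol] := X_sol z m; rewrite -/X in Zx sol.
have e4 : eps <= 4^-1 by move: Lg; rewrite mulrC -/eps; lra.
have A_mono u v : Z u -> Z v -> 0 <= dotv (A u - A v) (u - v).
  move=> Zu Zv; rewrite /A -scalerBr dotvZl; apply: mulr_ge0; first exact: ltW.
  exact: F_monotone.
have A_lip u v : Z u -> Z v -> dotv (A u - A v) (A u - A v) <= eps ^+ 2 * dotv (u - v) (u - v).
  exact: (Av_lipschitz L_gt0 F_lipschitz gamma_gt0).
have x_sol y : Z y -> 0 <= dotv (A (X z m) + X z m - c) (y - X z m).
  move=> /sol h; rewrite -(pmulr_rge0 _ rho0) -dotvZl -GE dotvZl; apply: mulr_ge0 h.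
  exact: ltW.
have al := eg_alignment Z_nonempty Z_closed Z_convex (ltW eps_gt0) e4 rho0 rho_eps A_mono A_lip
  Zx x_sol Zy H Zz.
have -> : inner_loop Z F gamma eta p H z m = iter H (eg_step Z (fun u => A u + u - c) rho) z.
  rewrite /inner_loop; apply: eq_iter; exact: (eg_step_scale Z GE).
apply: le_trans al _.
have QE : dotv (rho *: (c - A (X z m) - X z m)) (X z m - yt) = rho * Qv z m yt.
  rewrite dotvZl /Qv /inner_normal; congr (_ * dotv _ _).
  rewrite /c /A; move: (F ord0 _) (avg_op F m - _) => a1 a2.
  by apply/rowP => j; rewrite !mxE; ring.
rewrite QE.
have Q0 : 0 <= Qv z m yt by exact: (inner_normal_ge0 gamma_gt0 X_sol).
have r4 : rho <= 4^-1.
  by rewrite -rho_eps mulrDr mulr1 lerDl; exact: (mulr_ge0 (ltW rho0) (ltW eps_gt0)).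
have rate := alignment_rate x_ge H_ge.
have k0 : 0 <= (671 / 1000) ^+ H./2 :> R by apply: exprn_ge0; apply: divr_ge0; exact: ler0n.
have [_ _ H40] := x_power_bounds x_ge H_ge.
have H20 : 20 <= H./2%:R :> R by rewrite ler_nat; exact: (half_leq H40).
rewrite lerD2r.
have N0 := dotv_ge0 (z - yt).
move: Q0 N0 k0 rate H20; move: (Qv z m yt) (dotv (z - yt) _) (_ ^+ H./2) (H./2%:R) (3 / (2 * x)).
move=> Q N1 k j et Q0 N0 k0 rate j20.
have a1 : 11 / 10 * k <= et.
  apply: le_trans rate; rewrite mulrC; apply: (ler_wpM2l k0); lra.
have a2 : (492 / 100 * j + 22 / 10) * (rho * Q) <= (492 / 100 * j + 22 / 10) / 4 * Q.
  have c0 : 0 <= 492 / 100 * j + 22 / 10 by lra.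
  rewrite -[leRHS]mulrA; apply: (ler_wpM2l c0); exact: ler_wpM2r.
have a3 := ler_wpM2l k0 a2; have a4 := ler_wpM2r Q0 rate; have a5 := ler_wpM2r N0 a1.
by lra.
Qed.

Let x3_ge0 : 0 <= x ^- 3. Proof. exact: ltW. Qed.

Let inner_error z m : Z z ->
  Z (inner_loop Z F gamma eta p H z m) /\
  dotv (inner_loop Z F gamma eta p H z m - X z m) (inner_loop Z F gamma eta p H z m - X z m)
  <= x ^- 3 * dotv (z - X z m) (z - X z m).
Proof.
move=> Zz; have [Zu hu] := inner_loop_contraction_fast Z_nonempty Z_closed Z_convex L_gt0
  F_lipschitz F_monotone gamma_gt0 H eta_gt0 eta_L Lg Zz (X_sol z m).
split=> //; apply: le_trans hu _; apply: ler_wpM2r (dotv_ge0 _) _ _ _.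
by have [] := x_power_bounds x_ge H_ge.
Qed.

Let state := ('rV[R]_d * 'rV[R]_d)%type.

(* A state of the algorithm together with the previous state (z', m') and the
   shadow sequences (y, mb) of z and m. *)
Let lifted := (state * (state * state))%type.

Definition lifted_round (j : 'I_n.+1 * bool) (s : lifted) : lifted :=
  (round Z F gamma eta p H j s.1,
   (s.1, (X s.1.1 s.1.2 - lam *: (X s.1.1 s.1.2 - s.2.2.1),
          if j.2 then s.2.2.1 else s.2.2.2))).

Definition lifted_in (s : lifted) : Prop :=
  [/\ Z s.1.1, Z s.1.2, Z s.2.1.2, Z s.2.2.1 & Z s.2.2.2].

Lemma lifted_round_in j s : lifted_in s -> lifted_in (lifted_round j s).
Proof.
case: s => [[z m] [[zp mp] [yt mb]]] [/= Zz Zm Zmp Zy Zb]; split => //=.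
- exact: outer_step_in.
- by case: ifP.
- have [Zx _] := X_sol z m.
  have := segment_in Z_convex lam_ge0 (le1_of_le lam_le) Zx Zy; congr (Z _).
  by rewrite -scalerN opprB.
- by case: ifP.
Qed.

(** The first weight is of order [p], because the potential contains [|m - mb|^2 / p], which starts
    at [|z0 - zstar|^2 / p]. *)
Let weight k := iter k (next_weight p t x) (p / 128).

Let weight_good k : good_weight p t x (weight k).
Proof.
elim: k => [|k IH]; last exact: (next_weight_good p_gt0 p_le x_ge t_gt0).
split; first exact: lexx.
have v0 : 0 < x^-1 by rewrite invr_gt0.
have v1 : x^-1 <= 160^-1 by rewrite lef_pV2// posrE ltr0n.
have v2 : x^-1 * x^-1 <= 160^-1 * 160^-1 by apply: ler_pM => //; exact: ltW.
have E3 : x ^- 3 = x^-1 * (x^-1 * x^-1) by rewrite -exprVn !exprS expr0 mulr1.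
have v3 : x ^- 3 <= x^-1 * (160^-1 * 160^-1) by rewrite E3 ler_pM2l.
have w1 : p / 128 * (p / 128) <= 512^-1 * 512^-1.
  have h : p / 128 <= 512^-1 by move: p_le; lra.
  by apply: ler_pM => //; apply: divr_ge0 (ler0n _ _); exact: ltW.
have w0 : 0 <= p / 128 * (p / 128).
  by apply: mulr_ge0; apply: divr_ge0 (ler0n _ _); exact: ltW.
have -> : 3 / (2 * x) = 3 / 2 * x^-1 by rewrite invfM mulrA.
have h := ler_pM w0 (ltW t_gt0) w1 t_le.
by apply: le_trans h _; lra.
Qed.

Definition lifted_potential k (s : lifted) :=
  potential F zstar gamma p lam X (value_weight p x (weight k)) (weight k)
    s.2.1.1 s.2.1.2 s.1.1 s.1.2 s.2.2.1 s.2.2.2.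

Let value (s : lifted) := dotv (s.1.1 - zstar) (s.1.1 - zstar).

Lemma lifted_potential_ge k s : lifted_in s ->
  value s + (1 - lam) * dotv (s.1.2 - zstar) (s.1.2 - zstar) <= lifted_potential k s.
Proof.
case=> [Zz Zm Zmp Zy Zb].
have [B1 _] := value_weight_bounds p_gt0 p_le x_ge px_ge (weight_good k).
have [w0 _ _] := good_weight_bounds p_gt0 p_le x_ge px_ge t_gt0 t_le epsE (weight_good k).
have pg := potential_ge zstar_sol gamma_gt0 p_gt0 lam_le X_sol (value_weight p x (weight k)) s.2.1.1
  s.2.1.2 s.1.1 s.1.2 (ltW w0) Zy Zb.
apply: le_trans pg; rewrite ler_peMl//; apply: addr_ge0; first exact: dotv_ge0.
by apply: mulr_ge0 (dotv_ge0 _); rewrite subr_ge0; exact: (le1_of_le lam_le).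
Qed.

Lemma lifted_potential_step k s : lifted_in s ->
  averaged (@draw_weight R n p) lifted_round (lifted_potential k.+1) s
    <= (1 - t / 2) * lifted_potential k s.
Proof.
case: s => [[z m] [[zp mp] [yt mb]]] [/= Zz Zm Zmp Zy Zb].
rewrite /averaged sum_draw_weight /lifted_potential /= -/(weight k).
set w := weight k; have gw : good_weight p t x w := weight_good k.
have [_ tp _ _] := hard_params p_gt0 p_le x_ge px_ge t_gt0 t_le epsE.
have t1 : 0 < 1 - t / 2 by move: tp p_le; rewrite -/t; lra.
have tp' : t <= p / 100 by move: tp p_gt0; rewrite -/t; lra.
have kE : (1 - t / 2)^-1 * (1 - t / 2) = 1 by rewrite mulVf// gt_eqF.
have [w0 _ _] := good_weight_bounds p_gt0 p_le x_ge px_ge t_gt0 t_le epsE gw.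
have [tau [tau0 tau1 BB htau herr]] :=
  value_weight_step p_gt0 p_le x_ge px_ge t_gt0 t_le epsE gw kE lam_sqr.
have [[c1 c2 c3] [c4 c5 c6] [c7 c8 c9] c10] :=
  weight_conditions p_gt0 p_le x_ge px_ge t_gt0 t_le epsE gw kE.
have [B1 _] := value_weight_bounds p_gt0 p_le x_ge px_ge (weight_good k.+1).
rewrite /= -/(weight k) -/w in B1.
have [Zu hu] := inner_error m Zz.
have [ept ep] := eps_sqr.
have al := inner_loop_aligned Zz Zm Zy.
have et0 : 0 <= 3 / (2 * x) by apply: divr_ge0; [exact: ler0n | apply: mulr_ge0 (ler0n _ _) (ltW x_gt0)].
have et1 := alignment_error_le x_ge.
apply: (potential_step Z_nonempty Z_closed Z_convex L_gt0 mu_gt0 F_lipschitz F_strongly_monotone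
  zstar_in zstar_sol gamma_gt0 p_gt0 p_le lam_ge0 lam_le X_sol zp Zmp Zz Zm Zy Zb Zu tau0 tau1
  x3_ge0 th_le1 lam_sqr tp' ept ep kE B1 BB htau w0 c1 c2 c3 c4 c5 c6 c7 c8 c9 c10 et0 et1 hu al).
set u := inner_loop _ _ _ _ _ _ _ _ in Zu hu al *.
set rh := u - X z m - lam *: (z - X z m).
have N0 := dotv_ge0 (z - yt).
have Q0 : 0 <= Qv z m yt by exact: (inner_normal_ge0 gamma_gt0 X_sol).
apply: (herr _ (Qv z m yt + dotv (z - yt) (z - yt)) (dotv (z - yt) (z - yt)) (dotv rh rh)
  _ (dotv_ge0 _) N0 _ (dotv_ge0 _) _ _ al).
- by rewrite lerDr.
- have := sqr_sum_le (u - X z m) (- (lam *: (z - X z m))).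
  rewrite -/rh dotvNl dotvNr opprK dotvZl dotvZr (mulrA lam) -expr2.
  have h := ler_wpM2r (dotv_ge0 (z - X z m)) lam_sqr.
  exact: double_sum_le hu h.
- have rE : rh = (u - (X z m - lam *: (X z m - yt))) + - (lam *: (z - yt)).
    by rewrite /rh; apply/rowP => j; rewrite !mxE; ring.
  rewrite [in leLHS]rE; apply: le_trans (sqr_sum_le _ _) _.
  by rewrite dotvNl dotvNr opprK (dotvZl lam) (dotvZr lam) (mulrA lam) -expr2.
Qed.

(** Write [A] and [B] for the squared distances of [z] and [m]. A round leads to about
    [(1 - p) * A + p * B], and the potential dominates [A + (1 - lam) * B], so [p * B] is at most
    about [p] times the potential minus [p * A]. *)
Lemma lifted_value_step k s : lifted_in s ->
  averaged (@draw_weight R n p) lifted_round value s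
    <= (1 - 2 * p) * value s + 103 / 100 * p * lifted_potential k s.
Proof.
move=> hs; have := lifted_potential_ge k hs.
move: hs (lifted_potential k s).
case: s => [[z m] [[zp mp] [yt mb]]] [/= Zz Zm _ _ _] W hW.
rewrite /averaged sum_draw_weight /value /=.
under eq_bigr do rewrite -mulrDl addrCA subrr addr0 mul1r.
have [Zu hu] := inner_error m Zz; have [Zx _] := X_sol z m; rewrite -/X in Zx.
have [_ tp _ thp] := hard_params p_gt0 p_le x_ge px_ge t_gt0 t_le epsE.
have [ept ep] := eps_sqr.
have := outer_step_dist Z_nonempty Z_closed Z_convex L_gt0 F_lipschitz gamma_gt0 Zm zstar_in Zu.
set u := inner_loop _ _ _ _ _ _ _ _ in Zu hu *; set xx := X z m in Zx hu *.
pose al := z - xx; pose be := m - xx; pose e := u - xx; pose q := xx - zstar.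
have muE : m - u = be - e by rewrite /be /e; apply/rowP => j; rewrite !mxE; ring.
have zE : z - zstar = al + q by rewrite /al /q addrA subrK.
have mE : m - zstar = be + q by rewrite /be /q addrA subrK.
have uE : u - zstar = e + q by rewrite /e /q addrA subrK.
pose Dv v := gamma *: (avg_op F v - F ord0 v).
pose Y1 := Dv xx - Dv u; pose Y2 := Dv m - Dv u.
have DL := Dv_lipschitz L_gt0 F_lipschitz gamma_gt0.
have hY1 : dotv Y1 Y1 <= 4 * eps ^+ 2 * dotv e e.
  apply: le_trans (DL _ _ Zx Zu) _; by rewrite -(opprB u) dotvNl dotvNr opprK.
have hY2 : dotv Y2 Y2 <= 4 * eps ^+ 2 * dotv (be - e) (be - e).
  by rewrite -muE; exact: (DL _ _ Zm Zu).
have Y12 : Y2 - Y1 = Dv m - Dv xx by rewrite /Y1 /Y2 opprB addrA subrK.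
have hY : dotv (Y2 - Y1) (Y2 - Y1) <= 4 * eps ^+ 2 * dotv be be.
  by rewrite Y12; exact: (DL _ _ Zm Zx).
pose phx := gamma * dotv (avg_op F zstar) q.
have phx0 : 0 <= phx by apply: mulr_ge0; [exact: ltW | exact: zstar_sol].
have hvi : t * dotv q q + phx + dotv (Y2 - Y1) q <= (1 - p) * dotv al q + p * dotv be q.
  rewrite Y12; exact: (exact_step F_strongly_monotone zstar_in gamma_gt0 X_sol Zz Zm).
pose rh := e - lam *: al.
have eE : e = lam *: al + rh by rewrite /rh addrC subrK.
have tau0 : 0 < 16 * x ^- 3 by apply: mulr_gt0 th_gt0; exact: ltr0n.
have tau1 : 16 * x ^- 3 <= 1 by exact: small_mul16.
have pd := potential_descent p_gt0 p_le lam_ge0 lam_le t_gt0 tau0 tau1 x3_ge0 th_le1 ept ep phx0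
    lam_sqr eE hu hY1 hY2 hY hvi.
have hD := potential_dist p_gt0 p_le t_gt0 ept phx0 hY hvi.
rewrite uE muE -/(Dv m) -/(Dv u) -/Y2 => hE; apply: le_trans (le_trans hE pd) _.
have hrh : 2 / (16 * x ^- 3) * dotv rh rh <= 2^-1 * dotv al al.
  have -> : 2 / (16 * x ^- 3) * dotv rh rh = dotv rh rh / (8 * x ^- 3).
    by field; rewrite gt_eqF.
  rewrite ler_pdivrMr; last by apply: mulr_gt0 th_gt0; exact: ltr0n.
  have := sqr_sum_le e (- (lam *: al)).
  rewrite -/rh dotvNl dotvNr opprK dotvZl dotvZr (mulrA lam) -expr2.
  have h := ler_wpM2r (dotv_ge0 al) lam_sqr.
  have -> : 2^-1 * dotv al al * (8 * x ^- 3) = 4 * (x ^- 3 * dotv al al) by field; rewrite gt_eqF.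
  exact: double_sum_le hu h.
rewrite /value /= zE mE in hW *; rewrite -/al in hrh *.
have p0 := ltW p_gt0.
have s0 := dotv_ge0 al; have r0 := mulr_ge0 p0 (dotv_ge0 be); have D0 := dotv_ge0 q.
have tD := mulr_ge0 (ltW t_gt0) D0; have A0 := dotv_ge0 (al + q); have B0 := dotv_ge0 (be + q).
have pW := ler_wpM2l p0 hW; rewrite mulrDr in pW.
have hthD : x ^- 3 * dotv q q <= p / 10000 * dotv q q by exact: (ler_wpM2r D0 thp).
have hpD : p * dotv q q <= p * (dotv (al + q) (al + q) + 4^-1 * dotv (be + q) (be + q)).
  apply: (ler_wpM2l p0); apply: le_trans hD _; apply: lerD; last exact: ler_wpM2r.
  by rewrite ler_piMl// gerBl.
have lA := ler_wpM2r A0 (ler_wpM2l p0 lam_le); have lB := ler_wpM2r B0 (ler_wpM2l p0 lam_le).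
have pA := mulr_ge0 p0 A0; have pB := mulr_ge0 p0 B0.
exact: (value_step_bound hrh s0 r0 tD pA pB pW hthD hpD lA lB phx0).
Qed.

Lemma lifted_potential_start z0 : Z z0 ->
  lifted_potential 0 ((z0, z0), ((zstar, zstar), (zstar, zstar)))
    <= 5 / 2 * dotv (z0 - zstar) (z0 - zstar).
Proof.
move=> Zz; rewrite /lifted_potential /=.
have [_] := value_weight_bounds p_gt0 p_le x_ge px_ge (weight_good 0); rewrite /=.
move: (value_weight _ _ _) => B hB.
rewrite /potential /speed -/(X zstar zstar) X_zstar !subrr !dotv0r.
rewrite !(mulr0, mul0r, addr0, add0r).
have -> : zstar + p *: 0 - zstar = 0 :> 'rV[R]_d by rewrite scaler0 addr0 subrr.
rewrite !dotv0l !(mulr0, mul0r, addr0, add0r).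
have a0 := dotv_ge0 (z0 - zstar); move: (dotv _ _) a0 => a a0.
have c1 : a + (1 - lam) * a <= 2 * a.
  have := mulr_ge0 lam_ge0 a0; lra.
have c10 : 0 <= a + (1 - lam) * a.
  by apply: (addr_ge0 a0); apply: mulr_ge0 a0; rewrite subr_ge0; exact: (le1_of_le lam_le).
have h1 := le_trans (ler_wpM2r c10 hB) (ler_wpM2l _ c1).
have pa := mulr_ge0 (ltW p_gt0) a0; have pa4 := ler_wpM2r a0 p_le.
have ppa := ler_wpM2l (ltW p_gt0) pa4.
have E : (14 * (p / 128) + 3 * (p / 128 * (p / 128))) * (2 * a + a / p) =
  14 / 128 * (2 * (p * a) + a) + 3 / (128 * 128) * (2 * (p * (p * a)) + p * a).
  by field; rewrite gt_eqF.
rewrite E.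
have h2 : 0 <= 112 / 100 :> R by apply: divr_ge0; exact: ler0n.
have h12 := h1 h2.
exact: (start_bound h12 ppa pa4 pa a0).
Qed.

Theorem hard_regime_rate z0 K : Z z0 ->
  iter K (averaged (@draw_weight R n p) (round Z F gamma eta p H))
    (fun s => dotv (s.1 - zstar) (s.1 - zstar)) (z0, z0)
  <= (1 - t / 2) ^+ K * (2 * dotv (z0 - zstar) (z0 - zstar)).
Proof.
move=> Zz.
(* The shadows follow the state without acting on it, so the lifted chain projects to the original
   one. *)
have proj_iter (f : state -> R) k s :
    iter k (averaged (@draw_weight R n p) lifted_round) (fun s => f s.1) s =
    iter k (averaged (@draw_weight R n p) (round Z F gamma eta p H)) f s.1.
  elim: k s => // k IH s /=; rewrite /averaged; apply: eq_bigr => j _.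
  by rewrite IH.
pose s0 : lifted := ((z0, z0), ((zstar, zstar), (zstar, zstar))).
have hs0 : lifted_in s0 by [].
rewrite -(proj_iter (fun s => dotv (s.1 - zstar) (s.1 - zstar)) K s0).
have p0 := ltW p_gt0.
have p1 : p <= 1 by move: p_le; lra.
have w0 j : 0 <= @draw_weight R n p j by exact: draw_weight_ge0.
have [_ tp _ _] := hard_params p_gt0 p_le x_ge px_ge t_gt0 t_le epsE; rewrite -/t in tp.
have r0 : 0 <= 1 - 2 * p by move: p_le; lra.
have rq : 1 - 2 * p <= 1 - t / 2 by move: tp p_gt0; lra.
(* Here [103 / 100 * p] is close to half of the gap [2 * p - t / 2] between the rates, so [3 / 4] is
   admissible. Times the initial [5 / 2] it gives [15 / 8], below the factor 2 to be proved. *)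
have c0 : 0 <= 3 / 4 :> R by apply: divr_ge0; exact: ler0n.
have ec : 103 / 100 * p <= 3 / 4 * (1 - t / 2 - (1 - 2 * p)) by move: tp p_gt0; lra.
have W0 k s : lifted_in s -> 0 <= lifted_potential k s.
  move=> hs; apply: le_trans (lifted_potential_ge k hs); apply: addr_ge0; first exact: dotv_ge0.
  by apply: mulr_ge0 (dotv_ge0 _); rewrite subr_ge0; exact: (le1_of_le lam_le).
have := averaged_perturbed_contraction w0 lifted_round_in r0 rq c0 ec W0 lifted_potential_step
  (fun k s hs => lifted_value_step k hs) K 0 hs0.
rewrite /value /= => h; apply: le_trans h _.
have := lifted_potential_start Zz; rewrite -/s0.
have a0 := dotv_ge0 (z0 - zstar); move: (dotv _ _) (lifted_potential _ _) a0 => a W a0 hW.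
have rqK : (1 - 2 * p) ^+ K <= (1 - t / 2) ^+ K by apply: ler_exp_nonneg.
have rK := exprn_ge0 K r0; have qK := exprn_ge0 K (le_trans r0 rq).
have d0 : 0 <= 3 / 4 * ((1 - t / 2) ^+ K - (1 - 2 * p) ^+ K).
  by apply: (mulr_ge0 c0); rewrite subr_ge0.
have h1 := ler_wpM2l d0 hW; have h2 := mulr_ge0 rK a0; have h3 := mulr_ge0 qK a0.
apply: le_trans (lerD (lexx _) h1) _.
move: h2 h3; move: ((1 - 2 * p) ^+ K) ((1 - t / 2) ^+ K) => b c; lra.
Qed.

End hard_regime_rate.

(** * Case distinction on the step size *)

Theorem theoremC4 (R : realType) (d n : nat) (Z : set 'rV[R]_d)
  (F : 'I_n.+1 -> 'rV[R]_d -> 'rV[R]_d) (L mu delta : R)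
  (Z_nonempty : Z !=set0) (Z_closed : closed Z)
  (Z_convex : @convex_set R 'rV[R]_d Z)
  (L_gt0 : 0 < L) (mu_gt0 : 0 < mu) (delta_gt0 : 0 < delta)
  (F_lipschitz : forall i u v, Z u -> Z v ->
    enorm (F i u - F i v) <= L * enorm (u - v))
  (F_strongly_monotone : forall u v, Z u -> Z v ->
    mu * enorm (u - v) ^+ 2 <= dotv (avg_op F u - avg_op F v) (u - v))
  (F_monotone : forall i u v, Z u -> Z v -> 0 <= dotv (F i u - F i v) (u - v))
  (F_similar : forall j u v, Z u -> Z v ->
    n.+1%:R^-1 * \sum_i enorm (F i u - F j u - F i v + F j v) ^+ 2
      <= delta ^+ 2 * enorm (u - v) ^+ 2)
  (zstar : 'rV[R]_d) (zstar_in : Z zstar)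
  (zstar_sol : forall z, Z z -> 0 <= dotv (avg_op F zstar) (z - zstar))
  (gamma eta tau p : R) (H : nat)
  (gamma_gt0 : 0 < gamma) (eta_gt0 : 0 < eta)
  (p_gt0 : 0 < p) (p_le1 : p <= 1) (H_ge1 : (1 <= H)%N)
  (tauE : tau = p) (p_le : p <= 1 / 4)
  (gammaE : gamma = Num.min (Num.min (p / (3 * mu)) (Num.sqrt p / (4 * delta)))
    (1 / L * (H%:R / (4 * ln (40 * L / (mu * p))) - 1)))
  (etaE : eta = 1 / (4 * (L + 1 / gamma)))
  (H_ge : 8 * ln (40 * L / (mu * p)) <= H%:R)
  (z0 : 'rV[R]_d) (z0_in : Z z0)
  (dd : measure_display) (Om : measurableType dd) (P : probability Om R)
  (idx : nat -> Om -> 'I_n.+1) (coin : nat -> Om -> bool)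
  (draws : algorithm_draws P p idx coin) (K : nat) :
  ('E_P[fun w => (enorm ((three_pillars Z F gamma eta tau H z0
            (fun k => idx k w) (fun k => coin k w) K).1 - zstar) ^+ 2)%R]
    <= ((1 - gamma * mu / 2) ^+ K * (2 * enorm (z0 - zstar) ^+ 2))%R%:E)%E.
Proof.
subst tau.
have p4 : p <= 4^-1 by move: p_le; rewrite div1r.
have gamma_mu : gamma * mu <= p / 3.
  have g : gamma <= p / (3 * mu) by rewrite gammaE !ge_min lexx.
  apply: le_trans (ler_wpM2r (ltW mu_gt0) g) _.
  by rewrite le_eqVlt; apply/orP; left; apply/eqP; field; rewrite gt_eqF.
have gamma_delta : (gamma * delta) ^+ 2 <= p / 16.
  have g : gamma <= Num.sqrt p / (4 * delta) by rewrite gammaE !ge_min lexx orbT.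
  have h : gamma * delta <= Num.sqrt p / 4.
    apply: le_trans (ler_wpM2r (ltW delta_gt0) g) _.
    by rewrite le_eqVlt; apply/orP; left; apply/eqP; field; rewrite gt_eqF.
  have {}h : (gamma * delta) ^+ 2 <= (Num.sqrt p / 4) ^+ 2.
    by apply: lerXn2r; rewrite ?nnegrE ?divr_ge0 ?sqrtr_ge0// mulr_ge0// ltW.
  apply: le_trans h _; rewrite exprMn sqr_sqrtr ?(ltW p_gt0)//.
  by have -> : (4^-1 : R) ^+ 2 = 16^-1 by field.
have gL0 : 0 < L * gamma + 1 by rewrite ltr_wpDl// mulr_ge0 ?ltW.
have L0 : 0 < L + gamma^-1 by rewrite addr_gt0// invr_gt0.
have eta_L : eta * (L + gamma^-1) = 4^-1.
  by rewrite etaE !div1r; field; rewrite !gt_eqF.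
have f0 (s : 'rV[R]_d * 'rV[R]_d) : 0 <= dotv (s.1 - zstar) (s.1 - zstar) by exact: dotv_ge0.
suff rate : iter K (averaged (@draw_weight R n p) (round Z F gamma eta p H))
    (fun s => dotv (s.1 - zstar) (s.1 - zstar)) (z0, z0)
    <= (1 - gamma * mu / 2) ^+ K * (2 * dotv (z0 - zstar) (z0 - zstar)).
  rewrite unlock sqr_enorm.
  have intE := expectation_trajectory Z F gamma eta p H z0 draws
    (ltW p_gt0) p_le1 f0 K.
  under eq_integral do rewrite sqr_enorm.
  by rewrite intE lee_fin.
set x := 40 * L / (mu * p) in gammaE H_ge.
have mp0 : 0 < mu * p by rewrite mulr_gt0.
have descent := descent_rate Z_nonempty Z_closed Z_convex L_gt0 mu_gt0 delta_gt0 F_lipschitz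
  F_strongly_monotone F_monotone F_similar zstar_in zstar_sol gamma_gt0 p_gt0 p4 gamma_mu
  gamma_delta.
have [muL|Lmu] := leP mu L; last first.
  (* All conditions on [th] presuppose [mu <= L]; the value 0 is a placeholder. *)
  by apply: (descent eta H 0) => //; rewrite leNgt Lmu.
have px : 40 <= p * x.
  have -> : p * x = 40 * (L / mu) by rewrite /x; field; rewrite !gt_eqF.
  by rewrite ler_peMr ?ler0n// ler_pdivlMr// mul1r.
have x160 : 160 <= x.
  have x0 : 0 <= x by rewrite divr_ge0 ?(ltW mp0)// mulr_ge0 ?ler0n ?ltW.
  by have := ler_wpM2r x0 p4; move: px; clear; lra.
have x0 : 0 < x by apply: lt_le_trans x160; rewrite ltr0n.
have v1 : x^-1 <= 160^-1 by rewrite lef_pV2// posrE ltr0n.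
(* [10 / x] equals [mu * p / (4 * L)], so [10 / x <= gamma * mu] says exactly
   [p / 4 <= L * gamma]. *)
have [gL|gL] := leP (p / 4) (L * gamma).
  apply: (descent eta H x^-1) => // _.
    have -> : x^-1 = mu * p / (40 * L) by rewrite /x invf_div.
    have -> : 10 * (mu * p / (40 * L)) = mu * (p / 4 / L) by field; rewrite gt_eqF.
    by rewrite (mulrC gamma) ler_pM2l// ler_pdivrMr// (mulrC gamma).
  move=> z m u Zz sol.
  have [Zu hu] := inner_loop_contraction Z_nonempty Z_closed Z_convex L_gt0
    F_lipschitz F_monotone gamma_gt0 H eta_gt0 eta_L Zz sol.
  split=> //; apply: le_trans hu _; apply: ler_wpM2r (dotv_ge0 _) _ _ _.
  have lnx : 0 < ln x by rewrite ln_gt0//; apply: lt_le_trans x160; rewrite ltr1n.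
  (* The third bound on [gamma] amounts to [ln x <= (eta / gamma) * H], so the loop reaches the
     accuracy [1 / x]. *)
  have hg : L * gamma + 1 <= H%:R / (4 * ln x).
    have g : gamma <= 1 / L * (H%:R / (4 * ln x) - 1) by rewrite gammaE !ge_min lexx !orbT.
    by rewrite -lerBrDr -ler_pdivlMl// -[L^-1]div1r.
  have rhoE : eta / gamma = (4 * (L * gamma + 1))^-1.
    by rewrite etaE !div1r; field; rewrite !gt_eqF.
  have hH : ln x <= eta / gamma * H%:R.
    rewrite rhoE mulrC ler_pdivlMr ?mulr_gt0//.
    by move: hg; rewrite ler_pdivlMr ?mulr_gt0//; clear; lra.
  apply: (@le_trans _ _ (expR (- (eta / gamma)) ^+ H)).
    apply: lerXn2r; rewrite ?nnegrE ?expR_ge0 ?expR_ge1Dx//.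
    rewrite subr_ge0 rhoE invf_le1 ?mulr_gt0//.
    by have := mulr_gt0 L_gt0 gamma_gt0; clear; lra.
  rewrite -expRM_natl -[x]lnK ?posrE// -expRN ler_expR.
  by rewrite mulrN lerN2 mulrC.
have gL16 : L * gamma <= 16^-1 by move: gL p4; clear; lra.
have [xt|tx] := leP (10 * x ^- 3) (gamma * mu); last first.
  apply: (hard_regime_rate Z_nonempty Z_closed Z_convex L_gt0 mu_gt0 F_lipschitz
    F_strongly_monotone F_monotone zstar_in zstar_sol gamma_gt0 eta_gt0 p_gt0 p4 eta_L x160 px
    (ltW tx) _ H_ge) => //.
  by rewrite /x; field; rewrite !gt_eqF.
apply: (descent eta H (x ^- 3)) => // _.
  have v0 : 0 < x^-1 by rewrite invr_gt0.
  have v2 : x^-1 * x^-1 <= 160^-1 * 160^-1 by apply: ler_pM => //; exact: ltW.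
  have E3 : x ^- 3 = x^-1 * (x^-1 * x^-1) by rewrite -exprVn !exprS expr0 mulr1.
  have := ler_wpM2l (ltW v0) v2; rewrite -E3; clear -v1 v0; lra.
move=> z m u Zz sol.
have [Zu hu] := inner_loop_contraction_fast Z_nonempty Z_closed Z_convex L_gt0
  F_lipschitz F_monotone gamma_gt0 H eta_gt0 eta_L gL16 Zz sol.
split=> //; apply: le_trans hu _; apply: ler_wpM2r (dotv_ge0 _) _ _ _.
by have [] := x_power_bounds x160 H_ge.
Qed.
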